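(* Let $p$ be a prime number and $q=p^m$ with $m\geq 1$, where $m>1$ if $p\in\{2,3\}$, and let $G=\mathrm{PSL}_2(q)$. Let $\Omega=\Omega_{M,\omega}$ be a non-trivial twist of $\mathbb{C}G$ arising from a normalized $2$-cocycle $\omega:\widehat M\times\widehat M\to\mathbb C^\times$ for an abelian subgroup $M$ of $G$. Then the complex semisimple Hopf algebra $(\mathbb{C}G)_{\Omega}$ does not admit a Hopf order over any number ring.
   Context: Twists: let $M$ be an abelian subgroup of a finite group $G$. Let $\widehat M$ be the group of homomorphisms $M\to \mathbb C^\times$, and for $\phi\in\widehat M$ put $e_\phi=\frac{1}{|M|}\sum_{v\in M}\phi(v^{-1})v\in \mathbb CM$. A $2$-cocycle $\omega:\widehat M\times\widehat M\to \mathbb C^\times$ (trivial action) is normalized if $\omega(\phi,\varepsilon)=\omega(\varepsilon,\phi)=1$ for the trivial character $\varepsilon$ and all $\phi$. Put $\Omega=\Omega_{M,\omega}=\sum_{\phi,\psi\in\widehat M}\omega(\phi,\psi)\,e_\phi\otimes e_\psi\in \mathbb CG\otimes \mathbb CG$. The twist is called non-trivial if the cohomology class of $\omega$ is non-trivial, i.e. $\omega$ is not a coboundary. The Hopf algebra $(\mathbb CG)_{\Omega}$ has the algebra structure and counit of $\mathbb CG$, coproduct $\Delta_\Omega(g)=\Omega(g\otimes g)\Omega^{-1}$ and antipode $S_\Omega(g)=Q\,g^{-1}Q^{-1}$ for $g\in G$, where $Q=\sum\Omega^{(1)}S(\Omega^{(2)})$, $\Omega=\sum\Omega^{(1)}\otimes\Omega^{(2)}$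 and $S$ is the antipode of $\mathbb CG$. Hopf orders: let $H$ be a finite-dimensional Hopf algebra over a field $K$ and $R$ a subring of $K$. A Hopf order of $H$ over $R$ is a finitely generated projective $R$-submodule $X\subseteq H$ such that the natural map $X\otimes_R K\to H$ is an isomorphism and $1_H\in X$, $XX\subseteq X$, $\Delta(X)\subseteq X\otimes_R X$, $\varepsilon(X)\subseteq R$, $S(X)\subseteq X$. Here $K=\mathbb C$. A number ring is the ring of algebraic integers $\mathcal O_L$ of a number field $L\subset\mathbb C$. *)

(* Defs.v *)
From HB Require Import structures.
From mathcomp Require Import all_boot all_order all_fingroup all_algebra.
From mathcomp Require Import all_solvable all_field.
From mathcomp Require Import boolp reals complex.

Set Implicit Arguments.
Unset Strict Implicit.
Unset Printing Implicit Defensive.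

Import GroupScope GRing.Theory.
Local Open Scope ring_scope.

(* The group algebra K G of a finite group: functions G -> K under            *)
(* convolution. The type synonym is needed because {ffun gT -> K} itself      *)
(* carries the pointwise ring structure.                                      *)
Definition group_algebra (K : fieldType) (gT : finGroupType) : Type :=
  {ffun gT -> K^o}.

Section GroupAlgebra.
Variables (K : fieldType) (gT : finGroupType).
Local Notation KG := (group_algebra K gT).

HB.instance Definition _ := Vector.copy KG {ffun gT -> K^o}.

Definition ga_val (a : KG) : gT -> K := fun_of_fin a.
Definition ga_mk (f : gT -> K) : KG := [ffun g => f g : K^o].

Lemma ga_mkE f g : ga_val (ga_mk f) g = f g.
Proof. exact: ffunE. Qed.

Lemma ga_ext (a b : KG) : ga_val a =1 ga_val b -> a = b.
Proof. by move=> eq_ab; apply/ffunP. Qed.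

Lemma ga_valD (a b : KG) g : ga_val (a + b) g = ga_val a g + ga_val b g.
Proof. exact: ffunE. Qed.

Lemma ga_valZ k (a : KG) g : ga_val (k *: a) g = k * ga_val a g.
Proof. exact: ffunE. Qed.

Lemma ga_val0 g : ga_val (0 : KG) g = 0.
Proof. exact: ffunE. Qed.

Definition ga_mul (a b : KG) : KG :=
  ga_mk (fun g => \sum_h ga_val a h * ga_val b (h^-1 * g)%g).

Definition ga_elt (g : gT) : KG := ga_mk (fun h => (h == g)%:R).

Fact ga_mulA : associative ga_mul.
Proof.
move=> a b c; apply: ga_ext => g; rewrite !ga_mkE.
under eq_bigr => h _ do rewrite ga_mkE mulr_sumr.
under [RHS]eq_bigr => h _ do rewrite ga_mkE mulr_suml.
rewrite [RHS]exchange_big /=; apply: eq_bigr => h _.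
rewrite [RHS](reindex_inj (mulgI h)) /=; apply: eq_bigr => k _.
by rewrite mulrA mulKg invMg mulgA.
Qed.

Fact ga_mul1 : left_id (ga_elt 1%g) ga_mul.
Proof.
move=> a; apply: ga_ext => g; rewrite ga_mkE (bigD1 1%g) //= ga_mkE eqxx.
rewrite invg1 mul1g mul1r big1 ?addr0 // => h /negbTE h1.
by rewrite ga_mkE h1 mul0r.
Qed.

Fact ga_mulr1 : right_id (ga_elt 1%g) ga_mul.
Proof.
move=> a; apply: ga_ext => g; rewrite ga_mkE (bigD1 g) //= ga_mkE.
rewrite mulVg eqxx mulr1 big1 ?addr0 // => h hg.
rewrite ga_mkE -(inj_eq (mulgI h)) mulKVg mulg1 eq_sym.
by rewrite (negbTE hg) mulr0.
Qed.

Fact ga_mulDl : left_distributive ga_mul +%R.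
Proof.
move=> a b c; apply: ga_ext => g; rewrite ga_valD !ga_mkE -big_split /=.
by apply: eq_bigr => h _; rewrite ga_valD mulrDl.
Qed.

Fact ga_mulDr : right_distributive ga_mul +%R.
Proof.
move=> a b c; apply: ga_ext => g; rewrite ga_valD !ga_mkE -big_split /=.
by apply: eq_bigr => h _; rewrite ga_valD mulrDr.
Qed.

Fact ga_1neq0 : ga_elt 1%g != 0.
Proof.
apply/eqP => /(congr1 (fun a => ga_val a 1%g)) /eqP.
by rewrite ga_mkE ga_val0 eqxx oner_eq0.
Qed.

HB.instance Definition _ := GRing.Zmodule_isNzRing.Build KG
  ga_mulA ga_mul1 ga_mulr1 ga_mulDl ga_mulDr ga_1neq0.

Lemma ga_mulE (a b : KG) g :
  ga_val (a * b) g = \sum_h ga_val a h * ga_val b (h^-1 * g)%g.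
Proof. exact: ga_mkE. Qed.

Lemma ga_oneE : 1 = ga_elt 1%g :> KG.
Proof. by []. Qed.

Lemma ga_eltM (x y : gT) : ga_elt (x * y)%g = ga_elt x * ga_elt y :> KG.
Proof.
apply: ga_ext => g; rewrite ga_mulE (bigD1 x) //= !ga_mkE eqxx mul1r.
rewrite -(inj_eq (mulgI x) (x^-1 * g)%g) mulKVg big1 ?addr0 // => h /negbTE hx.
by rewrite ga_mkE hx mul0r.
Qed.

Fact ga_scaleAl (k : K) (a b : KG) : k *: (a * b) = (k *: a) * b.
Proof.
apply: ga_ext => g; rewrite ga_valZ !ga_mkE mulr_sumr.
by apply: eq_bigr => h _; rewrite ga_valZ mulrA.
Qed.

HB.instance Definition _ := GRing.Lmodule_isLalgebra.Build K KG ga_scaleAl.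

Fact ga_scaleAr (k : K) (a b : KG) : k *: (a * b) = a * (k *: b).
Proof.
apply: ga_ext => g; rewrite ga_valZ !ga_mkE mulr_sumr.
by apply: eq_bigr => h _; rewrite ga_valZ mulrCA.
Qed.

HB.instance Definition _ := GRing.Lalgebra_isAlgebra.Build K KG ga_scaleAr.
(* Provides inverses: a^-1 is the two-sided inverse of a if a is invertible,  *)
(* and a otherwise.                                                           *)
HB.instance Definition _ := Algebra_isFalgebra.Build K KG.

(* Linear extension to K G of a map defined on G. *)
Definition ga_lift (V : lmodType K) (f : gT -> V) (a : KG) : V :=
  \sum_g ga_val a g *: f g.

Fact ga_lift_is_linear V f : linear (@ga_lift V f).
Proof.
move=> k a b; rewrite /ga_lift scaler_sumr -big_split /=.
by apply: eq_bigr => g _; rewrite ga_valD ga_valZ scalerDl scalerA.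
Qed.

HB.instance Definition _ (V : lmodType K) (f : gT -> V) :=
  GRing.isLinear.Build K KG V _ (@ga_lift V f) (@ga_lift_is_linear V f).

End GroupAlgebra.

(* K G (x) K G is identified with K (G x G) through g (x) h = (g, h); the     *)
(* function below is the pure tensor a (x) b.                                 *)
Definition ga_tensor (K : fieldType) (gT : finGroupType)
    (a b : group_algebra K gT) : group_algebra K (gT * gT)%type :=
  ga_mk (fun x => ga_val a x.1 * ga_val b x.2).

Section Dual.
Variables (K : closedFieldType) (gT : finGroupType) (M : {group gT}).

(* A multiplicative map with f 1 = 1 takes its values in K^x. *)
Definition is_char (f : {ffun subg_of M -> K}) : bool :=
  (f 1%g == 1) && [forall x, forall y, f (x * y)%g == f x * f y].

Record dual := Dual { dual_fun :> {ffun subg_of M -> K}; _ : is_char dual_fun }.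

HB.instance Definition _ := [isSub for dual_fun].
HB.instance Definition _ := [Choice of dual by <:].

Lemma dual1 (phi : dual) : phi 1%g = 1.
Proof. by case: phi => f /= /andP[/eqP]. Qed.

Lemma dualM (phi : dual) x y : phi (x * y)%g = phi x * phi y.
Proof. by case: phi => f /= /andP[_ /forallP/(_ x)/forallP/(_ y)/eqP]. Qed.

Definition dual_roots : seq K :=
  sval (closed_field_poly_normal ('X^#|[set: subg_of M]| - 1%:P : {poly K})).

Lemma dual_rootsP (phi : dual) x : phi x \in dual_roots.
Proof.
rewrite /dual_roots; case: closed_field_poly_normal => r /= Dp.
have n_gt0 : (0 < #|[set: subg_of M]|)%N by exact: cardG_gt0.
move: Dp; rewrite lead_coefXnsubC // scale1r => Dp.
rewrite -root_prod_XsubC -Dp rootE !hornerE subr_eq0.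
have phiX k : phi (x ^+ k)%g = phi x ^+ k.
  by elim: k => [|k IHk]; rewrite ?expg0 ?dual1 // expgS exprS dualM IHk.
by rewrite -phiX expg_cardG ?inE // dual1.
Qed.

Definition dual_code (phi : dual) :
    {ffun subg_of M -> 'I_(size dual_roots).+1} :=
  [ffun x => inord (index (phi x) dual_roots)].

Definition dual_decode (c : {ffun subg_of M -> 'I_(size dual_roots).+1}) :
    option dual :=
  insub [ffun x => nth 0 dual_roots (c x)].

Lemma dual_codeK : pcancel dual_code dual_decode.
Proof.
move=> phi; rewrite /dual_decode -[RHS](valK phi); congr insub.
apply/ffunP=> x; rewrite !ffunE inordK ?nth_index ?dual_rootsP //.
by rewrite ltnS index_size.
Qed.

HB.instance Definition _ := PCanIsCountable dual_codeK.
HB.instance Definition _ : isFinite dual := PCanIsFinite dual_codeK.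

Fact dual_one_subproof : is_char [ffun=> 1].
Proof.
by rewrite /is_char ffunE eqxx; do 2!apply/forallP=> ?; rewrite !ffunE mulr1.
Qed.
Definition dual_one := Dual dual_one_subproof.

Fact dual_mul_subproof (phi psi : dual) :
  is_char [ffun x => phi x * psi x].
Proof.
rewrite /is_char ffunE !dual1 mulr1 eqxx; do 2!apply/forallP=> ?.
by rewrite !ffunE !dualM mulrACA.
Qed.
Definition dual_mul phi psi := Dual (dual_mul_subproof phi psi).

Fact dual_inv_subproof (phi : dual) : is_char [ffun x => (phi x)^-1].
Proof.
rewrite /is_char ffunE !dual1 invr1 eqxx; do 2!apply/forallP=> ?.
by rewrite !ffunE !dualM invfM.
Qed.
Definition dual_inv phi := Dual (dual_inv_subproof phi).

Lemma dual_neq0 (phi : dual) x : phi x != 0.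
Proof.
apply/eqP=> phi0; have /eqP := dual1 phi.
by rewrite -(mulgV x) dualM phi0 mul0r eq_sym oner_eq0.
Qed.

Fact dual_mulA : associative dual_mul.
Proof. by move=> f g h; apply/val_inj/ffunP=> x; rewrite !ffunE mulrA. Qed.
Fact dual_mul1 : left_id dual_one dual_mul.
Proof. by move=> f; apply/val_inj/ffunP=> x; rewrite !ffunE mul1r. Qed.
Fact dual_mulV : left_inverse dual_one dual_inv dual_mul.
Proof.
by move=> f; apply/val_inj/ffunP=> x; rewrite !ffunE mulVf ?dual_neq0.
Qed.

HB.instance Definition _ := Finite_isGroup.Build dual
  dual_mulA dual_mul1 dual_mulV.

Definition idem (phi : dual) : group_algebra K gT :=
  (#|M|%:R)^-1 *: \sum_(v : subg_of M) phi (v^-1)%g *: ga_elt K (sgval v).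

Definition normalized_2cocycle (omega : dual -> dual -> K) : Prop :=
  [/\ forall phi psi, omega phi psi != 0,
      forall phi psi chi,
        omega phi psi * omega (phi * psi)%g chi =
        omega psi chi * omega phi (psi * chi)%g
    & forall phi, omega phi 1%g = 1 /\ omega 1%g phi = 1].

Definition is_2coboundary (omega : dual -> dual -> K) : Prop :=
  exists2 theta : dual -> K, forall phi, theta phi != 0 &
    forall phi psi,
      omega phi psi = theta phi * theta psi / theta (phi * psi)%g.

Definition twist (omega : dual -> dual -> K) :
    group_algebra K (gT * gT)%type :=
  \sum_(phi : dual) \sum_(psi : dual)
    omega phi psi *: ga_tensor (idem phi) (idem psi).

End Dual.

(* The structure maps of a finite-dimensional Hopf algebra H; ha_sq and       *)
(* ha_tensor are a model of H (x) H and of its pure tensors. The Hopf algebra *)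
(* axioms are not recorded, as the notion of Hopf order does not refer to     *)
(* them.                                                                      *)
Record hopf_data (K : fieldType) := HopfData {
  ha_alg :> falgType K;
  ha_sq : falgType K;
  ha_tensor : ha_alg -> ha_alg -> ha_sq;
  ha_comul : {linear ha_alg -> ha_sq};
  ha_counit : {linear ha_alg -> K^o};
  ha_antipode : {linear ha_alg -> ha_alg} }.

(* J is intended to be a twist; then J and twist_Q are units, so that J^-1    *)
(* and twist_Q^-1 are genuine inverses.                                       *)
Section TwistedGroupAlgebra.
Variables (K : fieldType) (gT : finGroupType).
Variable J : group_algebra K (gT * gT)%type.

(* Q = \sum J^(1) S(J^(2)), with S(g) = g^-1. *)
Definition twist_Q : group_algebra K gT :=
  ga_lift (fun x : gT * gT => ga_elt K x.1 * ga_elt K (x.2^-1)%g) J.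

Definition twisted_group_algebra : hopf_data K :=
  @HopfData K (group_algebra K gT) (group_algebra K (gT * gT)%type)
    (@ga_tensor K gT)
    (ga_lift (fun g => J * ga_tensor (ga_elt K g) (ga_elt K g) * J^-1))
    (ga_lift (fun _ : gT => 1 : K^o))
    (ga_lift (fun g => twist_Q * ga_elt K (g^-1)%g * twist_Q^-1)).

End TwistedGroupAlgebra.

Definition fin_generated (R : nzRingType) (X : lmodType R) : Prop :=
  exists (n : nat) (u : 'I_n -> X),
    forall x, exists c : 'I_n -> R, x = \sum_i c i *: u i.

Definition projective (R : nzRingType) (P : lmodType R) : Prop :=
  forall (A B : lmodType R) (g : {linear A -> B}) (f : {linear P -> B}),
    (forall b, exists a, g a = b) ->
    exists h : {linear P -> A}, forall x, g (h x) = f x.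

(* The natural map X (x)_R K -> H attached to the R-linear map j : X -> H is  *)
(* an isomorphism: (H, j) has the universal property of the extension of      *)
(* scalars of X along iota : R -> K.                                          *)
Definition base_change_iso (R : comNzRingType) (K : fieldType)
    (iota : {rmorphism R -> K}) (X : lmodType R) (H : lmodType K)
    (j : {linear X -> H | iota \; *:%R}) : Prop :=
  forall (W : lmodType K) (f : {linear X -> W | iota \; *:%R}),
    exists2 F : {linear H -> W}, forall x, F (j x) = f x &
      forall F' : {linear H -> W}, (forall x, F' (j x) = f x) -> F' =1 F.

(* A subring of K is given by an injective morphism iota : R -> K, and an     *)
(* R-submodule of H by an injective R-linear map j : X -> H. As X is          *)
(* projective, X (x)_R X embeds in H (x) H with image the set of sums of      *)
(* pure tensors of elements of X.                                             *)
Definition hopf_order (R : comNzRingType) (K : fieldType)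
    (iota : {rmorphism R -> K}) (H : hopf_data K)
    (X : lmodType R) (j : {linear X -> H | iota \; *:%R}) : Prop :=
  (injective j /\ fin_generated X /\ projective X /\ base_change_iso j) /\
  [/\ exists x, j x = 1,
      forall x y, exists z, j z = j x * j y,
      forall x, exists (n : nat) (a b : 'I_n -> X),
        ha_comul H (j x) = \sum_k ha_tensor (j (a k)) (j (b k)),
      forall x, exists r, ha_counit H (j x) = iota r
    & forall x, exists y, j y = ha_antipode H (j x)].

Definition admits_hopf_order (R : comNzRingType) (K : fieldType)
    (iota : {rmorphism R -> K}) (H : hopf_data K) : Prop :=
  exists (X : lmodType R) (j : {linear X -> H | iota \; *:%R}), hopf_order j.

(* A number field inside C is a finite extension L of rat together with a     *)
(* morphism from L to C; its number ring is the image of ring_of_integers L.  *)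
Section RingOfIntegers.
Variable L : fieldExtType rat.

Definition alg_integer : {pred L} :=
  fun x => `[< integralOver (intr : int -> L) x >].

Fact alg_integer_subring : subring_closed alg_integer.
Proof.
split=> [|x y /asboolP xZ /asboolP yZ|x y /asboolP xZ /asboolP yZ];
  apply/asboolP.
- exact: integral1.
- exact: integral_sub.
- exact: integral_mul.
Qed.

HB.instance Definition _ := GRing.isSubringClosed.Build L alg_integer
  alg_integer_subring.

Record ring_of_integers :=
  RingOfIntegers { roi_val : L; _ : roi_val \in alg_integer }.

HB.instance Definition _ := [isSub for roi_val].
HB.instance Definition _ := [Choice of ring_of_integers by <:].
HB.instance Definition _ :=
  [SubChoice_isSubComNzRing of ring_of_integers by <:].

End RingOfIntegers.

Section PSL2.
Variable F : finFieldType.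

Definition SL2_set : {set {'GL_2[F]}} := [set g | \det (GLval g) == 1].

Fact SL2_group_set : group_set SL2_set.
Proof.
apply/group_setP; split=> [|g h]; rewrite !inE; first by rewrite GL_1E det1.
by rewrite GL_ME det_mulmx => /eqP-> /eqP->; rewrite mulr1.
Qed.

Definition SL2 := Group SL2_group_set.

Definition PSL2 : finGroupType := subg_of (SL2 / 'Z(SL2))%G.

End PSL2.

(* Main.v *)
Require Import Defs.
From HB Require Import structures.
From mathcomp Require Import all_boot all_order all_fingroup all_algebra.
From mathcomp Require Import all_solvable all_field.
From mathcomp Require Import boolp reals complex.
From mathcomp Require Import ring zify.

Set Implicit Arguments.
Unset Strict Implicit.
Unset Printing Implicit Defensive.

Import GRing.Theory.
Local Open Scope ring_scope.

(** Why there is no Hopf order.  Let [X] be a Hopf order over a number ring.  As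
   [X] is projective it has a dual basis: elements [x i] and coordinate forms
   [f i] for which the products and the twisted coproducts of the [x i] have
   coordinates that are algebraic integers ([hopf_order_frame]).  An element is
   called integral here when its coordinates are algebraic integers.  Traces
   then produce further integral elements: in each representation used below,
   a nonzero eigenvalue is also an eigenvalue of a matrix of algebraic integers.

   Let [rad] be the radical of the bicharacter [omega a b / omega b a] of the
   dual of [M], let [xi] trivialize [omega] on [rad], and let [N] be the
   subgroup of [M] on which the characters in [rad] are trivial.  For [t] in [G]
   the elements [e_phi t e_psi] span a subcoalgebra; its dual algebra acts on the
   functions on the dual of [M] by twisted translations, and the trace of the
   part where [rad] acts through [xi] is evaluation at a cocharacter.  Hence
   [c_t = |N| \sum_(phi, psi in rad) (xi phi / xi psi) e_phi t e_psi] is integral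
   ([cochar_alg_int]).  On the dual side, suppose that [G] acts on a finite set
   [Y] and that [lam : Y -> Y] commutes with this action.  The class function
   [chi] whose value at [g] is the number of fixed points of [y |-> (lam y) g]
   takes integral elements to algebraic integers ([fixchar_alg_int]).  Applying
   [chi (c_s * _)] to the first tensor factor of the coproduct of [c_t] gives a
   multiple of [c_t], and the multiplier counts fixed points: with [k] the number
   of triples [(v, w, y)] in [N * N * Y] such that [(lam y) (v s w t) = y], the
   element [k c_t / |N|] is integral.  One more application of [chi (c_s * _)]
   shows that [k ^ 2 / |N|] is an algebraic integer, so [|N|] divides [k ^ 2],
   whatever [Y], [lam], [s] and [t] are ([dvdn_fix_triples_sqr]).  Moreover [N] is
   not cyclic, since otherwise [rad] would be the whole dual and [omega] would be
   the coboundary of [xi] ([noncyclic_rad_perp]).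

   In PSL2(q), an abelian subgroup that is not cyclic either fixes a nonzero
   vector up to sign, or is a Klein four group generated by the images of two
   anticommuting matrices ([abelian_PSL2_cases]).  In each case some action has
   a [k] that is prime to a prime divisor of [|N|].
   - If [N] fixes a vector, let [Y] be the projective line and [U] the stabilizer
     of that vector up to sign.  Summing over [u] in [U] the counts attached to
     [u w] and the inverse of [w] gives [|N| S] with
     [S = 2 q + (|N| - 1) (q - 1)].  This is [1] modulo the characteristic
     ([unipotent_fix_triples], [unipotent_case]).
   - If [N] is a Klein group and [s = t = r] is an involution, the parity of [k]
     is that of the number of points fixed by [r] that have a trivial stabilizer
     in [N] ([odd_fix_triples_invol]).  When [-1] is a square and [q > 5], a
     suitable [r] has exactly one such point on the projective line
     ([split_klein_case]).  When [q = 5], let [G] act on itself by conjugation: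
     the points are the nontrivial elements of the centralizer of [r], which has
     even order ([klein_F5_case]).
   - If [N] is a Klein group and [-1] is not a square, let [Y] be the set of
     nonzero vectors up to sign and [lam] a scaling.  Averaging over a Borel
     subgroup, which has odd order, shows that not all [k] are even
     ([twisted_fix_triples], [nonsplit_klein_case]). *)

Lemma scale_vec_inj (K : fieldType) (V : lmodType K) (v : V) :
  v != 0 -> injective (fun a : K => a *: v).
Proof.
move=> v0 a b /eqP; rewrite -subr_eq0 -scalerBl scaler_eq0 (negbTE v0) orbF.
by rewrite subr_eq0 => /eqP.
Qed.

(** * Algebraic integers and eigenvalues *)

Section AlgebraicIntegers.
Variable C : numClosedFieldType.

Definition alg_int : {pred C} := fun x => `[< integralOver (intr : int -> C) x >].

Lemma alg_intP x : reflect (integralOver (intr : int -> C) x) (x \in alg_int).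
Proof. exact: asboolP. Qed.

Fact alg_int_subring : subring_closed alg_int.
Proof.
split=> [|x y /alg_intP xZ /alg_intP yZ|x y /alg_intP xZ /alg_intP yZ];
  apply/alg_intP.
- exact: integral1.
- exact: integral_sub.
- exact: integral_mul.
Qed.
HB.instance Definition _ := GRing.isSubringClosed.Build C alg_int
  alg_int_subring.

Lemma alg_int_frac (a b : nat) :
  (0 < b)%N -> (a%:R / b%:R : C) \in alg_int -> (b %| a)%N.
Proof.
move=> b_gt0 /alg_intP[p p_mon].
pose x : rat := a%:R / b%:R.
have -> : (a%:R / b%:R : C) = ratr x by rewrite fmorph_div !rmorph_nat.
have -> : map_poly intr p = map_poly ratr (map_poly intr p) :> {poly C}.
  by rewrite -map_poly_comp; apply: eq_map_poly => z /=; rewrite ratr_int.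
rewrite fmorph_root => px0.
pose pC : {poly algC} := map_poly intr p.
have DpC : pC = map_poly ratr (map_poly intr p).
  by rewrite -map_poly_comp; apply: eq_map_poly => z /=; rewrite ratr_int.
(* Move to the field of algebraic numbers, where a rational algebraic integer
   is an integer. *)
have xA : ratr x \in Aint.
  apply: (@root_monic_Aint pC); first by rewrite DpC fmorph_root.
  - exact: monic_map.
  - by apply/polyOverP=> i; rewrite coef_map /= rpred_int.
have xZ : (ratr x : algC) \is a Num.int.
  by apply: Cint_rat_Aint xA; apply: Crat_rat.
have [z Dz] := elimT Num.Theory.intrP xZ.
have: x = z%:~R.
  by apply: (fmorph_inj (ratr : rat -> algC)); rewrite /= Dz ratr_int.
have b_nz : (b%:R : rat) != 0 by rewrite Num.Theory.pnatr_eq0 -lt0n.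
rewrite /x => /(canRL (divfK b_nz)) Dab.
have : Posz a = z * b :> int by apply: (@intr_inj rat); rewrite rmorphM.
move=> /(congr1 (fun t : int => `|t|%N)); rewrite /= abszM /= => ->.
exact: dvdn_mull.
Qed.

Lemma char_poly_tr n (A : 'M[C]_n) : char_poly A^T = char_poly A.
Proof.
rewrite /char_poly -[RHS]det_tr; congr (\det _).
by apply/matrixP=> i j; rewrite !mxE eq_sym.
Qed.

(** The trace is the sum of the roots of the characteristic polynomial, so it
   suffices to treat the eigenvalues one by one.  This way [y] itself need not
   be conjugate to a matrix of algebraic integers. *)
Lemma sum_eigen_alg_int n (y : 'M[C]_n) :
    (forall (a : C) (v : 'cV_n), v != 0 -> a != 0 -> y *m v = a *: v ->
       a \in alg_int) ->
  \tr y \in alg_int.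
Proof.
case: n y => [|n] y Hy; first by rewrite /mxtrace big_ord0 rpred0.
have /esym/eqP: (char_poly y)`_n.+1.-1 = - \tr y by exact: char_poly_trace.
rewrite eqr_oppLR => /eqP->; rewrite rpredN.
have [rs Drs] := closed_field_poly_normal (char_poly y).
rewrite (monicP (char_poly_monic y)) scale1r in Drs.
have sz_rs : size rs = n.+1.
  by have := size_char_poly y; rewrite Drs size_prod_XsubC => -[].
rewrite Drs -sz_rs coefPn_prod_XsubC ?sz_rs // rpredN.
rewrite big_seq; apply: rpred_sum => r rs_r; have [-> | r_nz] := eqVneq r 0.
  exact: rpred0.
have: eigenvalue y^T r.
  rewrite eigenvalue_root_char char_poly_tr Drs root_prod_XsubC //.
case/eigenvalueP => v yv v_nz; apply: (Hy r v^T) => //.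
  by rewrite trmx_eq0.
by rewrite -[y]trmxK -trmx_mul yv linearZ.
Qed.

(** [a] is a root of the characteristic polynomial of [A], which is monic with
   algebraic integers as coefficients.  The index type is arbitrary because the
   matrices used later are indexed by pairs. *)
Lemma eigen_alg_int (S : finType) (A : S -> S -> C) (z : S -> C) (a : C) s0 :
    (forall s t, A s t \in alg_int) -> z s0 != 0 ->
    (forall s, \sum_t A s t * z t = a * z s) ->
  a \in alg_int.
Proof.
move=> Aint z_nz Az; set n := #|S|.
pose B : 'M[C]_n := \matrix_(i, j) A (enum_val i) (enum_val j).
have Ba : root (char_poly B) a.
  rewrite -char_poly_tr -eigenvalue_root_char; apply/eigenvalueP.
  exists (\row_j z (enum_val j)).
    apply/rowP=> j; rewrite !mxE -Az [RHS](reindex (@enum_val S predT)) /=.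
      by apply: eq_bigr => i _; rewrite !mxE mulrC.
    by exists enum_rank => i _; rewrite ?enum_valK ?enum_rankK.
  apply/eqP=> /rowP/(_ (enum_rank s0)); rewrite !mxE enum_rankK => /eqP.
  exact/negP.
apply/alg_intP; apply: integral_root_monic Ba _; first exact: char_poly_monic.
have: char_poly B \is a polyOver alg_int.
  rewrite /char_poly /determinant rpred_sum // => s _.
  rewrite rpredMsign rpred_prod // => i _; rewrite !mxE.
  by rewrite rpredB ?polyOverC // rpredMn // polyOverX.
by move/allP => BZ c /BZ/alg_intP.
Qed.

End AlgebraicIntegers.

Arguments alg_int {C}.

(** * Functionals and tensors on a group algebra *)

Section GroupAlgebraFunctionals.
Variables (K : fieldType) (gT : finGroupType).
Local Notation KG := (group_algebra K gT).

Lemma ga_sumE (h : KG) : h = \sum_g ga_val h g *: ga_elt K g.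
Proof.
apply: ga_ext => g; have val_sum (I : finType) (F : I -> KG) :
    ga_val (\sum_i F i) g = \sum_i ga_val (F i) g.
  apply: (big_ind2 (fun a b => ga_val a g = b)) => // [|a b c d <- <-].
    exact: ga_val0.
  exact: ga_valD.
rewrite val_sum (bigD1 g) //= big1 ?addr0 => [|k kg].
  by rewrite ga_valZ ga_mkE eqxx mulr1.
by rewrite ga_valZ ga_mkE eq_sym (negbTE kg) mulr0.
Qed.

Definition ev (f : gT -> K) (h : KG) : K := \sum_g ga_val h g * f g.

Fact ev_is_linear f : linear (ev f : KG -> K^o).
Proof.
move=> k a b; rewrite /ev scaler_sumr -big_split /=.
by apply: eq_bigr => g _; rewrite ga_valD ga_valZ mulrDl /GRing.scale /= mulrA.
Qed.
HB.instance Definition _ f :=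
  GRing.isLinear.Build K KG K^o _ (ev f) (ev_is_linear f).

Lemma evZ f k a : ev f (k *: a) = k * ev f a.
Proof. exact: linearZ. Qed.

Lemma ev_sum f (I : finType) (P : pred I) (F : I -> KG) :
  ev f (\sum_(i | P i) F i) = \sum_(i | P i) ev f (F i).
Proof. exact: linear_sum. Qed.

Lemma ev_elt f g : ev f (ga_elt K g) = f g.
Proof.
rewrite /ev (bigD1 g) //= big1 => [|k /negbTE kg].
  by rewrite ga_mkE eqxx mul1r addr0.
by rewrite ga_mkE kg mul0r.
Qed.

End GroupAlgebraFunctionals.

Section GroupAlgebraTensor.
Variables (K : fieldType) (gT : finGroupType).
Local Notation KG := (group_algebra K gT).
Local Notation KGG := (group_algebra K (gT * gT)%type).

Lemma ga_tensorE a b x :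
  ga_val (ga_tensor a b : KGG) x = ga_val a x.1 * ga_val b x.2.
Proof. exact: ga_mkE. Qed.

Definition ev2 (f g : gT -> K) : KGG -> K := ev (fun x => f x.1 * g x.2).

HB.instance Definition _ f g := GRing.Linear.on (ev2 f g).

Lemma ev2Z f g k a : ev2 f g (k *: a) = k * ev2 f g a.
Proof. exact: linearZ. Qed.

Lemma ev2_sum f g (I : finType) (P : pred I) (F : I -> KGG) :
  ev2 f g (\sum_(i | P i) F i) = \sum_(i | P i) ev2 f g (F i).
Proof. exact: linear_sum. Qed.

Lemma ev2_tensor f g a b : ev2 f g (ga_tensor a b) = ev f a * ev g b.
Proof.
rewrite /ev2 /ev mulr_suml; under [RHS]eq_bigr do rewrite mulr_sumr.
by rewrite pair_bigA; apply: eq_bigr => x _; rewrite ga_tensorE mulrACA.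
Qed.

Lemma ga_tensorDl a b c : ga_tensor (a + b) c = ga_tensor a c + ga_tensor b c :> KGG.
Proof. by apply: ga_ext => x; rewrite ga_valD !ga_tensorE ga_valD mulrDl. Qed.

Lemma ga_tensorDr a b c : ga_tensor c (a + b) = ga_tensor c a + ga_tensor c b :> KGG.
Proof. by apply: ga_ext => x; rewrite ga_valD !ga_tensorE ga_valD mulrDr. Qed.

Lemma ga_tensorZl k a b : ga_tensor (k *: a) b = k *: ga_tensor a b :> KGG.
Proof. by apply: ga_ext => x; rewrite ga_valZ !ga_tensorE ga_valZ mulrA. Qed.

Lemma ga_tensorZr k a b : ga_tensor a (k *: b) = k *: ga_tensor a b :> KGG.
Proof. by apply: ga_ext => x; rewrite ga_valZ !ga_tensorE ga_valZ mulrCA. Qed.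

Lemma ga_tensor0l b : ga_tensor 0 b = 0 :> KGG.
Proof. by rewrite -(scale0r 0) ga_tensorZl scale0r. Qed.

Lemma ga_tensor0r b : ga_tensor b 0 = 0 :> KGG.
Proof. by rewrite -(scale0r 0) ga_tensorZr scale0r. Qed.

Lemma ga_tensor_suml (I : finType) (P : pred I) (F : I -> KG) b :
  ga_tensor (\sum_(i | P i) F i) b = \sum_(i | P i) ga_tensor (F i) b :> KGG.
Proof.
apply: (big_ind2 (fun a c => ga_tensor a b = c)) => // [|a c a' c' <- <-].
  exact: ga_tensor0l.
exact: ga_tensorDl.
Qed.

Lemma ga_tensor_sumr (I : finType) (P : pred I) (F : I -> KG) b :
  ga_tensor b (\sum_(i | P i) F i) = \sum_(i | P i) ga_tensor b (F i) :> KGG.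
Proof.
apply: (big_ind2 (fun a c => ga_tensor b a = c)) => // [|a c a' c' <- <-].
  exact: ga_tensor0r.
exact: ga_tensorDr.
Qed.

Lemma ga_tensorM a b c d :
  ga_tensor a b * ga_tensor c d = ga_tensor (a * c) (b * d) :> KGG.
Proof.
apply: ga_ext => x; rewrite ga_mulE ga_tensorE !ga_mulE mulr_suml.
under [RHS]eq_bigr do rewrite mulr_sumr.
rewrite pair_bigA /=; apply: eq_bigr => y _; rewrite !ga_tensorE.
by rewrite mulrACA; case: x y => x1 x2 [y1 y2].
Qed.

Definition diag_comul : KG -> KGG :=
  ga_lift (fun g => ga_tensor (ga_elt K g) (ga_elt K g)).

HB.instance Definition _ := GRing.Linear.on diag_comul.

Lemma diag_comul_elt g :
  diag_comul (ga_elt K g) = ga_tensor (ga_elt K g) (ga_elt K g).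
Proof.
rewrite /diag_comul /ga_lift (bigD1 g) //= big1 => [|k /negbTE kg].
  by rewrite ga_mkE eqxx scale1r addr0.
by rewrite ga_mkE kg scale0r.
Qed.

Lemma diag_comulZ k a : diag_comul (k *: a) = k *: diag_comul a.
Proof. exact: linearZ. Qed.

Lemma diag_comul_sum (I : finType) (P : pred I) (F : I -> KG) :
  diag_comul (\sum_(i | P i) F i) = \sum_(i | P i) diag_comul (F i).
Proof. exact: linear_sum. Qed.

Lemma diag_comulM a b : diag_comul (a * b) = diag_comul a * diag_comul b.
Proof.
rewrite [a]ga_sumE [b]ga_sumE mulr_suml !diag_comul_sum mulr_suml.
apply: eq_bigr => g _; rewrite !mulr_sumr diag_comul_sum; apply: eq_bigr => h _.
rewrite !(diag_comulZ, diag_comul_elt) -!(scalerAl, scalerAr) -ga_eltM.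
by rewrite !(diag_comulZ, diag_comul_elt) ga_tensorM -!ga_eltM.
Qed.

Lemma twisted_comulE (J : KGG) (h : KG) :
  ha_comul (twisted_group_algebra J) h = J * diag_comul h * J^-1.
Proof.
rewrite /= /diag_comul /ga_lift mulr_sumr mulr_suml; apply: eq_bigr => g _.
by rewrite -scalerAr -scalerAl.
Qed.

End GroupAlgebraTensor.

(** * Integral frames of Hopf orders *)

Section Frames.
Variables (C : numClosedFieldType) (gT : finGroupType).
Local Notation KG := (group_algebra C gT).
Local Notation KGG := (group_algebra C (gT * gT)%type).

(** A dual basis of a Hopf order, seen inside the group algebra: the [x i]
   generate and the [f i] are coordinate forms.  The [x i] may be linearly
   dependent, since a projective module need not be free. *)
Definition integral_frame (J : KGG) n (x : 'I_n -> KG) (f : 'I_n -> gT -> C) :=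
  [/\ forall h, h = \sum_i ev (f i) h *: x i,
      forall i k, ev (f k) (x i) \in alg_int,
      forall i j k, ev (f k) (x i * x j) \in alg_int
    & forall i k l, ev2 (f k) (f l) (J * diag_comul (x i) * J^-1) \in alg_int].

(** Projectivity splits a surjection from a free module onto [X]; the
   coordinates of the splitting are linear forms on [X], and extension of scalars
   turns them into linear forms on the group algebra. *)
Lemma hopf_order_frame (J : KGG) (L : fieldExtType rat) (iota : {rmorphism L -> C}) :
    admits_hopf_order (iota \o (\val : ring_of_integers L -> L))
      (twisted_group_algebra J) ->
  exists n (x : 'I_n -> KG) (f : 'I_n -> gT -> C), integral_frame J x f.
Proof.
set A := ring_of_integers L; set i0 := (X in admits_hopf_order X).
case=> X [j [[_ [[n [u Hu]] [Hproj Hbc]]] [_ HM HD _ _]]].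
have i0_int (r : A) : (i0 r : C) \in alg_int.
  case: r => r rA /=; apply/alg_intP.
  have /asboolP/(integral_rmorph iota) := rA.
  case=> p p_mon p0; exists p => //; congr (root _ _): p0.
  by apply: eq_map_poly => z /=; rewrite rmorph_int.
pose V := {ffun 'I_n -> A^o}.
pose g (c : V) : X := \sum_i c i *: u i.
have g_lin : linear g.
  move=> k a b; rewrite /g scaler_sumr -big_split /=; apply: eq_bigr => i _.
  by rewrite !ffunE scalerDl scalerA.
pose gL : {linear V -> X} := HB.pack g (GRing.isLinear.Build _ _ _ _ g g_lin).
(* h is the splitting, and F i extends its i-th coordinate to the group
   algebra. *)
have [|h Hh] := Hproj _ _ gL idfun.
  move=> x; have [c ->] := Hu x; exists [ffun i => c i : A^o].
  by rewrite /= /g; apply: eq_bigr => i _; rewrite ffunE.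
pose s i (x : X) : C^o := i0 (h x i).
have s_lin i : linear_for (i0 \; *:%R) (s i).
  by move=> k a b; rewrite /s linearP !ffunE rmorphD rmorphM.
pose sL i : {linear X -> C^o | i0 \; *:%R} :=
  HB.pack (s i) (GRing.isLinear.Build _ _ _ _ (s i) (s_lin i)).
have /choice[F HF] i : exists F : {linear KG -> C^o}, forall x, F (j x) = i0 (h x i).
  by have [F HF _] := Hbc _ (sL i); exists F.
pose x i : KG := j (u i); pose f i g := F i (ga_elt C g).
have evF i a : ev (f i) a = F i a.
  rewrite {2}[a]ga_sumE linear_sum; apply: eq_bigr => k _.
  by rewrite linearZ.
have Dj (y : X) : j y = \sum_i i0 (h y i) *: x i :> KG.
  rewrite -[in LHS](Hh y : gL (h y) = y) /= /g linear_sum; apply: eq_bigr => i _.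
  by rewrite linearZ.
exists n, x, f; split.
- pose G (a : KG) : KG := \sum_i F i a *: x i.
  have G_lin : linear G.
    move=> k a b; rewrite /G scaler_sumr -big_split /=; apply: eq_bigr => i _.
    by rewrite linearP scalerDl scalerA.
  pose GL : {linear KG -> KG} := HB.pack G (GRing.isLinear.Build _ _ _ _ G G_lin).
  (* The dual basis formula holds on X, and a linear map on the group algebra
     is determined by its values on X. *)
  have [Id _ uniq] := Hbc _ j; move=> a.
  transitivity (G a); last by apply: eq_bigr => i _; rewrite evF.
  rewrite (_ : G a = GL a) // (uniq GL) => [|y]; last first.
    by rewrite /= /G [RHS]Dj; apply: eq_bigr => i _; rewrite HF.
  by rewrite -[RHS](uniq idfun).
- by move=> i k; rewrite evF HF.
- by move=> i k l; have [z <-] := HM (u i) (u k); rewrite evF HF.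
move=> i k l; have [N [a [b Dab]]] := HD (u i).
rewrite twisted_comulE in Dab; rewrite Dab ev2_sum rpred_sum // => c _.
by rewrite ev2_tensor !evF !HF rpredM.
Qed.

End Frames.

(** * Characters of a finite abelian group *)

Section Characters.
Variables (C : numClosedFieldType) (gT : finGroupType) (M : {group gT}).
Hypothesis abM : abelian M.
Local Notation D := (dual C M).
Local Notation S := (subg_of M).

Lemma subgC (x y : S) : (x * y = y * x)%g.
Proof. by apply: val_inj; apply: (centsP abM); apply: subgP. Qed.

Lemma dualE (phi psi : D) x : (phi * psi)%g x = phi x * psi x.
Proof. exact: ffunE. Qed.

Lemma dual1E x : (1%g : D) x = 1.
Proof. exact: ffunE. Qed.

Lemma dualP (phi psi : D) : (forall x, phi x = psi x) -> phi = psi.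
Proof. by move=> eq_phi; apply/val_inj/ffunP. Qed.

Lemma dualC (phi psi : D) : (phi * psi = psi * phi)%g.
Proof. by apply: dualP => x; rewrite !dualE mulrC. Qed.

Lemma dualV (phi : D) x : phi (x^-1)%g = (phi x)^-1.
Proof.
apply: (mulfI (dual_neq0 phi x)).
by rewrite -dualM mulgV dual1 divff ?dual_neq0.
Qed.

Lemma dualVE (phi : D) x : (phi^-1)%g x = (phi x)^-1.
Proof. exact: ffunE. Qed.

Definition rtrans_mx (w : S) : 'M[C]_#|S| :=
  \matrix_(i, j) (enum_val j == enum_val i * w)%g%:R.

Lemma row_rtrans_mx (z : 'rV[C]_#|S|) w x :
  (z *m rtrans_mx w) 0 (enum_rank x) = z 0 (enum_rank (x * w^-1)%g).
Proof.
rewrite mxE (bigD1 (enum_rank (x * w^-1)%g)) //= mxE !enum_rankK mulgKV eqxx.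
rewrite mulr1 big1 ?addr0 // => i; rewrite -(inj_eq enum_val_inj) enum_rankK.
move=> /negbTE neq_i; rewrite !mxE enum_rankK.
by rewrite -(inj_eq (mulIg w^-1%g)) mulgK eq_sym neq_i mulr0.
Qed.

Lemma rtrans_mxM w w' : rtrans_mx w *m rtrans_mx w' = rtrans_mx (w * w')%g.
Proof.
apply/row_matrixP=> i; rewrite row_mul !rowE; apply/rowP=> j.
by rewrite -mulmxA -(enum_valK j) mulmxA !row_rtrans_mx invMg mulgA.
Qed.

Lemma rtrans_mx1 : rtrans_mx 1%g = 1%:M.
Proof.
apply/matrixP=> i j; rewrite !mxE mulg1 (inj_eq enum_val_inj).
by rewrite eq_sym.
Qed.

(** The right translations by [M] commute, and they preserve the nonzero image
   of (translation by [w]) - 1.  A common eigenvector in that image has a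
   character of [M] as its system of eigenvalues.  If the value at [w] were [1],
   then summing the translations by the powers of [w] would multiply the
   eigenvector by the order of [w], whereas this sum kills the image. *)
Lemma dual_separates (w : S) : w != 1%g -> exists phi : D, phi w != 1.
Proof.
move=> w1; pose W := rtrans_mx w - 1%:M; pose B := row_base W.
pose A x := B *m rtrans_mx x *m pinvmx B.
have BA x : A x *m B = B *m rtrans_mx x.
  rewrite mulmxKpV // eq_row_base.
  have /submxP[Z ->] : (B <= W)%MS by rewrite eq_row_base.
  have -> : Z *m W *m rtrans_mx x = Z *m rtrans_mx x *m W.
    rewrite -!mulmxA; congr (_ *m _).
    by rewrite /W mulmxBl mulmxBr !rtrans_mxM mul1mx mulmx1 subgC.
  exact: submxMl.
have fB : row_free B := row_base_free W.
have /submxP[Z DB] : (B <= W)%MS by rewrite eq_row_base.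
clearbody A B.
have AC x y : A x *m A y = A y *m A x.
  apply: (row_free_inj fB) => /=.
  by rewrite -[LHS]mulmxA -[RHS]mulmxA !BA !mulmxA !BA -!mulmxA !rtrans_mxM subgC.
have rW : (0 < \rank W)%N.
  rewrite lt0n mxrank_eq0; apply/eqP=> /matrixP/(_ (enum_rank 1%g) (enum_rank w)).
  rewrite !mxE !enum_rankK mul1g eqxx (inj_eq enum_rank_inj) eq_sym (negbTE w1).
  by move/eqP; rewrite subr0 oner_eq0.
have [|v v_nz /allP vA] := common_eigenvector (As := [seq A x | x <- enum S]) rW.
  by move=> _ _ /mapP[x _ ->] /mapP[y _ ->]; apply: AC.
pose u := v *m B.
have u_nz : u != 0.
  by rewrite mulmx_free_eq0.
have /fin_all_exists[a ua] x : exists a, u *m rtrans_mx x = a *: u.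
  have /sub_rVP[a va] : (v *m A x <= v)%MS.
    by apply: vA; apply: map_f; rewrite mem_enum.
  by exists a; rewrite -mulmxA -BA mulmxA va scalemxAl.
have uK a1 a2 : a1 *: u = a2 *: u -> a1 = a2 by apply: scale_vec_inj.
have a1 : a 1%g = 1 by apply: uK; rewrite -ua rtrans_mx1 mulmx1 scale1r.
have aM x y : a (x * y)%g = a x * a y.
  apply: uK; rewrite -ua -rtrans_mxM mulmxA ua -scalemxAl ua scalerA.
  by rewrite mulrC.
have char_a : is_char [ffun x => a x].
  rewrite /is_char ffunE a1 eqxx; do 2!apply/forallP=> ?.
  by rewrite !ffunE aM.
exists (Dual char_a); rewrite /= ffunE; apply: contra_neqN u_nz => /eqP aw.
have uw : u *m rtrans_mx w = u by rewrite ua aw scale1r.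
pose T := \sum_(i < #[w]%g) rtrans_mx (w ^+ i)%g.
have uT : u *m T = #[w]%g%:R *: u.
  rewrite mulmx_sumr (eq_bigr (fun=> u)) => [|i _].
    by rewrite sumr_const card_ord scaler_nat.
  elim: (nat_of_ord i) => [|k IHk]; first by rewrite expg0 rtrans_mx1 mulmx1.
  by rewrite expgSr -rtrans_mxM mulmxA IHk uw.
have WT : W *m T = 0.
  rewrite /W mulmxBl mul1mx mulmx_sumr.
  under eq_bigr do rewrite rtrans_mxM -expgS.
  have [m ordw] : exists m, #[w]%g = m.+1 by case: #[w]%g (order_gt0 w) => // m; exists m.
  have := expg_order w; rewrite /T ordw => wm.
  rewrite big_ord_recr [X in _ - X]big_ord_recl /= wm expg0.
  by rewrite [X in _ - X]addrC subrr.
have: u *m T = 0 by rewrite /u DB -!mulmxA WT !mulmx0.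
rewrite uT => /eqP; rewrite scaler_eq0 Num.Theory.pnatr_eq0.
by move=> /orP[|/eqP//]; rewrite eqn0Ngt order_gt0.
Qed.

Lemma card_subg_of : #|{: S}| = #|M|.
Proof. by rewrite -cardsT (card_isog (isog_subg M)). Qed.

Lemma sum_dual_char (phi : D) : \sum_w phi w = #|M|%:R *+ (phi == 1%g).
Proof.
have [-> | phi1] := eqVneq phi 1%g.
  rewrite (eq_bigr (fun=> 1)) => [|w _]; last exact: dual1E.
  by rewrite sumr_const card_subg_of.
have /existsP[x phix] : [exists x, phi x != 1].
  apply: contraR phi1 => /existsPn phi1; apply/eqP/dualP=> x.
  by rewrite dual1E; apply/eqP; have := phi1 x; rewrite negbK.
apply: (mulfI (x := phi x - 1)); first by rewrite subr_eq0.
rewrite mulr0n mulr0 mulrBl mul1r mulr_sumr.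
rewrite [X in _ - X](reindex_inj (mulgI x)) /=.
by under eq_bigr do rewrite -dualM; rewrite subrr.
Qed.

Lemma sum_dual_val_nt (w : S) : w != 1%g -> \sum_(phi : D) phi w = 0.
Proof.
move=> /dual_separates[psi psiw].
apply: (mulfI (x := psi w - 1)); first by rewrite subr_eq0.
rewrite mulr0 mulrBl mul1r mulr_sumr [X in _ - X](reindex_inj (mulgI psi)) /=.
by under eq_bigr do rewrite -dualE; rewrite subrr.
Qed.

Lemma card_dual : #|{: D}| = #|M|.
Proof.
have: \sum_(phi : D) \sum_(w : S) phi w = #|M|%:R :> C.
  rewrite (bigD1 1%g) // sum_dual_char eqxx mulr1n big1 /= ?addr0 // => phi.
  by move/negbTE=> phi1; rewrite sum_dual_char phi1.
rewrite exchange_big (bigD1 (1%g : S)) //= [X in _ + X]big1 => [|w]; last exact: sum_dual_val_nt.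
rewrite addr0 (eq_bigr (fun=> 1)) => [|phi _]; last exact: dual1.
by rewrite sumr_const => /eqP; rewrite Num.Theory.eqr_nat => /eqP.
Qed.

Lemma sum_dual_val (w : S) : \sum_(phi : D) phi w = #|M|%:R *+ (w == 1%g).
Proof.
have [-> | w1] := eqVneq w 1%g; last by rewrite sum_dual_val_nt.
rewrite (eq_bigr (fun=> 1)) => [|phi _]; last exact: dual1.
by rewrite sumr_const card_dual.
Qed.

End Characters.

(** * Idempotents, twists and the twisted coproduct *)

Section Idempotents.
Variables (C : numClosedFieldType) (gT : finGroupType) (M : {group gT}).
Hypothesis abM : abelian M.
Local Notation D := (dual C M).
Local Notation S := (subg_of M).
Local Notation KG := (group_algebra C gT).
Local Notation KGG := (group_algebra C (gT * gT)%type).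
Local Notation e := (@idem C gT M).
Local Notation elt := (ga_elt C).

Lemma cardM_neq0 : #|M|%:R != 0 :> C.
Proof. by rewrite Num.Theory.pnatr_eq0 -lt0n cardG_gt0. Qed.

Lemma idem_elt (phi : D) (w : S) : (e phi) * elt (sgval w) = phi w *: (e phi).
Proof.
rewrite /idem -scalerAl scalerA mulrC -scalerA; congr (_ *: _).
rewrite mulr_suml [LHS](reindex_inj (mulIg w^-1%g)) scaler_sumr /=.
apply: eq_bigr => v _; rewrite invMg invgK dualM -scalerAl -ga_eltM scalerA.
by congr (_ *: elt _); rewrite /= mulgKV.
Qed.

Lemma idemM (phi psi : D) : (e phi) * (e psi) = (e phi) *+ (phi == psi).
Proof.
rewrite {2}/idem -scalerAr mulr_sumr.
under eq_bigr do rewrite -scalerAr idem_elt scalerA dualV -dualVE -dualE.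
rewrite -scaler_suml sum_dual_char // scalerA -(inj_eq (mulgI psi)) mulgA mulgV.
rewrite mul1g mulg1; case: eqP => _; last by rewrite mulr0 scale0r.
by rewrite mulr1n mulVf ?cardM_neq0 // scale1r.
Qed.

Lemma sum_idem : \sum_(phi : D) (e phi) = 1.
Proof.
rewrite /idem -scaler_sumr exchange_big (bigD1 1%g) //= [X in _ + X]big1.
  rewrite addr0 -scaler_suml invg1 sum_dual_val // eqxx mulr1n scalerA.
  by rewrite mulVf ?cardM_neq0 // scale1r.
move=> w w1; rewrite -scaler_suml sum_dual_val // invg_eq1.
by rewrite (negbTE w1) scale0r.
Qed.

Lemma ga_tensor11 : ga_tensor 1 1 = 1 :> KGG.
Proof.
apply: ga_ext => -[x y].
by rewrite ga_tensorE -![1]/(elt 1%g) !ga_mkE -natrM mulnb.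
Qed.

(** Multiply by [1 = \sum_a e_a] in the first tensor factor: there each [v] acts
   on [e_a] through the scalar [a v], which shifts the character of the second
   factor. *)
Lemma idem_comul (phi : D) :
  diag_comul (e phi) = \sum_(a : D) ga_tensor (e a) (e (a^-1 * phi)%g).
Proof.
transitivity (\sum_(a : D) ga_tensor (e a) 1 * diag_comul (e phi)).
  by rewrite -mulr_suml -ga_tensor_suml sum_idem ga_tensor11 mul1r.
apply: eq_bigr => a _; rewrite {2}/idem diag_comulZ diag_comul_sum.
rewrite {2}/idem ga_tensorZr ga_tensor_sumr -scalerAr mulr_sumr.
congr (_ *: _); apply: eq_bigr => v _.
rewrite diag_comulZ diag_comul_elt -scalerAr ga_tensorM mul1r idem_elt.
rewrite ga_tensorZl scalerA ga_tensorZr; congr (_ *: _).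
by rewrite !dualV dualE dualVE invfM invrK mulrC.
Qed.

Variable omega : D -> D -> C.
Hypothesis omega_cocycle : normalized_2cocycle omega.

Lemma omega_neq0 a b : omega a b != 0.
Proof. by case: omega_cocycle. Qed.

Lemma omegaA a b c :
  omega a b * omega (a * b)%g c = omega b c * omega a (b * c)%g.
Proof. by case: omega_cocycle. Qed.

Lemma omega1r a : omega a 1%g = 1. Proof. by case: omega_cocycle => _ _ /(_ a)[]. Qed.
Lemma omega1l a : omega 1%g a = 1. Proof. by case: omega_cocycle => _ _ /(_ a)[]. Qed.

Lemma twist_idem (om : D -> D -> C) (a b : D) :
  twist om * ga_tensor (e a) (e b) = om a b *: ga_tensor (e a) (e b).
Proof.
have term a' b' : (om a' b' *: ga_tensor (e a') (e b')) * ga_tensor (e a) (e b)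
    = om a' b' *: ga_tensor (e a' *+ (a' == a)) (e b' *+ (b' == b)).
  by rewrite -[LHS]scalerAl ga_tensorM !idemM.
rewrite /twist [LHS]mulr_suml (bigD1 a) //= [X in _ + X]big1 ?addr0.
  rewrite [LHS]mulr_suml (bigD1 b) //= [X in _ + X]big1 ?addr0.
    by rewrite term !eqxx.
  by move=> b' /negbTE b'b; rewrite term b'b ga_tensor0r scaler0.
move=> a' /negbTE a'a; rewrite [LHS]mulr_suml big1 // => b' _.
by rewrite term a'a ga_tensor0l scaler0.
Qed.

Lemma idem_twist (om : D -> D -> C) (a b : D) :
  ga_tensor (e a) (e b) * twist om = om a b *: ga_tensor (e a) (e b).
Proof.
have term a' b' : ga_tensor (e a) (e b) * (om a' b' *: ga_tensor (e a') (e b'))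
    = om a' b' *: ga_tensor (e a *+ (a == a')) (e b *+ (b == b')).
  by rewrite -[LHS]scalerAr ga_tensorM !idemM.
rewrite /twist [LHS]mulr_sumr (bigD1 a) //= [X in _ + X]big1 ?addr0.
  rewrite [LHS]mulr_sumr (bigD1 b) //= [X in _ + X]big1 ?addr0.
    by rewrite term !eqxx.
  by move=> b' /negbTE b'b; rewrite term [b == _]eq_sym b'b ga_tensor0r scaler0.
move=> a' /negbTE a'a; rewrite [LHS]mulr_sumr big1 // => b' _.
by rewrite term eq_sym a'a ga_tensor0l scaler0.
Qed.

Lemma twistM (om om' : D -> D -> C) :
  (forall a b, om a b * om' a b = 1) -> twist om * twist om' = 1.
Proof.
move=> om_inv; rewrite {2}/twist mulr_sumr -ga_tensor11 -{1}sum_idem.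
rewrite ga_tensor_suml; apply: eq_bigr => a _.
rewrite -sum_idem ga_tensor_sumr mulr_sumr; apply: eq_bigr => b _.
by rewrite -scalerAr twist_idem scalerA mulrC om_inv scale1r.
Qed.

Lemma twist_inv : (twist omega)^-1 = twist (fun a b => (omega a b)^-1).
Proof.
set J := twist omega; set J' := twist _.
have JJ' : J * J' = 1 by apply: twistM => a b; rewrite divff ?omega_neq0.
have J'J : J' * J = 1 by apply: twistM => a b; rewrite mulVf ?omega_neq0.
have Ju : J \is a GRing.unit by apply/unitrP; exists J'.
by rewrite -[LHS]mulr1 -JJ' mulKr.
Qed.

Definition sandwich (s : gT) (phi psi : D) : KG := (e phi) * elt s * (e psi).

(** The elements [e_phi s e_psi] span a subcoalgebra for the twisted coproduct,
   because the twist acts on each [e_a (x) e_b] through a scalar. *)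
Lemma sandwich_comul (s : gT) (phi psi : D) :
  twist omega * diag_comul (sandwich s phi psi) * (twist omega)^-1 =
  \sum_(a : D) \sum_(c : D)
     (omega a (a^-1 * phi)%g / omega c (c^-1 * psi)%g) *:
     ga_tensor (sandwich s a c)
               (sandwich s (a^-1 * phi)%g (c^-1 * psi)%g).
Proof.
rewrite /sandwich !diag_comulM !idem_comul diag_comul_elt twist_inv.
rewrite -!mulrA [_ * twist _]mulr_suml !mulrA [twist _ * _]mulr_sumr.
rewrite !mulr_suml; apply: eq_bigr => a _; rewrite mulr_sumr.
apply: eq_bigr => c _; rewrite idem_twist twist_idem -[LHS]scalerAr -![in LHS]scalerAl.
by rewrite scalerA !ga_tensorM mulrC.
Qed.

End Idempotents.

(** * The radical of the cocycle and its twisted translations *)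

Section Cocharacters.
Variables (C : numClosedFieldType) (gT : finGroupType) (M : {group gT}).
Local Notation D := (dual C M).
Variable omega : D -> D -> C.
Hypothesis omega_cocycle : normalized_2cocycle omega.
Local Notation omega_nz := (omega_neq0 omega_cocycle).
Local Notation omA := (omegaA omega_cocycle).

(** The radical of the bicharacter [comm_bichar] introduced below; [omega] is
   symmetric on it. *)
Definition rad : {set D} := [set r | [forall a, omega r a == omega a r]].

Lemma radP r : reflect (forall a, omega r a = omega a r) (r \in rad).
Proof. by rewrite inE; apply: (iffP forallP) => h a; apply/eqP. Qed.

Lemma rad_group_set : group_set rad.
Proof.
apply/group_setP; split=> [|r s /radP rR /radP sR].
  by apply/radP=> a; rewrite (omega1l omega_cocycle) (omega1r omega_cocycle).
apply/radP=> a; apply: (mulfI (omega_nz r s)).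
by rewrite (omA r s a) -(omA a r s) sR -(rR a) (dualC s a) -(omA r a s) (dualC r a).
Qed.
Canonical rad_group := Group rad_group_set.

Definition comm_bichar (a b : D) := omega a b / omega b a.

Lemma comm_bicharM phi a c :
  comm_bichar (a * c)%g phi = comm_bichar a phi * comm_bichar c phi.
Proof.
have e0 := omA a c phi; have e1 := omA phi a c; have e2 := omA a phi c.
rewrite (dualC c phi) in e0; rewrite (dualC phi a) in e1.
have nz1 := omega_nz phi a; have nz2 := omega_nz phi c.
have nz3 := omega_nz a c; have nz4 := omega_nz (a * phi)%g c.
have nz5 := omega_nz phi (a * c)%g.
rewrite /comm_bichar; move/(canRL (mulKf nz3)): e0 => ->.
rewrite -(mulKf nz2 (omega a (phi * c)%g)) -e2.
have -> : omega phi (a * c)%g =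
    (omega a c)^-1 * (omega phi a * omega (a * phi)%g c) by rewrite e1 mulKf.
by field; rewrite nz1 nz2 nz3 nz4.
Qed.

Lemma comm_bichar_rad phi : reflect (forall a, comm_bichar a phi = 1) (phi \in rad).
Proof.
apply: (iffP (radP phi)) => h a.
  by rewrite /comm_bichar h divff ?omega_nz.
by rewrite -[omega a phi](divfK (omega_nz phi a)) -/(comm_bichar _ _) h mul1r.
Qed.

Lemma sum_commutation (phi : D) :
  \sum_a omega a phi / omega phi a = #|{: D}|%:R *+ (phi \in rad).
Proof.
case: (boolP (phi \in rad)) => [/comm_bichar_rad phiR | phiR].
  rewrite (eq_bigr (fun=> 1)) => [|a _]; first by rewrite sumr_const.
  exact: phiR.
have [b phib] : exists b, comm_bichar b phi != 1.
  apply/existsP; apply: contraR phiR => /existsPn h; apply/comm_bichar_rad => a.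
  by apply/eqP; have := h a; rewrite negbK.
rewrite mulr0n; apply: (mulfI (x := comm_bichar b phi - 1)).
  by rewrite subr_eq0.
rewrite mulr0 mulrBl mul1r mulr_sumr [X in _ - X](reindex_inj (mulgI b)) /=.
by under eq_bigr do rewrite -/(comm_bichar _ _) -comm_bicharM; rewrite subrr.
Qed.

Local Notation n := #|{: D}|.

(** Twisted translations of the functions on the dual of [M].  Matrices act on
   rows, and [Rmx] multiplies with the factor [omega], while [Lmx] multiplies
   with its inverse.  The two families commute, so the products
   [Rmx phi *m Lmx psi] multiply with the structure constants with which the
   elements [e_phi s e_psi] comultiply; see [dual_rep_conv]. *)
Definition Rmx (phi : D) : 'M[C]_n :=
  \matrix_(i, j) (omega (enum_val i) phi *+
                   (enum_val j == enum_val i * phi)%g).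

Definition Lmx (psi : D) : 'M[C]_n :=
  \matrix_(i, j) ((omega psi (enum_val j))^-1 *+
                   (enum_val i == psi * enum_val j)%g).

Lemma row_Rmx (z : 'rV[C]_n) phi x :
  (z *m Rmx phi) 0 (enum_rank x) =
    z 0 (enum_rank (x * phi^-1)%g) * omega (x * phi^-1)%g phi.
Proof.
rewrite mxE (bigD1 (enum_rank (x * phi^-1)%g)) //= mxE !enum_rankK mulgKV eqxx.
rewrite mulr1n big1 ?addr0 // => i; rewrite -(inj_eq enum_val_inj) enum_rankK.
move=> /negbTE neq_i; rewrite !mxE enum_rankK.
by rewrite -(inj_eq (mulIg phi^-1%g)) mulgK eq_sym neq_i mulr0.
Qed.

Lemma row_Lmx (z : 'rV[C]_n) psi x :
  (z *m Lmx psi) 0 (enum_rank x) = z 0 (enum_rank (psi * x)%g) / omega psi x.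
Proof.
rewrite mxE (bigD1 (enum_rank (psi * x)%g)) //= mxE !enum_rankK eqxx.
rewrite mulr1n big1 ?addr0 // => i; rewrite -(inj_eq enum_val_inj) enum_rankK.
by move=> /negbTE neq_i; rewrite !mxE enum_rankK neq_i mulr0.
Qed.

Lemma row_mx_eq (A B : 'M[C]_n) :
    (forall (z : 'rV_n) x, (z *m A) 0 (enum_rank x) = (z *m B) 0 (enum_rank x)) ->
  A = B.
Proof.
move=> eqAB; apply/row_matrixP=> i; rewrite !rowE; apply/rowP=> j.
by rewrite -(enum_valK j) eqAB.
Qed.

Lemma RmxM phi phi' : Rmx phi *m Rmx phi' = omega phi phi' *: Rmx (phi * phi')%g.
Proof.
apply: row_mx_eq => z x; rewrite mulmxA !row_Rmx -scalemxAr mxE row_Rmx.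
rewrite invMg mulgA; set a := (x * _ * _)%g.
have -> : (x * phi'^-1 = a * phi)%g by rewrite /a mulgKV.
by rewrite -mulrA omA mulrCA.
Qed.

Lemma LmxM psi psi' : Lmx psi *m Lmx psi' = (omega psi psi')^-1 *: Lmx (psi * psi')%g.
Proof.
apply: row_mx_eq => z x; rewrite mulmxA !row_Lmx -scalemxAr mxE row_Lmx.
rewrite mulgA mulrCA -mulrA; congr (_ * _).
by rewrite -!invfM omA mulrC.
Qed.

Lemma Rmx_Lmx phi psi : Rmx phi *m Lmx psi = Lmx psi *m Rmx phi.
Proof.
apply: row_mx_eq => z x; rewrite !mulmxA row_Lmx row_Rmx row_Rmx row_Lmx.
rewrite mulgA; set c := (x * _)%g; have Dx : x = (c * phi)%g by rewrite mulgKV.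
rewrite -!mulrA; congr (_ * _).
have e := omA psi c phi; rewrite -Dx in e.
have -> : (psi * x * phi^-1 = psi * c)%g by rewrite mulgA.
by rewrite -(mulKf (omega_nz psi c) (omega _ phi)) e; field; rewrite !omega_nz.
Qed.

(** A diagonal entry can only be nonzero if [phi = psi], and the entries are then
   the values of a bicharacter at [psi], which add up to zero outside the
   radical. *)
Lemma tr_Rmx_Lmx phi psi :
  \tr (Rmx phi *m Lmx psi) = n%:R *+ ((phi == psi) && (psi \in rad)).
Proof.
rewrite /mxtrace (reindex (@enum_rank D)) /=; last first.
  by exists enum_val => x _; rewrite ?enum_valK ?enum_rankK.
transitivity (\sum_a omega a psi / omega psi a *+ (phi == psi)).
  apply: eq_bigr => a _.
  have -> (A : 'M[C]_n) i : A i i = ((delta_mx 0 i : 'rV_n) *m A) 0 i by rewrite -rowE mxE.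
  rewrite mulmxA row_Lmx row_Rmx mxE eqxx (inj_eq enum_rank_inj) /=.
  rewrite (dualC psi a) -mulgA -[X in _ == X]mulg1 (inj_eq (mulgI a)).
  rewrite -eq_mulgV1 eq_sym; case: eqP => [->|_]; last by rewrite !mul0r.
  by rewrite mul1r mulgV mulg1.
rewrite sumrMnl sum_commutation -mulrnA mulnC mulnb.
by [].
Qed.

Variable xi : D -> C.
Hypothesis xi_neq0 : forall r, r \in rad -> xi r != 0.
Hypothesis xiM : forall r s, r \in rad -> s \in rad ->
  xi r * xi s = omega r s * xi (r * s)%g.

(** The projection onto the subspace on which [rad] acts through [xi]. *)
Definition rad_proj : 'M[C]_n := #|rad|%:R^-1 *: \sum_(r in rad) (xi r)^-1 *: Rmx r.

Lemma cardrad_neq0 : #|rad|%:R != 0 :> C.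
Proof. by rewrite Num.Theory.pnatr_eq0 -lt0n (cardG_gt0 rad_group). Qed.

Lemma rad_proj_idem : rad_proj *m rad_proj = rad_proj.
Proof.
rewrite {2}/rad_proj -scalemxAr mulmx_sumr (eq_bigr (fun=> rad_proj)) => [|r rR].
  by rewrite sumr_const -scaler_nat scalerA mulVf ?cardrad_neq0 // scale1r.
rewrite /rad_proj -scalemxAl; congr (_ *: _); rewrite mulmx_suml.
rewrite [RHS](reindex_inj (mulIg r)) /=; apply: eq_big => [s | s sR].
  by rewrite (groupMr s (rR : r \in rad_group)).
rewrite -scalemxAl -scalemxAr RmxM !scalerA; congr (_ *: _).
have nz := xi_neq0 (groupM sR rR : (s * r)%g \in rad).
have /(canRL (mulKf (omega_nz s r))) -> : omega s r * xi (s * r)%g = xi s * xi r.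
  by rewrite xiM.
by field; rewrite omega_nz !xi_neq0.
Qed.

Lemma rad_proj_comm phi psi : rad_proj *m (Rmx phi *m Lmx psi) = (Rmx phi *m Lmx psi) *m rad_proj.
Proof.
rewrite /rad_proj -scalemxAl -scalemxAr mulmx_suml mulmx_sumr; congr (_ *: _).
apply: eq_bigr => r /radP rR; rewrite -scalemxAl -scalemxAr; congr (_ *: _).
rewrite -[RHS]mulmxA -Rmx_Lmx !mulmxA RmxM RmxM.
by rewrite rR dualC.
Qed.

(** Multiplying by [rad_proj] replaces [phi] by its translates by [rad]; exactly
   one of them is equal to [psi] when both lie in [rad], and none contributes
   otherwise. *)
Lemma tr_Rmx_Lmx_rad_proj phi psi : \tr (Rmx phi *m Lmx psi *m rad_proj) =
  (#|{: D}|%:R / #|rad|%:R * (xi phi / xi psi))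
    *+ ((phi \in rad) && (psi \in rad)).
Proof.
rewrite /rad_proj -scalemxAr linearZ mulmx_sumr linear_sum /=.
transitivity (#|rad|%:R^-1 *
  \sum_(r in rad) (xi r)^-1 * omega phi r * \tr (Rmx (phi * r)%g *m Lmx psi)).
  congr (_ * _); apply: eq_bigr => r rR; rewrite -scalemxAr linearZ /=.
  by rewrite -mulmxA -Rmx_Lmx mulmxA RmxM -scalemxAl linearZ /= mulrA.
case: (boolP (psi \in rad)) => psiR; last first.
  rewrite andbF big1 ?mulr0 // => r _.
  by rewrite tr_Rmx_Lmx (negbTE psiR) andbF mulr0.
rewrite andbT; case: (boolP (phi \in rad)) => phiR; last first.
  rewrite big1 ?mulr0 // => r rR; rewrite tr_Rmx_Lmx.
  case: eqP => [Dpsi | _]; last by rewrite mulr0.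
  case/negP: phiR; rewrite -(groupMr phi (rR : r \in rad_group)) /=.
  by rewrite Dpsi.
have rR : (phi^-1 * psi)%g \in rad by apply: (@groupM _ rad_group); rewrite ?groupV.
rewrite (bigD1 (phi^-1 * psi)%g) //= big1 ?addr0 => [|r /andP[_ neq_r]].
  rewrite tr_Rmx_Lmx mulKVg eqxx psiR /= mulr1n mulr1n.
  have nz := xi_neq0 psiR.
  have e := xiM phiR rR; rewrite mulKVg in e.
  have -> : omega phi (phi^-1 * psi)%g = xi phi * xi (phi^-1 * psi)%g / xi psi.
    by rewrite e mulfK.
  by field; rewrite nz (xi_neq0 rR) cardrad_neq0.
rewrite tr_Rmx_Lmx; case: eqP => [Dpsi | _]; last by rewrite mulr0.
by rewrite -Dpsi mulKg eqxx in neq_r.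
Qed.

End Cocharacters.

(** * Integrality of the cocharacters *)

Section CocharacterIntegrality.
Variables (C : numClosedFieldType) (gT : finGroupType) (M : {group gT}).
Hypothesis abM : abelian M.
Local Notation D := (dual C M).
Local Notation KG := (group_algebra C gT).
Variable omega : D -> D -> C.
Hypothesis omega_cocycle : normalized_2cocycle omega.
Local Notation Rad := (rad omega).
Local Notation omega_nz := (omega_neq0 omega_cocycle).
Local Notation n := #|{: D}|.
Local Notation Rm := (Rmx omega).
Local Notation Lm := (Lmx omega).

(** The matrices [Rmx r] for [r] in the radical commute; [xi] is their system of
   eigenvalues on a common eigenvector. *)
Lemma rad_char : exists2 xi : D -> C, forall r, r \in Rad -> xi r != 0 &
  forall r s, r \in Rad -> s \in Rad -> xi r * xi s = omega r s * xi (r * s)%g.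
Proof.
have n_gt0 : (0 < n)%N by apply/card_gt0P; exists 1%g.
have [|v v_nz /allP vR] := common_eigenvector (As := [seq Rm r | r <- enum Rad]) n_gt0.
  move=> _ _ /mapP[r + ->] /mapP[s _ ->]; rewrite mem_enum => /radP rR.
  by rewrite /comm_mx !(RmxM omega_cocycle) rR dualC.
have /fin_all_exists[xi vxi] r : exists a, r \in Rad -> v *m Rm r = a *: v.
  case: (boolP (r \in Rad)) => rR; last by exists 0.
  have /sub_rVP[a va] : (v *m Rm r <= v)%MS.
    by apply: vR; apply: map_f; rewrite mem_enum.
  by exists a.
have vK a1 a2 : a1 *: v = a2 *: v -> a1 = a2 by apply: scale_vec_inj.
have xiM r s : r \in Rad -> s \in Rad -> xi r * xi s = omega r s * xi (r * s)%g.
  move=> rR sR; apply: vK; rewrite -[RHS]scalerA -vxi; last first.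
  exact: (@groupM _ (rad_group omega_cocycle)).
  rewrite scalemxAr -(RmxM omega_cocycle) mulmxA vxi // -scalemxAl vxi //.
  by rewrite scalerA.
exists xi => // r rR; apply: contraNneq v_nz => xir.
have r1 : 1%g \in Rad by apply: (@group1 _ (rad_group omega_cocycle)).
have r'R : (r^-1)%g \in Rad.
  by apply: (@groupVr _ (rad_group omega_cocycle)).
have := xiM r _ rR r'R; rewrite xir mul0r mulgV => /esym/eqP.
rewrite mulf_eq0 (negbTE (omega_nz _ _)) /= => /eqP xi1.
rewrite -[v]mulmx1.
have <- : Rm 1%g = 1%:M.
  apply/matrixP=> i j; rewrite !mxE mulg1 (inj_eq enum_val_inj) eq_sym.
  by case: eqP => // _; rewrite (omega1r omega_cocycle).
by rewrite vxi // xi1 scale0r.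
Qed.

Variable xi : D -> C.
Hypothesis xi_neq0 : forall r, r \in Rad -> xi r != 0.
Hypothesis xiM : forall r s, r \in Rad -> s \in Rad ->
  xi r * xi s = omega r s * xi (r * s)%g.
Local Notation P := (rad_proj omega xi).

Section DualRepresentation.
Variable t : gT.
Local Notation s := (sandwich (M := M) (C := C) t).

(** The product of the algebra dual to the twisted group algebra. *)
Definition twisted_conv (f g : gT -> C) (h : KG) : C :=
  ev2 f g (twist omega * diag_comul h * (twist omega)^-1).

(** A representation of the dual algebra, as [dual_rep_conv] shows.  It factors
   through the dual of the subcoalgebra attached to [t]. *)
Definition dual_rep (f : KG -> C) : 'M[C]_n :=
  \sum_phi \sum_psi f (s phi psi) *: (Rm phi *m Lm psi).

Lemma dual_rep_conv (f g : gT -> C) : dual_rep (ev f) *m dual_rep (ev g) = dual_rep (twisted_conv f g).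
Proof.
rewrite /dual_rep mulmx_suml.
transitivity (\sum_a \sum_b \sum_c \sum_d
    (ev f (s a c) * ev g (s b d) * (omega a b / omega c d)) *:
      (Rm (a * b)%g *m Lm (c * d)%g)).
  apply: eq_bigr => a _; rewrite mulmx_sumr; apply: eq_bigr => b _.
  rewrite mulmx_suml; apply: eq_bigr => c _; rewrite mulmx_sumr.
  apply: eq_bigr => d _; rewrite -scalemxAl -scalemxAr scalerA.
  rewrite -mulmxA [Lm c *m _]mulmxA -(Rmx_Lmx omega_cocycle) -mulmxA.
  rewrite (LmxM omega_cocycle) mulmxA (RmxM omega_cocycle).
  by rewrite -scalemxAl -scalemxAr !scalerA mulrA.
transitivity (\sum_a \sum_phi \sum_c \sum_psi
    (ev f (s a c) * ev g (s (a^-1 * phi)%g (c^-1 * psi)%g) *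
    (omega a (a^-1 * phi)%g / omega c (c^-1 * psi)%g)) *:
      (Rm phi *m Lm psi)).
  apply: eq_bigr => a _; rewrite (reindex_inj (mulgI a^-1%g)) /=.
  apply: eq_bigr => phi _; apply: eq_bigr => c _.
  rewrite (reindex_inj (mulgI c^-1%g)) /=; apply: eq_bigr => psi _.
  by rewrite !mulKVg.
rewrite exchange_big; apply: eq_bigr => phi _ /=.
under eq_bigr do rewrite exchange_big /=.
rewrite exchange_big; apply: eq_bigr => psi _ /=.
rewrite /twisted_conv (sandwich_comul abM omega_cocycle) ev2_sum scaler_suml.
apply: eq_bigr => a _; rewrite ev2_sum scaler_suml; apply: eq_bigr => c _.
by rewrite ev2Z ev2_tensor mulrC.
Qed.

Lemma dual_rep_rad_proj f : P *m dual_rep f = dual_rep f *m P.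
Proof.
rewrite /dual_rep mulmx_sumr mulmx_suml; apply: eq_bigr => a _.
rewrite mulmx_sumr mulmx_suml; apply: eq_bigr => b _.
by rewrite -scalemxAl -scalemxAr (rad_proj_comm omega_cocycle).
Qed.

(** The element that represents the trace of [dual_rep] cut down by the projection
   [P], up to a scalar; see [tr_dual_rep_rad_proj]. *)
Definition cochar : KG :=
  \sum_(phi in Rad) \sum_(psi in Rad) (xi phi / xi psi) *: s phi psi.

Lemma tr_dual_rep_rad_proj f : \tr (dual_rep (ev f) *m P) = n%:R / #|Rad|%:R * ev f cochar.
Proof.
rewrite /dual_rep mulmx_suml linear_sum /cochar ev_sum mulr_sumr [RHS]big_mkcond.
apply: eq_bigr => phi _ /=; rewrite mulmx_suml linear_sum /=.
under eq_bigr do rewrite -scalemxAl linearZ /=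
  (tr_Rmx_Lmx_rad_proj omega_cocycle xi_neq0 xiM).
case: (boolP (phi \in Rad)) => phiR; last by rewrite big1 // => i _; rewrite mulr0n mulr0.
rewrite ev_sum mulr_sumr [RHS]big_mkcond; apply: eq_bigr => psi _ /=.
case: (psi \in Rad); last by rewrite mulr0.
by rewrite mulr1n evZ [LHS]mulrC -[LHS]mulrA.
Qed.

Variables (d : nat) (x : 'I_d -> KG) (f : 'I_d -> gT -> C).
Hypothesis frame : integral_frame (twist omega) x f.

(** The left-hand side is the trace of the action of [f k].  If [v] is an
   eigenvector of it for the eigenvalue [a], then the vectors obtained from the
   actions of the [f i] on [v] are multiplied by [a] when [f i] is replaced by
   [f i * f k], and the latter product is a combination of the [f l] with
   algebraic integers as coefficients.  So [a] is an eigenvalue of a matrix of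
   algebraic integers. *)
Lemma cochar_alg_int k :
  n%:R / #|Rad|%:R * ev (f k) cochar \in alg_int.
Proof.
have [fE _ _ fD] := frame.
rewrite -tr_dual_rep_rad_proj; set y := dual_rep (ev (f k)) *m P.
apply: sum_eigen_alg_int => a v v_nz a_nz yv.
pose A (s1 s2 : 'I_d * 'I_n) := twisted_conv (f s1.1) (f k) (x s2.1) *+ (s1.2 == s2.2).
pose z (s1 : 'I_d * 'I_n) := (dual_rep (ev (f s1.1)) *m P *m v) s1.2 0.
have /existsP[j zj] : [exists j, (y *m v) j 0 != 0].
  apply: contraR v_nz => /existsPn yv0.
  have: y *m v = 0.
    by apply/matrixP=> i j; rewrite [RHS]mxE ord1; apply/eqP; have := yv0 i; rewrite negbK.
  by rewrite yv => /eqP; rewrite scaler_eq0 (negbTE a_nz).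
apply: (@eigen_alg_int _ _ A z a (k, j)) => // [[i1 j1] [i2 j2]|[i j']].
  by rewrite /A /= rpredMn // fD.
rewrite /z /=.
have <- : (dual_rep (ev (f i)) *m P *m (y *m v)) j' 0 = a * (dual_rep (ev (f i)) *m P *m v) j' 0.
  by rewrite yv -scalemxAr mxE.
have -> : dual_rep (ev (f i)) *m P *m (y *m v) =
    \sum_l twisted_conv (f i) (f k) (x l) *: (dual_rep (ev (f l)) *m P *m v).
  rewrite mulmxA /y -[_ *m P *m _]mulmxA [P *m _]mulmxA dual_rep_rad_proj.
  rewrite -[dual_rep (ev (f k)) *m P *m P]mulmxA (rad_proj_idem omega_cocycle xi_neq0 xiM).
  rewrite mulmxA dual_rep_conv.
  have -> : dual_rep (twisted_conv (f i) (f k)) =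
     \sum_l twisted_conv (f i) (f k) (x l) *: dual_rep (ev (f l)).
    rewrite /dual_rep; under [RHS]eq_bigr do rewrite scaler_sumr.
    rewrite [RHS]exchange_big; apply: eq_bigr => phi _ /=.
    under [RHS]eq_bigr do rewrite scaler_sumr.
    rewrite [RHS]exchange_big; apply: eq_bigr => psi _ /=.
    under [RHS]eq_bigr do rewrite scalerA.
    rewrite -scaler_suml; congr (_ *: _).
    rewrite {1}[s phi psi]fE /twisted_conv diag_comul_sum mulr_sumr mulr_suml ev2_sum.
    apply: eq_bigr => l _; rewrite diag_comulZ -scalerAr -scalerAl ev2Z.
    by rewrite mulrC.
  rewrite !mulmx_suml; apply: eq_bigr => l _.
  by rewrite -!scalemxAl.
rewrite summxE -(pair_bigA _ (fun i1 j1 => A (i, j') (i1, j1) * z (i1, j1))) /=.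
apply: eq_bigr => l _; rewrite (bigD1 j') //= big1 => [|j1 neq_j].
  by rewrite /A /z /= eqxx mulr1n addr0 [RHS]mxE.
by rewrite /A /= eq_sym (negbTE neq_j) mulr0n mul0r.
Qed.

End DualRepresentation.

End CocharacterIntegrality.

(** * Integrality of twisted permutation characters *)

Section FixedPointCount.
Variables (C : numClosedFieldType) (gT : finGroupType).
Local Notation KG := (group_algebra C gT).
Local Notation KGG := (group_algebra C (gT * gT)%type).

Lemma evM (phi : gT -> C) (a b : KG) :
  ev phi (a * b) = \sum_g \sum_h ga_val a g * ga_val b h * phi (g * h)%g.
Proof.
rewrite {1}[a]ga_sumE mulr_suml ev_sum; apply: eq_bigr => g _.
rewrite {1}[b]ga_sumE mulr_sumr ev_sum; apply: eq_bigr => h _.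
by rewrite -scalerAr -scalerAl -ga_eltM !evZ ev_elt mulrA [_ * ga_val a g]mulrC.
Qed.

Section Action.
Variables (Y : finType) (act : Y -> gT -> Y) (lam : Y -> Y).
Hypothesis actM : forall y g h, act y (g * h)%g = act (act y g) h.
Hypothesis act1 : forall y, act y 1%g = y.
Hypothesis lam_act : forall y g, lam (act y g) = act (lam y) g.

Definition fixcount g := #|[set y | act (lam y) g == y]|.
(** In terms of the average [E] of [N], this is [|N| ^ 2] times the value of the
   fixed point character at [E s E t]; see [fix_triplesE]. *)
Definition fix_triples (N : {group gT}) s t :=
  (\sum_(v in N) \sum_(w in N) fixcount (v * s * w * t)%g)%N.

Definition fixchar g : C := (fixcount g)%:R.

Lemma fixcountJ g h : fixcount (g * h)%g = fixcount (h * g)%g.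
Proof.
have actK k : cancel (act^~ k) (act^~ k^-1%g).
  by move=> y; rewrite -actM mulgV act1.
rewrite /fixcount -[RHS](card_imset _ (can_inj (actK g^-1%g))).
apply: eq_card => y; rewrite inE; apply/eqP/imsetP => [fy | [z]].
  exists (act y g); last by rewrite -actM mulgV act1.
  by rewrite inE lam_act -actM mulgA actM fy.
rewrite inE => /eqP fz ->; rewrite lam_act -actM -{2}fz -actM.
by congr act; rewrite mulgA mulVg mul1g mulgK.
Qed.

Lemma ev_fixcharC (a b : KG) : ev fixchar (a * b) = ev fixchar (b * a).
Proof.
rewrite !evM exchange_big; apply: eq_bigr => g _; apply: eq_bigr => h _.
by rewrite /fixchar fixcountJ [ga_val a h * _]mulrC.
Qed.

Variables (J : KGG) (d : nat) (x : 'I_d -> KG) (f : 'I_d -> gT -> C).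
Hypothesis frame : integral_frame J x f.

(** Membership in the order, after extending its scalars to the ring of all
   algebraic integers. *)
Definition in_order (h : KG) := forall k, ev (f k) h \in alg_int.

Lemma in_orderM a b : in_order a -> in_order b -> in_order (a * b).
Proof.
have [fE _ fM _] := frame; move=> aX bX k.
rewrite [a]fE [b]fE mulr_suml ev_sum rpred_sum // => i _.
rewrite mulr_sumr ev_sum rpred_sum // => j _.
by rewrite -scalerAr -scalerAl !evZ !rpredM.
Qed.

(** [ev fixchar z] is the trace of the operator that acts by [z] on functions on [Y]
   and then pulls back along [lam].  Let [u] be an eigenvector for the eigenvalue
   [a].  The functions obtained by letting the [x k] act on [u] satisfy a linear
   system whose coefficients are the coordinates of the products [x k * z], which
   are algebraic integers, and [a] is an eigenvalue of that system. *)
Lemma fixchar_alg_int z : in_order z -> ev fixchar z \in alg_int.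
Proof.
have [fE _ fM _] := frame; move=> zX.
pose r (h : KG) (y y' : Y) := ev (fun g => (act y g == y')%:R) h.
have rM a b y y' : r (a * b) y y' = \sum_t r a y t * r b t y'.
  rewrite /r evM exchange_big /=.
  under [RHS]eq_bigr => t _.
    rewrite /ev mulr_suml; under eq_bigr do rewrite mulr_sumr.
    over.
  rewrite [RHS]exchange_big [LHS]exchange_big; apply: eq_bigr => g _ /=.
  rewrite [RHS]exchange_big; apply: eq_bigr => h _ /=.
  rewrite (bigD1 (act y g)) //= big1 => [|t /negbTE neq_t].
    by rewrite addr0 eqxx mulr1 actM mulrA.
  by rewrite eq_sym neq_t mulr0 mul0r.
pose w : 'M[C]_#|Y| := \matrix_(i, j) r z (lam (enum_val i)) (enum_val j).
have -> : ev fixchar z = \tr w.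
  rewrite /mxtrace; under [RHS]eq_bigr do rewrite mxE.
  transitivity (\sum_y r z (lam y) y); last first.
    by rewrite (reindex (@enum_val Y predT)) //; apply: onW_bij; apply: enum_val_bij.
  rewrite /r /ev exchange_big; apply: eq_bigr => g _ /=.
  rewrite -mulr_sumr; congr (_ * _); rewrite /fixchar /fixcount -sum1_card.
  rewrite natr_sum [LHS]big_mkcond; apply: eq_bigr => y _.
  by rewrite inE; case: ifP.
apply: sum_eigen_alg_int => a v v_nz a_nz wv.
pose u (y : Y) : C := v (enum_rank y) 0.
have wu y : \sum_t r z (lam y) t * u t = a * u y.
  have := congr1 (fun m : 'cV_#|Y| => m (enum_rank y) 0) wv.
  rewrite mxE [RHS]mxE => <-.
  rewrite [LHS](reindex (@enum_val Y predT)) /=; last first.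
    by exists enum_rank => t _; rewrite ?enum_valK ?enum_rankK.
  by apply: eq_bigr => i _; rewrite mxE /u enum_valK enum_rankK.
pose A (s1 s2 : 'I_d * Y) := ev (f s2.1) (x s1.1 * z) *+ (lam s1.2 == s2.2).
pose Z (s1 : 'I_d * Y) := \sum_t r (x s1.1) s1.2 t * u t.
have rE h y t : r h y t = \sum_k ev (f k) h * r (x k) y t.
  by rewrite /r {1}[h]fE ev_sum; apply: eq_bigr => k _; rewrite evZ.
have zE h y : \sum_t r h y t * u t = \sum_k ev (f k) h * Z (k, y).
  under eq_bigr do rewrite rE mulr_suml.
  rewrite exchange_big; apply: eq_bigr => k _ /=.
  by rewrite /Z /= mulr_sumr; apply: eq_bigr => t _; rewrite mulrA.
have /existsP[y uy] : [exists y, u y != 0].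
  apply: contraR v_nz => /existsPn u0; apply/eqP/matrixP=> i j.
  rewrite [RHS]mxE ord1; have := u0 (enum_val i).
  by rewrite negbK /u enum_valK => /eqP.
have /existsP[k zk] : [exists k, Z (k, lam y) != 0].
  apply: contraR uy => /existsPn Z0.
  rewrite -(inj_eq (mulfI a_nz)) mulr0 -wu zE big1 // => k _.
  by have := Z0 k; rewrite negbK => /eqP->; rewrite mulr0.
apply: (@eigen_alg_int _ _ A Z a _ _ zk) => [[i1 y1] [i2 y2]|[i y1]].
  rewrite /A /= rpredMn //.
  rewrite [z]fE mulr_sumr ev_sum rpred_sum // => l _.
  by rewrite -scalerAr evZ rpredM.
rewrite -(pair_bigA _ (fun i2 y2 => A (i, y1) (i2, y2) * Z (i2, y2))) /=.
transitivity (\sum_l ev (f l) (x i * z) * Z (l, lam y1)).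
  apply: eq_bigr => l _; rewrite (bigD1 (lam y1)) //= big1 => [|t neq_t].
    by rewrite /A /= eqxx addr0.
  by rewrite /A /= eq_sym (negbTE neq_t) mul0r.
rewrite -zE.
have r_sum h y2 (phi : Y -> C) :
    \sum_t r h y2 t * phi t = \sum_g ga_val h g * phi (act y2 g).
  rewrite /r /ev; under eq_bigr do rewrite mulr_suml.
  rewrite exchange_big; apply: eq_bigr => g _ /=.
  rewrite (bigD1 (act y2 g)) //= big1 => [|t /negbTE neq_t].
    by rewrite addr0 eqxx mulr1.
  by rewrite eq_sym neq_t mulr0 mul0r.
rewrite /Z /= mulr_sumr.
transitivity (\sum_t r (x i) (lam y1) t * \sum_t' r z t t' * u t').
  under eq_bigr do rewrite rM mulr_suml.
  rewrite exchange_big; apply: eq_bigr => t _; rewrite mulr_sumr.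
  by apply: eq_bigr => t' _; rewrite mulrA.
rewrite r_sum; under eq_bigr do rewrite -lam_act wu.
rewrite -(r_sum _ _ (fun y2 => a * u y2)); apply: eq_bigr => t _.
by rewrite mulrCA.
Qed.

End Action.
End FixedPointCount.

(** * The divisibility criterion *)

Section Criterion.
Variables (C : numClosedFieldType) (gT : finGroupType) (M : {group gT}).
Hypothesis abM : abelian M.
Local Notation D := (dual C M).
Local Notation S := (subg_of M).
Local Notation KG := (group_algebra C gT).
Variable omega : D -> D -> C.
Hypothesis omega_cocycle : normalized_2cocycle omega.
Local Notation Rad := (rad omega).
Local Notation omega_nz := (omega_neq0 omega_cocycle).
Local Notation e := (@idem C gT M).
Local Notation elt := (ga_elt C).
Local Notation radG := (rad_group omega_cocycle).

Definition rad_perp : {set gT} :=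
  [set v in M | [forall r in Rad, r (subg M v) == 1]].

Lemma rad_perpP (w : S) :
  reflect (forall r, r \in Rad -> r w = 1) (sgval w \in rad_perp).
Proof.
rewrite inE subgP sgvalK /=; apply: (iffP forall_inP) => h r /h; first by move/eqP.
by move=> ->.
Qed.

Lemma rad_perp_sub : rad_perp \subset M.
Proof. by apply/subsetP=> v; rewrite inE => /andP[]. Qed.

Lemma rad_perp_group_set : group_set rad_perp.
Proof.
apply/group_setP; split=> [|v w Nv Nw].
  by apply/(rad_perpP 1%g) => r _; apply: dual1.
have Mv := subsetP rad_perp_sub v Nv; have Mw := subsetP rad_perp_sub w Nw.
move: Nv Nw; rewrite -{1 2}(@subgK _ M _ Mv) -{1 2}(@subgK _ M _ Mw) => /rad_perpP Nv /rad_perpP Nw.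
by apply/(rad_perpP (_ * _)%g) => r rR; rewrite dualM Nv ?Nw ?mulr1.
Qed.
Canonical rad_perp_group := Group rad_perp_group_set.

Lemma sum_rad (w : S) :
  \sum_(r in Rad) r w = #|Rad|%:R *+ (sgval w \in rad_perp).
Proof.
case: rad_perpP => [w1 | wN].
  by rewrite (eq_bigr (fun=> 1)) ?sumr_const // => r /w1.
have [r0 r0R r0w] : exists2 r0, r0 \in Rad & r0 w != 1.
  have /existsP[r0] : [exists r0 in Rad, r0 w != 1].
    rewrite -[X in is_true X]negbK; apply/negP => /exists_inPn r1; case: wN => r.
    by move/r1; rewrite negbK => /eqP.
  by case/andP=> *; exists r0.
apply: (mulfI (x := r0 w - 1)); first by rewrite subr_eq0.
rewrite mulr0n mulr0 mulrBl mul1r mulr_sumr.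
rewrite [X in _ - X](reindex_inj (mulgI r0)) /=.
rewrite [X in _ - X](eq_bigl (mem Rad)) => [|r]; last first.
  exact: (groupMl r (r0R : r0 \in radG)).
by under eq_bigr do rewrite -dualE; rewrite subrr.
Qed.

Lemma big_rad_perp (V : nmodType) (F : gT -> V) :
  \sum_(v in rad_perp) F v = \sum_(w : S | sgval w \in rad_perp) F (sgval w).
Proof.
rewrite (reindex_onto sgval (subg M)) => [|v /(subsetP rad_perp_sub)]; last exact: subgK.
by apply: eq_bigl => w; rewrite sgvalK eqxx andbT.
Qed.

Lemma card_rad_perp : (#|rad_perp| * #|Rad|)%N = #|M|.
Proof.
apply/eqP; rewrite -(Num.Theory.eqr_nat C) natrM; apply/eqP.
transitivity (\sum_(w : S) \sum_(r in Rad) r w).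
  under eq_bigr do rewrite sum_rad.
  rewrite -sum1_card natr_sum mulr_suml big_rad_perp big_mkcond.
  by apply: eq_bigr => w _ /=; case: (_ \in _) => //=; rewrite mul1r.
rewrite exchange_big (bigD1 (1%g : D)); last exact: (group1 radG).
rewrite sum_dual_char eqxx mulr1n big1 /= ?addr0 // => r /andP[_ /negbTE r1].
by rewrite sum_dual_char r1.
Qed.

(** Fourier inversion: the idempotents of [rad] add up to the average of the
   subgroup orthogonal to [rad]. *)
Lemma sum_idem_rad :
  \sum_(r in Rad) e r = #|rad_perp|%:R^-1 *: \sum_(v in rad_perp) elt v.
Proof.
rewrite /idem -scaler_sumr exchange_big big_rad_perp /=.
under eq_bigr do rewrite -scaler_suml.
have -> : \sum_w (\sum_(r in Rad) r w^-1%g) *: elt (sgval w) =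
    #|Rad|%:R *: \sum_(w : S | sgval w \in rad_perp) elt (sgval w).
  rewrite scaler_sumr [RHS]big_mkcond; apply: eq_bigr => w _ /=.
  rewrite sum_rad (_ : sgval w^-1%g = (sgval w)^-1%g) //.
  rewrite (groupV rad_perp_group); case: (_ \in _); rewrite ?mulr1n //.
  by rewrite mulr0n scale0r.
rewrite scalerA -card_rad_perp natrM invfM -mulrA mulVf ?mulr1 //.
exact: (cardrad_neq0 omega_cocycle).
Qed.

Variable xi : D -> C.
Hypothesis xi_neq0 : forall r, r \in Rad -> xi r != 0.
Hypothesis xiM : forall r s, r \in Rad -> s \in Rad ->
  xi r * xi s = omega r s * xi (r * s)%g.
Local Notation cochar := (cochar omega xi).
Local Notation N := rad_perp.

Variables (d : nat) (x : 'I_d -> KG) (f : 'I_d -> gT -> C).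
Hypothesis frame : integral_frame (twist omega) x f.
Local Notation in_order := (in_order f).

Lemma twisted_conv_frame g1 g2 h :
  twisted_conv omega g1 g2 h = \sum_l ev (f l) h * twisted_conv omega g1 g2 (x l).
Proof.
have [fE _ _ _] := frame.
rewrite /twisted_conv {1}[h]fE diag_comul_sum mulr_sumr mulr_suml ev2_sum.
by apply: eq_bigr => l _; rewrite diag_comulZ -scalerAr -scalerAl ev2Z.
Qed.

Lemma cochar_in_order t : in_order (#|N|%:R *: cochar t).
Proof.
move=> k; rewrite evZ.
have := cochar_alg_int abM omega_cocycle xi_neq0 xiM t frame k.
rewrite card_dual // -card_rad_perp natrM mulfK //.
exact: (cardrad_neq0 omega_cocycle).
Qed.

Variables (Y : finType) (act : Y -> gT -> Y) (lam : Y -> Y).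
Hypothesis actM : forall y g h, act y (g * h)%g = act (act y g) h.
Hypothesis act1 : forall y, act y 1%g = y.
Hypothesis lam_act : forall y g, lam (act y g) = act (lam y) g.
Local Notation chi := (fixchar C act lam).

Variables s t : gT.

Lemma fix_triplesE :
  (fix_triples act lam rad_perp_group s t)%:R = #|N|%:R ^+ 2 *
    \sum_(c in Rad) \sum_(a in Rad) ev chi (e c * elt s * e a * elt t).
Proof.
have -> : \sum_(c in Rad) \sum_(a in Rad) ev chi (e c * elt s * e a * elt t) =
    ev chi ((\sum_(c in Rad) e c) * elt s * (\sum_(a in Rad) e a) * elt t).
  rewrite !mulr_suml ev_sum; apply: eq_bigr => c _.
  by rewrite mulr_sumr mulr_suml ev_sum.
have scal (k : C) (a b b' : KG) : (k *: a) * b * (k *: a) * b' = (k ^+ 2) *: (a * b * a * b').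
  by rewrite -!scalerAl -scalerAr -!scalerAl scalerA.
have nz : #|N|%:R != 0 :> C.
  by rewrite Num.Theory.pnatr_eq0 -lt0n (cardG_gt0 rad_perp_group).
rewrite sum_idem_rad scal evZ mulrA -exprMn divff // expr1n mul1r.
rewrite !mulr_suml ev_sum natr_sum; apply: eq_bigr => v _.
rewrite mulr_sumr mulr_suml ev_sum natr_sum; apply: eq_bigr => w _.
by rewrite -!ga_eltM ev_elt.
Qed.

Lemma ev_cochar_sandwich a c :
  ev chi (cochar s * sandwich t a c) =
    (xi c / xi a * ev chi (e c * elt s * e a * elt t))
      *+ ((a \in Rad) && (c \in Rad)).
Proof.
rewrite /cochar mulr_suml ev_sum.
have term phi psi : ev chi ((xi phi / xi psi *: sandwich s phi psi) * sandwich t a c) =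
    (xi phi / xi psi * ev chi (e phi * elt s * e psi * elt t)) *+ ((psi == a) && (phi == c)).
  rewrite -scalerAl evZ /sandwich.
  have -> : e phi * elt s * e psi * (e a * elt t * e c) =
      e phi * elt s * (e psi * e a) * elt t * e c by rewrite !mulrA.
  rewrite (ev_fixcharC actM act1 lam_act).
  have -> : e c * (e phi * elt s * (e psi * e a) * elt t) =
      (e c * e phi) * elt s * (e psi * e a) * elt t by rewrite !mulrA.
  rewrite !idemM // [c == phi]eq_sym.
  case: (phi =P c) => [->|_]; last first.
    by rewrite andbF !mulr0n !mul0r linear0 mulr0.
  case: (psi =P a) => [->|_]; last by rewrite !mulr0n mulr0 mul0r linear0 mulr0.
  by rewrite !mulr1n.
case: (boolP (c \in Rad)) => cR; last first.
  rewrite andbF big1 // => phi phiR; rewrite mulr_suml ev_sum big1 // => psi psiR.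
  rewrite term; case: (phi =P c) => [Dc|_]; last by rewrite andbF.
  by rewrite Dc (negbTE cR) in phiR.
rewrite (bigD1 c) //= [X in _ + X]big1 ?addr0 => [|phi /andP[_ /negbTE phic]]; last first.
  by rewrite mulr_suml ev_sum big1 // => psi _; rewrite term phic andbF.
rewrite mulr_suml ev_sum; case: (boolP (a \in Rad)) => aR; last first.
  rewrite big1 // => psi psiR; rewrite term.
  by case: (psi =P a) => [Da|//]; rewrite Da (negbTE aR) in psiR.
rewrite (bigD1 a) //= [X in _ + X]big1 ?addr0 => [|psi /andP[_ /negbTE psia]]; last first.
  by rewrite term psia.
by rewrite term !eqxx.
Qed.

(** Since [chi] is a class function, [chi (c_s * _)] only sees the terms
   [e_a t e_c] with [a] and [c] in [Rad].  On these, translating the summation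
   indices by [a] and [c] turns the coefficients of the coproduct into those of
   [cochar t], by the relation between [xi] and [omega]. *)
Lemma twisted_conv_cochar (g : gT -> C) :
  twisted_conv omega (fun h => ev chi (cochar s * elt h)) g (cochar t) =
  (\sum_(c in Rad) \sum_(a in Rad) ev chi (e c * elt s * e a * elt t)) *
    ev g (cochar t).
Proof.
set G := (fun h => _).
have evG h : ev G h = ev chi (cochar s * h).
  rewrite {2}[h]ga_sumE mulr_sumr ev_sum; apply: eq_bigr => k _.
  by rewrite -scalerAr evZ.
pose R2 (F : D -> D -> C) := \sum_(phi in Rad) \sum_(psi in Rad) F phi psi.
transitivity (R2 (fun phi psi => xi phi / xi psi * R2 (fun a c =>
   omega a (a^-1 * phi)%g / omega c (c^-1 * psi)%g *
   (xi c / xi a * ev chi (e c * elt s * e a * elt t) *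
    ev g (sandwich t (a^-1 * phi)%g (c^-1 * psi)%g))))).
  rewrite /twisted_conv {1}/cochar diag_comul_sum mulr_sumr mulr_suml ev2_sum.
  apply: eq_bigr => phi _; rewrite diag_comul_sum mulr_sumr mulr_suml ev2_sum.
  apply: eq_bigr => psi _; rewrite diag_comulZ -scalerAr -scalerAl ev2Z.
  rewrite (sandwich_comul abM omega_cocycle) ev2_sum /R2; congr (_ * _).
  rewrite [RHS]big_mkcond; apply: eq_bigr => a _.
  rewrite ev2_sum; case: (boolP (a \in Rad)) => aR; last first.
    rewrite big1 // => c _; rewrite ev2Z ev2_tensor evG ev_cochar_sandwich.
    by rewrite (negbTE aR) mulr0n mul0r mulr0.
  rewrite [RHS]big_mkcond; apply: eq_bigr => c _.
  rewrite ev2Z ev2_tensor evG ev_cochar_sandwich aR /=.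
  by case: (c \in Rad); rewrite ?mulr1n // mulr0n mul0r mulr0.
transitivity (R2 (fun a c => R2 (fun phi psi => xi phi / xi psi *
   (omega a (a^-1 * phi)%g / omega c (c^-1 * psi)%g *
   (xi c / xi a * ev chi (e c * elt s * e a * elt t) *
    ev g (sandwich t (a^-1 * phi)%g (c^-1 * psi)%g)))))).
  have R2M k (F : D -> D -> C) : k * R2 F = R2 (fun a c => k * F a c).
    by rewrite [LHS]mulr_sumr; apply: eq_bigr => a _; rewrite mulr_sumr.
  have R2C (F : D -> D -> D -> D -> C) :
      R2 (fun phi psi => R2 (F phi psi)) = R2 (fun a c => R2 (fun phi psi => F phi psi a c)).
    transitivity (\sum_(phi in Rad) \sum_(a in Rad) \sum_(psi in Rad)
        \sum_(c in Rad) F phi psi a c).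
      by apply: eq_bigr => phi _; apply: exchange_big.
    rewrite exchange_big; apply: eq_bigr => a _ /=.
    transitivity (\sum_(phi in Rad) \sum_(c in Rad) \sum_(psi in Rad) F phi psi a c).
      by apply: eq_bigr => phi _; apply: exchange_big.
    exact: exchange_big.
  rewrite -R2C; apply: eq_bigr => phi _; apply: eq_bigr => psi _; exact: R2M.
rewrite {1}/R2 exchange_big mulr_suml /=; apply: eq_bigr => c cR.
rewrite mulr_suml; apply: eq_bigr => a aR.
move: (ev chi _) => k; rewrite /R2 /cochar ev_sum mulr_sumr.
rewrite (reindex_inj (mulgI a)) /=; apply: eq_big => [phi|phi].
  exact: (groupMl phi (aR : a \in radG)).
rewrite (groupMl phi (aR : a \in radG)) => phiR.
rewrite ev_sum mulr_sumr (reindex_inj (mulgI c)) /=; apply: eq_big => [psi|psi].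
  exact: (groupMl psi (cR : c \in radG)).
rewrite (groupMl psi (cR : c \in radG)) => psiR.
rewrite !mulKg evZ.
have /(canRL (mulKf (omega_nz a phi))) -> := esym (xiM aR phiR).
have /(canRL (mulKf (omega_nz c psi))) -> := esym (xiM cR psiR).
by field; rewrite !omega_nz !xi_neq0.
Qed.

(** [cs] and [ct] are integral, [k%:R *: cochar t] is integral as a contraction of
   the coproduct of [ct] with [chi (cs * _)], and the value of [chi (cs * _)] at
   this element is [k ^ 2 / |N|]. *)
Lemma dvdn_fix_triples_sqr : (#|N| %| fix_triples act lam rad_perp_group s t ^ 2)%N.
Proof.
have nz : #|N|%:R != 0 :> C.
  by rewrite Num.Theory.pnatr_eq0 -lt0n (cardG_gt0 rad_perp_group).
set k := fix_triples _ _ _ _ _; set K := \sum_(c in Rad) \sum_(a in Rad) ev chi (e c * elt s * e a * elt t).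
have Dk : k%:R = #|N|%:R ^+ 2 * K :> C by exact: fix_triplesE.
have [fE fI _ fD] := frame.
set cs := #|N|%:R *: cochar s; set ct := #|N|%:R *: cochar t.
have csX : in_order cs by apply: cochar_in_order.
have ctX : in_order ct by apply: cochar_in_order.
have chi_cs h : in_order h -> ev chi (cs * h) \in alg_int.
  move=> hX; apply: (fixchar_alg_int actM lam_act frame).
  exact: in_orderM frame _ _ csX hX.
pose G h : C := ev chi (cochar s * elt h).
have evG h : ev G h = ev chi (cochar s * h).
  rewrite {2}[h]ga_sumE mulr_sumr ev_sum; apply: eq_bigr => l _.
  by rewrite -scalerAr evZ.
(* Expand the coproduct of ct along the frame in both tensor factors. *)
have hX : in_order (k%:R *: cochar t).
  move=> l; rewrite evZ Dk.
  have -> : #|N|%:R ^+ 2 * K * ev (f l) (cochar t) =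
      #|N|%:R * twisted_conv omega G (f l) ct.
    rewrite /twisted_conv /ct diag_comulZ -scalerAr -scalerAl ev2Z.
    by rewrite -/(twisted_conv omega G (f l) (cochar t)) twisted_conv_cochar !mulrA expr2.
  rewrite twisted_conv_frame mulr_sumr; apply: rpred_sum => i _.
  rewrite mulrCA rpredM //.
  rewrite /twisted_conv; move: (twist _ * _ * _) (fD i) => D_i D_iX.
  have -> : #|N|%:R * ev2 G (f l) D_i =
      \sum_j ev chi (cs * x j) * ev2 (f j) (f l) D_i.
    rewrite /ev2 /ev mulr_sumr; under [RHS]eq_bigr do rewrite mulr_sumr.
    rewrite exchange_big; apply: eq_bigr => y _ /=.
    rewrite mulrCA; under [RHS]eq_bigr do rewrite mulrCA.
    rewrite -mulr_sumr; congr (_ * _); rewrite mulrA.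
    under [RHS]eq_bigr do rewrite mulrA.
    rewrite -mulr_suml; congr (_ * _); rewrite /G -evZ scalerAl -/cs.
    rewrite {1}[elt y.1]fE mulr_sumr ev_sum; apply: eq_bigr => j _.
    by rewrite -scalerAr evZ ev_elt mulrC.
  apply: rpred_sum => j _; rewrite rpredM //.
  by apply: chi_cs => j'; apply: fI.
have := chi_cs _ hX.
rewrite /cs -scalerAl -scalerAr !evZ.
have -> : ev chi (cochar s * cochar t) = K.
  rewrite {2}/cochar mulr_sumr ev_sum /K [RHS]exchange_big.
  apply: eq_bigr => a aR /=.
  rewrite mulr_sumr ev_sum; apply: eq_bigr => c cR.
  rewrite -scalerAr evZ ev_cochar_sandwich aR cR mulr1n.
  by move: (ev chi _) => k0; field; rewrite !xi_neq0.
have -> : #|N|%:R * (k%:R * K) = (k ^ 2)%:R / #|N|%:R :> C.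
  by rewrite natrX Dk; field.
by apply: alg_int_frac; apply: cardG_gt0 rad_perp_group.
Qed.

End Criterion.

(** * Non-cyclicity of the orthogonal of the radical *)

Section Noncyclic.
Variables (C : numClosedFieldType) (gT : finGroupType) (M : {group gT}).
Hypothesis abM : abelian M.
Local Notation D := (dual C M).
Local Notation S := (subg_of M).
Variable omega : D -> D -> C.
Hypothesis omega_cocycle : normalized_2cocycle omega.
Local Notation Rad := (rad omega).
Local Notation N := (rad_perp omega).
Local Notation radG := (rad_group omega_cocycle).

(** Otherwise [phi] is orthogonal to every element of [Rad] in the space of
   functions on [M], hence to their sum, which is [|Rad|] times the indicator
   function of [N]. *)
Lemma dual_rad_perp (phi : D) :
  (forall w : S, sgval w \in N -> phi w = 1) -> phi \in Rad.
Proof.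
move=> phiN; apply: contraT => phiR.
have: \sum_(w : S) phi w^-1%g * (\sum_(r in Rad) r w) = #|M|%:R.
  under eq_bigr do rewrite (sum_rad omega_cocycle).
  rewrite -(card_rad_perp omega_cocycle) natrM.
  rewrite -[#|N|]sum1_card natr_sum mulr_suml.
  rewrite big_rad_perp [RHS]big_mkcond.
  apply: eq_bigr => w _ /=; case: (boolP (_ \in N)) => wN; last by rewrite mulr0.
  by rewrite dualV phiN // invr1.
under eq_bigr do rewrite mulr_sumr.
rewrite exchange_big big1 => [/esym/eqP|r rR] /=.
  by rewrite (negbTE (cardM_neq0 C M)).
transitivity (\sum_w (phi^-1 * r)%g w).
  by apply: eq_bigr => w _; rewrite dualE dualVE dualV.
rewrite sum_dual_char; case: eqP => // /(canRL (mulKg _)).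
by rewrite invgK mulg1 => Dr; rewrite Dr (negbTE phiR) in rR.
Qed.

(** If [N] is cyclic then so is its dual, the quotient by [Rad] of the dual of
   [M].  A generator of this quotient is orthogonal to itself, as [comm_bichar]
   is alternating, and to [Rad], hence it lies in [Rad]. *)
Lemma cyclic_rad_perp : cyclic N -> forall phi, phi \in Rad.
Proof.
case/cyclicP=> v DN.
have Nv : v \in N by rewrite DN cycle_id.
have [w Dv] : exists w : S, v = sgval w.
  by exists (subg M v); rewrite subgK // (subsetP (rad_perp_sub omega)).
have radE phi : (phi \in Rad) = (phi w == 1).
  apply/idP/eqP=> [phiR | phiw]; first by move: Nv; rewrite Dv => /rad_perpP->.
  apply: dual_rad_perp => u; rewrite DN => /cycleP[k].
  have -> : (v ^+ k)%g = sgval (w ^+ k)%g.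
    by rewrite Dv; elim: k => // k IHk; rewrite !expgS IHk.
  move/val_inj=> ->; elim: k => [|k IHk]; first by rewrite expg0 dual1.
  by rewrite expgS dualM IHk phiw mulr1.
have nR : ([set: D] \subset 'N(Rad))%g.
  apply/subsetP=> phi _; rewrite inE; apply/subsetP=> _ /imsetP[r rR ->].
  by rewrite conjgE (dualC r) mulKg.
(* Evaluation at the generator w of N embeds the quotient in the
   multiplicative group of C. *)
pose f (z : coset_of radG) : C := (repr z : D) w.
have f_coset phi : f (coset radG phi) = phi w.
  rewrite /f; have: repr (coset radG phi) \in coset radG phi by apply: mem_repr_coset.
  rewrite val_coset ?(subsetP nR) ?inE //= => /rcosetP[r rR ->].
  by rewrite dualE; move: rR; rewrite /= radE => /eqP->; rewrite mul1r.
have cosetX z : exists phi, z = coset radG phi.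
  by case: (cosetP z) => phi _ ->; exists phi.
have /cyclicP[z Dz] : cyclic ([set: coset_of radG]).
  apply: (@field_mul_group_cyclic _ _ _ f) => [z1 z2 _ _|z _].
    have [phi1 ->] := cosetX z1; have [phi2 ->] := cosetX z2.
    by rewrite -morphM ?(subsetP nR) ?inE // !f_coset dualE.
  have [phi ->] := cosetX z; rewrite f_coset; split=> [phiw|phi1].
    by apply: coset_id; rewrite /= radE phiw.
  by apply/eqP; rewrite -radE; apply: coset_idr phi1; rewrite (subsetP nR) ?inE.
have [gam Dgam] := cosetX z.
have genD phi : exists k r, r \in Rad /\ phi = (r * gam ^+ k)%g.
  have: coset radG phi \in <[z]>%g by rewrite -Dz inE.
  case/cycleP=> k; rewrite Dgam -morphX ?(subsetP nR) ?inE // => eq_phi.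
  have : phi \in coset radG (gam ^+ k)%g.
    by rewrite -eq_phi val_coset ?rcoset_refl // (subsetP nR) ?inE.
  rewrite val_coset ?(subsetP nR) ?inE // => /rcosetP[r rR ->].
  by exists k, r.
have bc1 a : comm_bichar omega a a = 1.
  by rewrite /comm_bichar divff // (omega_neq0 omega_cocycle).
have gamR : gam \in Rad.
  apply/(comm_bichar_rad omega_cocycle) => a; have [k [r [rR ->]]] := genD a.
  rewrite comm_bicharM //.
  have -> : comm_bichar omega r gam = 1.
    by rewrite /comm_bichar (radP _ _ rR) divff // (omega_neq0 omega_cocycle).
  rewrite mul1r; elim: k => [|k IHk]; last by rewrite expgS comm_bicharM // bc1 IHk mulr1.
  by rewrite /comm_bichar (omega1l omega_cocycle) (omega1r omega_cocycle) divff // oner_eq0.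
move=> phi; have [k [r [rR ->]]] := genD phi.
by apply: (@groupM _ radG) => //; apply: (@groupX _ radG).
Qed.

(** When [Rad] is the whole dual, [omega] is the coboundary of [xi]. *)
Lemma noncyclic_rad_perp : ~ is_2coboundary omega -> ~~ cyclic N.
Proof.
move=> ncob; apply/negP=> /cyclic_rad_perp allR; apply: ncob.
have [xi xi_nz xiM] := rad_char omega_cocycle.
exists xi => [phi|phi psi]; first exact/xi_nz/allR.
by rewrite xiM ?allR // mulfK // xi_nz ?allR.
Qed.

End Noncyclic.

Definition fix_triples_divisible (gT : finGroupType) (N : {group gT}) :=
  forall (Y : finType) (act : Y -> gT -> Y) (lam : Y -> Y),
    (forall y g h, act y (g * h)%g = act (act y g) h) ->
    (forall y, act y 1%g = y) ->
    (forall y g, lam (act y g) = act (lam y) g) ->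
  forall s t, (#|N| %| fix_triples act lam N s t ^ 2)%N.

Lemma hopf_order_fix_triples (C : numClosedFieldType) (gT : finGroupType)
    (M : {group gT}) (omega : dual C M -> dual C M -> C)
    (L : fieldExtType rat) (iota : {rmorphism L -> C}) :
    abelian M -> normalized_2cocycle omega -> ~ is_2coboundary omega ->
    admits_hopf_order (iota \o (\val : ring_of_integers L -> L))
      (twisted_group_algebra (twist omega)) ->
  exists N : {group gT},
    [/\ N \subset M, ~~ cyclic N & fix_triples_divisible N].
Proof.
move=> abM omega_cocycle ncob /hopf_order_frame[d [x [f frame]]].
have [xi xi_nz xiM] := rad_char omega_cocycle.
exists (rad_perp_group omega); split=> [||Y act lam actM act1 lam_act s t].
- exact: rad_perp_sub.
- exact: noncyclic_rad_perp.
exact: (dvdn_fix_triples_sqr abM omega_cocycle xi_nz xiM frame actM act1 lam_act).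
Qed.

(** * Counting fixed triples *)

Section Parity.

(** The points that are not fixed come in pairs. *)
Lemma odd_card_invol (T : finType) (A : {set T}) (f : T -> T) :
    {in A, forall x, f x \in A} -> {in A, cancel f f} ->
  odd #|A| = odd #|[set x in A | f x == x]|.
Proof.
have [k] := ubnP #|A|; elim: k A => // k IHk A ltAk fA fK.
case: (pickP [pred x in A | f x != x]) => [x /andP[/= Ax fx] | noA]; last first.
  congr (odd _); apply: eq_card => x; rewrite inE.
  by case: (boolP (x \in A)) => //= Ax; have := noA x; rewrite /= Ax /= => /negbFE->.
set B := A :\ x :\ f x; have Afx := fA x Ax.
have cardA : #|A| = #|B|.+2.
  by rewrite (cardsD1 x) Ax (cardsD1 (f x)) !inE fx Afx.
have BA y : y \in B -> y \in A by rewrite !inE => /and3P[].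
have fB : {in B, forall y, f y \in B}.
  move=> y By; have Ay := BA y By; move: By; rewrite !inE (fA y Ay) Ay !andbT.
  case/andP=> y_fx y_x; apply/andP; split.
    by apply: contraNneq y_x => eqf; rewrite -(fK y Ay) eqf fK.
  by apply: contraNneq y_fx => <-; rewrite fK.
rewrite cardA /= negbK (IHk B) //; first last.
- by move=> y /BA; apply: fK.
- by move: ltAk; rewrite cardA !ltnS => /ltnW.
congr (odd _); apply: eq_card => y; rewrite !inE.
case: (y =P f x) => [->|_] /=.
  by rewrite (fK x Ax) eq_sym (negbTE fx) andbF.
by case: (y =P x) => [->|//]; rewrite (negbTE fx) !andbF.
Qed.

End Parity.

Section Counting.
Variables (gT : finGroupType) (N : {group gT}).
Variables (Y : finType) (act : Y -> gT -> Y).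
Hypothesis actM : forall y g h, act y (g * h)%g = act (act y g) h.
Hypothesis act1 : forall y, act y 1%g = y.

Lemma actK g : cancel (act^~ g) (act^~ g^-1%g).
Proof. by move=> y; rewrite -actM mulgV act1. Qed.

Lemma actKV g : cancel (act^~ g^-1%g) (act^~ g).
Proof. by move=> y; rewrite -actM mulVg act1. Qed.

(** The fixed points [y] of [v r w r] come in pairs under the action of [v], except
   those for which [v] fixes [y] and [w] fixes [y r].  So the count has the parity
   of the sum over [y] of [a y * a (y r)], where the order [a y] of the stabilizer
   of [y] in [N] is odd if and only if the stabilizer is trivial.  The remaining
   points come in pairs under [r]. *)
Lemma odd_fix_triples_invol r :
    {in N, forall v, v * v = 1}%g -> (r * r = 1)%g ->
  odd (fix_triples act id N r r) =
  odd #|[set y | (act y r == y) && [forall v in N, (act y v == y) ==> (v == 1%g)]]|.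
Proof.
move=> N2 r2.
pose a y := #|[set v in N | act y v == y]|.
pose reg y := [forall v in N, (act y v == y) ==> (v == 1%g)].
have odd_a y : odd (a y) = reg y.
  case: (boolP (reg y)) => [/forall_inP regy | ].
    rewrite (_ : a y = 1%N) // -(cards1 (1%g : gT)); apply: eq_card => v.
    rewrite !inE; apply/andP/eqP=> [[Nv fv] | ->]; last by rewrite group1 act1.
    by apply/eqP; have := regy v Nv; rewrite fv.
  rewrite negb_forall => /existsP[v]; rewrite !negb_imply => /and3P[Nv /eqP yv v1].
  (* Translation by v pairs the elements of a nontrivial stabilizer. *)
  rewrite /a (@odd_card_invol _ _ (fun w => v * w)%g).
  - rewrite (_ : [set w in _ | _] = set0) ?cards0 //; apply/setP=> w; rewrite !inE.
    by rewrite (eq_mulgV1 (v * w)%g w) mulgK (negbTE v1) andbF.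
  - by move=> w; rewrite !inE => /andP[Nw /eqP yw]; rewrite groupM // actM yv yw eqxx.
  by move=> w _; rewrite mulgA N2 // mul1g.
have fix_parity v w : v \in N -> w \in N ->
    odd (fixcount act id (v * r * w * r)%g) =
    odd #|[set y | (act y v == y) && (act (act y r) w == act y r)]|.
  move=> Nv Nw; rewrite /fixcount (@odd_card_invol _ _ (act^~ v)).
  - congr (odd _); apply: eq_card => y; rewrite !inE.
    case: (act y v =P y) => [yv | _]; rewrite ?andbF // andbT /= !actM yv.
    by rewrite -[LHS](can_eq (actK r)) -[in LHS](actM _ r r) r2 act1.
  - move=> y; rewrite !inE => /eqP fy; rewrite -!actM; apply/eqP.
    rewrite !mulgA N2 // mul1g -{1}fy -actM.
    rewrite !mulgA -(mulgA _ r r) r2 mulg1 -(mulgA _ w w) N2 // mulg1.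
    by rewrite -(mulgA _ r r) r2 mulg1.
  by move=> y _; rewrite -actM N2 ?act1.
have -> : odd (fix_triples act id N r r) = odd (\sum_y a y * a (act y r)).
  have -> : (\sum_y a y * a (act y r) = \sum_(v in N) \sum_(w in N)
     #|[set y | (act y v == y) && (act (act y r) w == act y r)]|)%N.
    under [RHS]eq_bigr do under eq_bigr do rewrite -sum1_card big_mkcond /=.
    under [RHS]eq_bigr do rewrite exchange_big /=.
    rewrite [RHS]exchange_big; apply: eq_bigr => y _ /=.
    rewrite /a -!sum1_card big_distrl /= big_mkcond [RHS]big_mkcond.
    apply: eq_bigr => v _; rewrite !inE; case: (v \in N) => //=.
    case yv: (act y v == y) => /=; last first.
      by rewrite big1 // => w _; rewrite inE yv.
    rewrite mul1n big_mkcond [RHS]big_mkcond; apply: eq_bigr => w _.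
    by rewrite !inE yv; case: (w \in N).
  rewrite /fix_triples !(big_morph odd oddD (erefl : odd 0 = false)).
  apply: eq_bigr => v Nv; rewrite !(big_morph odd oddD (erefl : odd 0 = false)).
  by apply: eq_bigr => w Nw; apply: fix_parity.
have -> : odd (\sum_y a y * a (act y r)) = odd #|[set y | reg y && reg (act y r)]|.
  rewrite -sum1_card [in RHS]big_mkcond !(big_morph odd oddD (erefl : odd 0 = false)).
  by apply: eq_bigr => y _; rewrite inE oddM !odd_a; case: ifP.
rewrite (@odd_card_invol _ _ (act^~ r)).
- congr (odd _); apply: eq_card => y; rewrite !inE -/(reg y).
  by case: (act y r =P y) => [->|_]; rewrite ?andbF // andbT andbb.
- move=> y; rewrite !inE -actM r2 act1 andbC //.
by move=> y _; rewrite -actM r2 act1.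
Qed.

Lemma dvdn_sum_cosets (U : {group gT}) (c : gT -> nat) p :
    N \subset U -> {in N & U, forall v u, c (v * u)%g = c u} ->
    {in U, forall u, (p %| c u)%N} ->
  (#|N| * p %| \sum_(u in U) c u)%N.
Proof.
move=> sNU cN pc; rewrite (set_partition_big _ (rcosets_partition sNU)) /=.
apply: dvdn_sum => A /rcosetsP[u Uu ->].
rewrite (eq_bigr (fun=> c u)) => [|_ /rcosetP[v Nv ->]]; last exact: cN.
by rewrite sum_nat_const card_rcoset dvdn_mul // pc.
Qed.

(** [Y] is a projective line in which [U] fixes [y0] and is simply transitive on
   the other points.  If [p] divided all the counts for [u w] and the inverse of
   [w], it would divide their sum over [U] divided by [|N|], because these counts
   are constant on the cosets of [N].  That quotient is the sum [S] over [n] in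
   [N] of the number of pairs [(u, y)] with [y (u (w n w^-1)) = y], which is
   [2 |U|] for [n = 1] and [|U| - 1] otherwise. *)
Lemma unipotent_fix_triples (U : {group gT}) (y0 : Y) (w : gT) p :
    prime p -> (p %| #|N|)%N -> N \subset U ->
    {in U, forall u, act y0 u = y0} ->
    (forall y y', y != y0 -> y' != y0 ->
       exists2 u, u \in U & forall u', u' \in U -> (act y u' == y') = (u' == u)) ->
    act y0 w != y0 ->
  exists s t, ~~ (p %| fix_triples act id N s t)%N.
Proof.
move=> p_pr pN sNU Uy0 Ureg wy0.
have pU : (p %| #|U|)%N by apply: dvdn_trans pN (cardSg sNU).
have regU y u : u \in U -> y != y0 -> (act y u == y) = (u == 1%g).
  move=> Uu yy0; have [u1 Uu1 h] := Ureg y y yy0 yy0.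
  have: (act y 1%g == y) = (1%g == u1) by apply: h.
  by rewrite act1 eqxx => /esym/eqP->; apply: h.
pose g n := (w * n * w^-1)%g.
pose S := (\sum_(n in N) \sum_(u in U) fixcount act id (u * g n))%N.
case: (boolP [forall u in U, (p %| fix_triples act id N (u * w)%g w^-1%g)%N]) => [/forall_inP pD|]; last first.
  rewrite negb_forall => /existsP[u]; rewrite negb_imply => /andP[_ pu].
  by exists (u * w)%g, w^-1%g.
have pS : (p %| S)%N.
  rewrite -(dvdn_pmul2l (cardG_gt0 N)).
  have -> : (#|N| * S = \sum_(u in U) fix_triples act id N (u * w)%g w^-1%g)%N.
    rewrite /fix_triples exchange_big /= -sum_nat_const; apply: eq_bigr => v Nv.
    rewrite exchange_big; apply: eq_bigr => n Nn /=.
    rewrite (reindex_inj (mulgI v)) /=; apply: eq_big => [u|u Uu].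
      by rewrite groupMl // (subsetP sNU).
    by rewrite /g !mulgA.
  apply: dvdn_sum_cosets => // v u Nv Uu; rewrite /fix_triples [RHS](reindex_inj (mulIg v)) /=.
  apply: eq_big => [v'|v' Nv']; first by rewrite groupMr.
  by apply: eq_bigr => n _; rewrite !mulgA.
pose q := #|[set y | y != y0]|.
have DU : q = #|U|.
  rewrite /q -(@card_in_imset _ _ (act (act y0 w)) U) => [|u u' Uu Uu' equ].
    apply: eq_card => y; rewrite inE; apply/idP/imsetP=> [yy0 | [u Uu ->]].
      by have [u Uu h] := Ureg _ y wy0 yy0; exists u => //; apply/esym/eqP; rewrite h.
    by apply: contraNneq wy0 => h; rewrite -(actK u (act y0 w)) h Uy0 ?groupV.
  have u'y0 : act (act y0 w) u' != y0.
    by apply: contraNneq wy0 => h; rewrite -(actK u' (act y0 w)) h Uy0 ?groupV.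
  have [u1 Uu1 h] := Ureg _ _ wy0 u'y0.
  by move/eqP: equ; rewrite h // => /eqP->; apply/esym/eqP; rewrite -h.
(* For a fixed y, count the u such that u sends y where the inverse of g n
   does: all or none if y is y0, one or none otherwise. *)
have KE n : n \in N -> (\sum_(u in U) fixcount act id (u * g n) =
     #|U| * (act y0 (g n)^-1 == y0)%g + \sum_(y | y != y0) (act y (g n)^-1 != y0)%g)%N.
  move=> Nn; transitivity (\sum_y #|[set u in U | act y u == act y (g n)^-1%g]|)%N.
    under [RHS]eq_bigr do rewrite -sum1_card big_mkcond /=.
    rewrite [RHS]exchange_big [LHS]big_mkcond; apply: eq_bigr => u _ /=.
    case: (boolP (u \in U)) => Uu; last by rewrite big1 // => y _; rewrite inE (negbTE Uu).
    rewrite /fixcount -sum1_card big_mkcond; apply: eq_bigr => y _; rewrite !inE Uu /=.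
    by rewrite actM -{2}(actKV (g n) y) (can_eq (actK (g n))).
  rewrite (bigD1 y0) //=; congr (_ + _)%N.
    rewrite -sum1_card big_mkcond /= -sum_nat_const [RHS]big_mkcond; apply: eq_bigr => u _.
    by rewrite inE; case: (boolP (u \in U)) => //= Uu; rewrite Uy0 // eq_sym; case: eqP.
  apply: eq_bigr => y yy0; case: (boolP (act y (g n)^-1%g == y0)) => [/eqP->|gy] /=.
    apply/eqP; rewrite cards_eq0; apply/eqP/setP=> u; rewrite !inE.
    apply/negbTE; apply: contra yy0 => /andP[Uu /eqP yu].
    by rewrite -(actK u y) yu Uy0 ?groupV.
  have [u Uu h] := Ureg y _ yy0 gy.
  rewrite -(cards1 u); apply: eq_card => u'; rewrite !inE.
  case: (boolP (u' \in U)) => [Uu'|nUu'] /=; first exact: h.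
  by apply/esym/eqP => Du; rewrite Du Uu in nUu'.
have K1 : (\sum_(u in U) fixcount act id (u * g 1%g) = #|U| + #|U|)%N.
  rewrite KE ?group1 // /g mulg1 mulgV invg1 act1 eqxx muln1; congr (_ + _)%N.
  rewrite -DU /q -sum1_card; apply: eq_big => [y|y yy0]; first by rewrite inE.
  by rewrite act1 yy0.
have Kn n : n \in N -> n != 1%g -> (\sum_(u in U) fixcount act id (u * g n) + 1 = #|U|)%N.
  move=> Nn n1; have Un := subsetP sNU n Nn.
  have fix_g m : m \in N -> m != 1%g -> act y0 (g m) != y0.
    move=> Nm m1; apply: contra m1 => /eqP; rewrite /g actM actM => h.
    rewrite -(regU _ m (subsetP sNU m Nm) wy0); apply/eqP.
    by apply: (can_inj (actK w^-1%g)); rewrite h actK.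
  rewrite KE // -DU /q -sum1_card.
  have -> : (g n)^-1%g = g n^-1%g by rewrite /g !invMg invgK mulgA.
  rewrite (negbTE (fix_g _ _ _)) ?groupV ?invg_eq1 // muln0 add0n.
  have gy0 := fix_g n Nn n1.
  rewrite [RHS](eq_bigl (fun y => y != y0)) => [|y]; last by rewrite inE.
  rewrite (bigD1 (act y0 (g n))) //= [in RHS](bigD1 (act y0 (g n))) //=.
  have gK : act (act y0 (g n)) (g n^-1%g) = y0.
    by rewrite -actM /g !mulgA mulgKV -(mulgA w) mulgV mulg1 mulgV act1.
  rewrite gK eqxx add0n addnC; congr (_ + _)%N; apply: eq_bigr => y /andP[_ yg].
  suff -> : act y (g n^-1%g) != y0 by [].
  by apply: contra yg => /eqP <-; rewrite -actM /g !mulgA mulgKV -(mulgA w) mulVg mulg1 mulgV act1.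
(* This rearranges S = 2 |U| + (|N| - 1) (|U| - 1) without subtractions. *)
have: (S + #|N| = 1 + #|U| * (#|N| + 1))%N.
  have DN : #|N| = (\sum_(n in N | n != 1%g) 1).+1%N.
    by rewrite -sum1_card (bigD1 1%g) //= add1n.
  rewrite /S (bigD1 1%g) //= K1 {1}DN -addnA addnS -big_split /=.
  rewrite (eq_bigr (fun=> #|U|)) => [|n /andP[Nn n1]]; last exact: Kn.
  rewrite -[X in (_ + X.+1)%N]mul1n.
  have -> : (\sum_(n in N | n != 1%g) #|U| = #|U| * #|N|.-1)%N.
    by rewrite -[#|U| in LHS]muln1 -big_distrr /= DN.
  rewrite -(prednK (cardG_gt0 N)) /=; nia.
move/(congr1 (dvdn p)); rewrite (dvdn_addr _ pS) pN (dvdn_addl _ (dvdn_mulr _ pU)).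
by rewrite dvdn1 => /esym/eqP p1; rewrite p1 in p_pr.
Qed.

End Counting.

(** In the application [Y] is the set of nonzero vectors up to sign, [inf] the
   set of those on a given line, [b] the family of the elements of the Borel
   subgroup of that line and [mu i] the scalar for which [b i] followed by
   [mu i] fixes the line pointwise. *)
Section TwistedCounting.
Variables (gT : finGroupType) (N : {group gT}).
Variables (Y : finType) (act : Y -> gT -> Y).
Hypothesis actM : forall y g h, act y (g * h)%g = act (act y g) h.
Hypothesis act1 : forall y, act y 1%g = y.
Variables (K : Type) (mulK : K -> K -> K) (oneK : K) (sc : K -> Y -> Y).
Hypothesis scM : forall c d y, sc (mulK c d) y = sc c (sc d y).
Hypothesis sc1 : forall y, sc oneK y = y.
Hypothesis sc_act : forall c y g, sc c (act y g) = act (sc c y) g.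
Variables (I : finType) (b : I -> gT) (mu : I -> K) (inf : pred Y).
Hypothesis inf_sc : forall c y, inf (sc c y) = inf y.
Hypothesis inf_b : forall i y, inf (act y (b i)) = inf y.
Hypothesis inf_free : forall y v, v \in N -> inf y -> inf (act y v) -> v = 1%g.
Hypothesis inf_fix : forall i y, inf y -> sc (mu i) (act y (b i)) = y.
Hypothesis noninf_reg : forall y y', ~~ inf y -> ~~ inf y' ->
  odd #|[set i | sc (mu i) (act y (b i)) == y']|.
Hypothesis odd_I : odd #|I|.

(** The kernel modulo 2 of the operator summing all the [b i] followed by
   [mu i]; by [kE] it is the identity on [inf] and takes the constant value [1]
   on the complement. *)
Let k (a z : Y) : 'F_2 := \sum_i (sc (mu i) (act a (b i)) == z)%:R.

Let F2_dbl (a : 'F_2) : a + a = 0.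
Proof.
by rewrite -mulr2n -mulr_natr (_ : 2%:R = 0 :> 'F_2) ?mulr0 //; apply: val_inj.
Qed.

Let F2_odd n : n%:R = (odd n)%:R :> 'F_2.
Proof.
rewrite -[in LHS](odd_double_half n) natrD -muln2 natrM.
by rewrite (_ : 2%:R = 0 :> 'F_2) ?mulr0 ?addr0 //; apply: val_inj.
Qed.

Let kE a z : k a z = (if inf a then a == z else ~~ inf z)%:R.
Proof.
have -> : k a z = #|[set i | sc (mu i) (act a (b i)) == z]|%:R.
  rewrite -sum1_card natr_sum [RHS]big_mkcond; apply: eq_bigr => i _.
  by rewrite inE; case: ifP.
rewrite F2_odd; congr (nat_of_bool _)%:R; case: ifPn => ia.
  case: eqP => [<- | az].
    rewrite (_ : [set i | _] = setT) ?cardsT //; apply/setP=> i.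
    by rewrite !inE inf_fix // eqxx.
  rewrite (_ : [set i | _] = set0) ?cards0 //; apply/setP=> i.
  by rewrite !inE inf_fix //; apply/eqP.
case: (boolP (inf z)) => iz /=; last exact: noninf_reg.
rewrite (_ : [set i | _] = set0) ?cards0 //; apply/setP=> i; rewrite !inE.
by apply: contraNF ia => /eqP Dz; rewrite -(inf_b i) -(inf_sc (mu i)) Dz.
Qed.

(** If all counts are even, then for each scalar [c] the sum [e c y] of products
   of two kernels has an even total over [y], since it is a sum of the counts for
   the pairs [b i], [b j] with suitable scalars.  But [e l] and [e oneK] only
   differ on [inf], where [e l y + e oneK y = 1]: in [e oneK y] the term at
   [v = w = 1] is [1], whereas in [e l y] it vanishes because [l] moves [y].  As
   [inf] has an odd number of points this is a contradiction. *)
Lemma twisted_fix_triples (l : K) :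
    (forall y, inf y -> sc l y != y) -> odd #|[set y | inf y]| ->
  exists s t c, odd (fix_triples act (sc c) N s t).
Proof.
move=> l_fix odd_inf.
case: (pselect (exists s t c, odd (fix_triples act (sc c) N s t))) => // noodd.
have even_d s t c : (fix_triples act (sc c) N s t)%:R = 0 :> 'F_2.
  by rewrite F2_odd; case: (boolP (odd _)) => // h; case: noodd; exists s, t, c.
pose e c y : 'F_2 := \sum_(v in N) \sum_(w in N)
   \sum_z k (act (sc c y) v) z * k (act z w) y.
have sum_e c : \sum_y e c y = 0.
  transitivity (\sum_i \sum_j
      (fix_triples act (sc (mulK (mulK (mu j) (mu i)) c)) N (b i) (b j))%:R : 'F_2).
    rewrite /fix_triples; under [RHS]eq_bigr do under eq_bigr do rewrite natr_sum.
    rewrite /e exchange_big; under [RHS]eq_bigr do rewrite exchange_big.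
    rewrite [RHS]exchange_big; apply: eq_bigr => v Nv /=.
    under [RHS]eq_bigr do under eq_bigr do rewrite natr_sum.
    rewrite exchange_big; under [RHS]eq_bigr do rewrite exchange_big.
    rewrite [RHS]exchange_big; apply: eq_bigr => w Nw /=.
    transitivity (\sum_y \sum_i \sum_j
       (act (sc (mulK (mulK (mu j) (mu i)) c) y) (v * b i * w * b j)%g == y)%:R : 'F_2).
      apply: eq_bigr => y _; rewrite /k.
      under eq_bigr do rewrite mulr_suml.
      rewrite exchange_big; apply: eq_bigr => i _ /=.
      under eq_bigr do rewrite mulr_sumr.
      rewrite exchange_big; apply: eq_bigr => j _ /=.
      rewrite (bigD1 (sc (mu i) (act (act (sc c y) v) (b i)))) //= eqxx mul1r.
      rewrite big1 ?addr0 => [|z /negbTE zn]; last by rewrite eq_sym zn mul0r.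
      congr (nat_of_bool (_ == _))%:R.
      by rewrite !scM !actM -!sc_act.
    rewrite exchange_big; apply: eq_bigr => i _ /=.
    rewrite exchange_big; apply: eq_bigr => j _ /=.
    rewrite /fixcount -sum1_card natr_sum [RHS]big_mkcond; apply: eq_bigr => y _.
    by rewrite inE; case: ifP.
  by rewrite big1 // => i _; rewrite big1.
have eE c y : e c y = \sum_(v in N) \sum_(w in N)
   if inf (act y v) then k (act (sc c (act y v)) w) y
   else \sum_(z | ~~ inf z) k (act z w) y.
  apply: eq_bigr => v Nv; apply: eq_bigr => w Nw.
  rewrite -sc_act -(inf_sc c (act y v)).
  set a := sc c _; case: ifPn => ia.
    rewrite (bigD1 a) //= big1 ?addr0 => [|z za]; first by rewrite kE ia eqxx mul1r.
    by rewrite kE ia eq_sym (negbTE za) mul0r.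
  rewrite [RHS]big_mkcond; apply: eq_bigr => z _.
  by rewrite kE (negbTE ia); case: ifP => _; rewrite ?mul1r // mul0r.
have e_noninf y : ~~ inf y -> e l y = e oneK y.
  move=> iy; rewrite !eE; apply: eq_bigr => v Nv; apply: eq_bigr => w Nw.
  case: ifP => // iv; rewrite sc1 !kE -sc_act inf_sc iy.
  case: ifP => // iw; congr (nat_of_bool _)%:R.
  apply/eqP/eqP => Dy; by case/negP: iy; rewrite -Dy ?inf_sc.
have e_inf y : inf y -> e l y + e oneK y = 1.
  move=> iy; rewrite !eE -big_split (bigD1 1%g) //= -big_split (bigD1 1%g) //=.
  rewrite !act1 iy sc1 !kE inf_sc iy eqxx (negbTE (l_fix y iy)) add0r.
  rewrite big1 ?addr0 => [|w /andP[Nw w1]].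
    rewrite big1 ?addr0 // => v /andP[Nv v1]; rewrite -big_split big1 // => w Nw.
    case: ifPn => [iv | _]; first by case/eqP: v1; apply: inf_free iv.
    exact: F2_dbl.
  have noninf_w z : inf z -> inf (act z w) = false.
    by move=> iz; apply: contraNF w1 => /(inf_free Nw iz) ->.
  by rewrite !kE !noninf_w ?inf_sc // iy addr0.
have: \sum_y e l y + \sum_y e oneK y = 1.
  rewrite -big_split /= -[RHS](_ : #|[set y | inf y]|%:R = 1); last by rewrite F2_odd odd_inf.
  rewrite -sum1_card natr_sum [RHS]big_mkcond; apply: eq_bigr => y _.
  rewrite inE; case: ifPn => [|iy]; first exact: e_inf.
  by rewrite e_noninf // F2_dbl.
by rewrite !sum_e addr0 => /esym/eqP; rewrite oner_eq0.
Qed.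

End TwistedCounting.

(** * Two by two matrices *)

Section Matrix2.
Variable F : fieldType.
Implicit Types (A B : 'M[F]_2) (v w : 'rV[F]_2).

Lemma ord2P (P : 'I_2 -> Prop) : P 0 -> P 1 -> forall i, P i.
Proof.
by move=> P0 P1 [[|[|//]] lti]; [move: P0 | move: P1]; congr P; apply: val_inj.
Qed.

Lemma sum_ord2 (V : nmodType) (f : 'I_2 -> V) : \sum_i f i = f 0 + f 1.
Proof.
by rewrite !big_ord_recl big_ord0 addr0; congr (_ + f _); apply: val_inj.
Qed.

Lemma rv2P v w : v 0 0 = w 0 0 -> v 0 1 = w 0 1 -> v = w.
Proof. by move=> h0 h1; apply/rowP; apply: ord2P. Qed.

Lemma mx2P A B : A 0 0 = B 0 0 -> A 0 1 = B 0 1 -> A 1 0 = B 1 0 -> A 1 1 = B 1 1 -> A = B.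
Proof. by move=> *; apply/matrixP; apply: ord2P; apply: ord2P. Qed.

Lemma det2 A : \det A = A 0 0 * A 1 1 - A 0 1 * A 1 0.
Proof.
rewrite (expand_det_row _ 0) sum_ord2 /cofactor !det_mx11 !mxE /= expr0 expr1 mul1r mulN1r mulrN.
by congr (_ * A _ _ - _ * A _ _); apply: val_inj.
Qed.

Lemma mul_rv2 v A j : (v *m A) 0 j = v 0 0 * A 0 j + v 0 1 * A 1 j.
Proof. by rewrite mxE sum_ord2. Qed.

Lemma mul_mx2 A B i j : (A *m B) i j = A i 0 * B 0 j + A i 1 * B 1 j.
Proof. by rewrite mxE sum_ord2. Qed.

(** The determinant of the pair [(v, w)]; it vanishes when they are collinear. *)
Definition area v w := v 0 0 * w 0 1 - v 0 1 * w 0 0.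

Lemma area_mul v w A : area (v *m A) (w *m A) = \det A * area v w.
Proof. by rewrite /area !mul_rv2 det2; ring. Qed.

Lemma areaZr v w c : area v (c *: w) = c * area v w.
Proof. by rewrite /area !mxE; ring. Qed.

Lemma areaZl v w c : area (c *: v) w = c * area v w.
Proof. by rewrite /area !mxE; ring. Qed.

Lemma areaDr v w w' : area v (w + w') = area v w + area v w'.
Proof. by rewrite /area !mxE; ring. Qed.

Lemma areaDl v w w' : area (w + w') v = area w v + area w' v.
Proof. by rewrite /area !mxE; ring. Qed.

Lemma areaC v w : area v w = - area w v.
Proof. by rewrite /area; ring. Qed.

Lemma area_vv v : area v v = 0.
Proof. by rewrite /area; ring. Qed.

Lemma rv2_neq0 v : v != 0 -> (v 0 0 != 0) || (v 0 1 != 0).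
Proof.
apply: contraNT; rewrite negb_or !negbK => /andP[/eqP v0 /eqP v1].
by apply/eqP/rv2P; rewrite !mxE.
Qed.

Lemma area_eq0 v w : v != 0 -> area v w = 0 -> exists c, w = c *: v.
Proof.
move=> /rv2_neq0/orP[] vi /eqP; rewrite subr_eq0 => /eqP e.
  exists (w 0 0 / v 0 0); apply: rv2P; rewrite !mxE; first by field.
  by apply: (mulfI vi); rewrite e; field.
exists (w 0 1 / v 0 1); apply: rv2P; rewrite !mxE; last by field.
by apply: (mulfI vi); rewrite -e; field.
Qed.

Lemma area_expand a b v : area a b != 0 ->
  v = (area v b / area a b) *: a + (area a v / area a b) *: b.
Proof.
by move=> nz; apply: rv2P; rewrite !mxE; rewrite /area in nz *; field.
Qed.

Lemma mx2_basis_eq a b A B : area a b != 0 -> a *m A = a *m B -> b *m A = b *m B -> A = B.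
Proof.
move=> nz ea eb; apply/row_matrixP=> i; rewrite !rowE (area_expand (delta_mx 0 i) nz).
by rewrite !mulmxDl -!scalemxAl ea eb.
Qed.

Lemma sl2_basis a b a' b' : area a b != 0 -> area a' b' = area a b ->
  exists A, [/\ \det A = 1, a *m A = a' & b *m A = b'].
Proof.
move=> nz e'; set D := area a b in nz.
exists (\matrix_(i, j) (if i == 0 then (b 0 1 * a' 0 j - a 0 1 * b' 0 j) / D
                        else (a 0 0 * b' 0 j - b 0 0 * a' 0 j) / D)).
split.
- transitivity (area a' b' * area a b / (area a b * area a b)).
    by rewrite det2 !mxE /= /D; rewrite /D /area in nz *; field.
  by rewrite e' divff // mulf_neq0.
- by apply: rv2P; rewrite mul_rv2 !mxE /=; rewrite /D /area in nz *; field.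
by apply: rv2P; rewrite mul_rv2 !mxE /=; rewrite /D /area in nz *; field.
Qed.

Lemma exists_area a : a != 0 -> exists b, area a b = 1.
Proof.
case/rv2_neq0/orP => ai.
  exists (\row_j (if j == 0 then 0 else (a 0 0)^-1)); rewrite /area !mxE /=.
  by field.
exists (\row_j (if j == 0 then - (a 0 1)^-1 else 0)); rewrite /area !mxE /=.
by field.
Qed.

Lemma area_neq0 v w : area v w != 0 -> (v != 0) && (w != 0).
Proof.
move=> nz; apply/andP; split; apply: contraNneq nz => ->; rewrite /area !mxE;
by apply/eqP; ring.
Qed.

Lemma mxtrace2 A : \tr A = A 0 0 + A 1 1.
Proof. by rewrite /mxtrace sum_ord2. Qed.

Lemma cayley2 A : \det A = 1 -> A *m A = \tr A *: A - 1%:M.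
Proof.
rewrite det2 => d1; apply: mx2P; rewrite mxtrace2 mul_mx2 !mxE /= ?mulr1n ?mulr0n.
- by rewrite -d1; ring.
- by ring.
- by ring.
by rewrite -d1; ring.
Qed.

(** If both off-diagonal entries vanish, the sum of the basis vectors works unless
   the diagonal entries agree. *)
Lemma cyclic_vector A : (forall c, A <> c%:M) -> exists v, area v (v *m A) != 0.
Proof.
move=> ns; case: (eqVneq (A 0 1) 0) => A01; last first.
  by exists (delta_mx 0 0); rewrite /area !mul_rv2 !mxE /=; apply: contra A01 => /eqP <-; apply/eqP; ring.
case: (eqVneq (A 1 0) 0) => A10; last first.
  exists (delta_mx 0 1); rewrite /area !mul_rv2 !mxE /=; rewrite -oppr_eq0 in A10.
  by apply: contra A10 => /eqP <-; apply/eqP; ring.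
exists (const_mx 1); rewrite /area !mul_rv2 !mxE A01 A10.
apply/eqP=> e; apply: (ns (A 0 0)); apply: mx2P; rewrite !mxE /= ?mulr1n ?mulr0n //.
by apply/eqP; rewrite -subr_eq0; apply/eqP; rewrite -e; ring.
Qed.

(** [B] and a combination of [1] and [A] agree on a vector [v] that is not an
   eigenvector of [A], and then on [v *m A] too. *)
Lemma centralizer2 A B : (forall c, A <> c%:M) -> A *m B = B *m A ->
  exists a b, B = a%:M + b *: A.
Proof.
move=> /cyclic_vector[v nz] AB.
pose a := area (v *m B) (v *m A) / area v (v *m A).
pose b := area v (v *m B) / area v (v *m A).
have e : v *m B = v *m (a%:M + b *: A).
  rewrite {1}(area_expand (v *m B) nz) mulmxDr mul_mx_scalar -scalemxAr //.
exists a, b; apply: (mx2_basis_eq nz) => //.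
rewrite -!mulmxA AB [in LHS]mulmxA e -!mulmxA; congr (v *m _).
by rewrite mulmxDl mulmxDr mul_scalar_mx mul_mx_scalar -scalemxAl -scalemxAr.
Qed.

End Matrix2.

(** * From SL2 to PSL2 *)

Section Projection.
Variable F : finFieldType.
Implicit Types A B : 'M[F]_2.
Local Notation G := (SL2 F).
Local Notation Z := 'Z(SL2 F)%g.

Definition mx_GL A : {'GL_2[F]} := insubd (1%g : {'GL_2[F]}) A.

Lemma mx_GLK A : \det A = 1 -> GLval (mx_GL A) = A.
Proof. by move=> d1; rewrite /mx_GL insubdK // unitmxE d1 unitr1. Qed.

Lemma mx_GL_SL A : \det A = 1 -> mx_GL A \in G.
Proof. by move=> d1; rewrite inE mx_GLK // d1. Qed.

Lemma mx_GLM A B : \det A = 1 -> \det B = 1 -> mx_GL (A *m B) = (mx_GL A * mx_GL B)%g.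
Proof.
move=> dA dB; apply: val_inj; rewrite [LHS]mx_GLK ?det_mulmx ?dA ?dB ?mulr1 //.
by rewrite -[RHS]/(GLval _) GL_ME !mx_GLK.
Qed.

Definition proj_PSL A : PSL2 F := subg (G / Z)%G (coset Z (mx_GL A)).

Lemma SL_normZ A : \det A = 1 -> mx_GL A \in 'N(Z)%g.
Proof. by move/mx_GL_SL; apply: subsetP (normal_norm (center_normal _)) _. Qed.

Lemma proj_sgval A : \det A = 1 -> sgval (proj_PSL A) = coset Z (mx_GL A).
Proof. by move=> dA; rewrite subgK // mem_quotient // mx_GL_SL. Qed.

Lemma proj_PSLM A B : \det A = 1 -> \det B = 1 ->
  proj_PSL (A *m B) = (proj_PSL A * proj_PSL B)%g.
Proof.
move=> dA dB; apply: val_inj; rewrite /= !proj_sgval ?det_mulmx ?dA ?dB ?mulr1 //.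
by rewrite mx_GLM // morphM ?SL_normZ.
Qed.

Lemma proj_PSL_surj (x : PSL2 F) : exists2 A, \det A = 1 & x = proj_PSL A.
Proof.
have /morphimP[g _ Gg Dg] := subgP x.
have dg : \det (GLval g) = 1 by apply/eqP; move: Gg; rewrite inE.
exists (GLval g) => //; apply: val_inj; rewrite /= proj_sgval // Dg.
by congr (coset _ _); apply: val_inj; rewrite -[RHS]/(GLval _) mx_GLK.
Qed.

(** A central matrix commutes with the transvection [T] and its transpose. *)
Lemma center_scalar A : \det A = 1 -> (mx_GL A \in Z) = (A == 1%:M) || (A == - 1%:M).
Proof.
move=> dA; apply/idP/idP => [/centerP[_ cA] | ]; last first.
  move=> ZA; apply/centerP; split=> [|g _]; first exact: mx_GL_SL.
  apply: val_inj; rewrite -[LHS]/(GLval _) -[RHS]/(GLval _) !GL_ME -!mulmxE mx_GLK //.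
  by case/orP: ZA => /eqP->; rewrite ?mulmx1 ?mul1mx // mulmxN mulNmx mulmx1 mul1mx.
have comm B : \det B = 1 -> A *m B = B *m A.
  move=> dB; have := cA _ (mx_GL_SL dB).
  by rewrite /commute -!mx_GLM // => /(congr1 (@GLval _ _)); rewrite !mx_GLK ?det_mulmx ?dA ?dB ?mulr1.
pose T : 'M[F]_2 := \matrix_(i, j) (if (i == j) || (i == 0) then 1 else 0).
have dT : \det T = 1 by rewrite det2 !mxE /=; ring.
have dT' : \det T^T = 1 by rewrite det_tr.
have := comm _ dT; have := comm _ dT' => e1 e2.
have e (i j : 'I_2) : (A *m T) i j = (T *m A) i j by rewrite e2.
have e' (i j : 'I_2) : (A *m T^T) i j = (T^T *m A) i j by rewrite e1.
have A10 : A 1 0 = 0.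
  have := e 0 0; rewrite !mul_mx2 !mxE /= !(mulr1, mul1r, mulr0, mul0r, addr0).
  by move/eqP; rewrite -subr_eq0 opprD addNKr oppr_eq0 => /eqP.
have A01 : A 0 1 = 0.
  have := e' 0 0; rewrite !mul_mx2 !mxE /= !(mulr1, mul1r, mulr0, mul0r, addr0).
  by move/eqP; rewrite -subr_eq0 addrAC subrr add0r => /eqP.
have A11 : A 1 1 = A 0 0.
  have := e 0 1; rewrite !mul_mx2 !mxE /= !(mulr1, mul1r, mulr0, mul0r, addr0).
  by rewrite A01 addr0 add0r.
move: dA; rewrite det2 A11 A01 A10 mulr0 subr0 -expr2 => /eqP.
rewrite sqrf_eq1 => /orP[] /eqP A00; apply/orP; [left | right]; apply/eqP/mx2P;
  by rewrite !mxE /= ?A11 ?A01 ?A10 ?A00 ?mulr1n ?mulr0n ?oppr0.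
Qed.

Lemma proj_PSL_eq A B : \det A = 1 -> \det B = 1 ->
  (proj_PSL A == proj_PSL B) = (A == B) || (A == - B).
Proof.
move=> dA dB; have Bu : B \in unitmx by rewrite unitmxE dB unitr1.
have dB' : \det (invmx B) = 1 by rewrite det_inv dB invr1.
have dAB : \det (A *m invmx B) = 1 by rewrite det_mulmx dA dB' mulr1.
have eqB C : (A *m invmx B == C) = (A == C *m B).
  by apply/eqP/eqP=> [<- | ->]; rewrite ?mulmxKV ?mulmxK.
transitivity (mx_GL (A *m invmx B) \in Z); last first.
  by rewrite center_scalar // !eqB mulNmx !mul1mx.
have -> : A = A *m invmx B *m B by rewrite mulmxKV.
rewrite mulmxK // proj_PSLM // -{2}[proj_PSL B]mul1g (inj_eq (mulIg _)).
rewrite -(inj_eq val_inj) /= proj_sgval //.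
apply/eqP/idP=> [|/coset_id->//]; exact: coset_idr (SL_normZ dAB).
Qed.

Lemma proj_PSL1 : proj_PSL 1%:M = 1%g.
Proof.
have d1 : \det (1%:M : 'M[F]_2) = 1 by rewrite det1.
by apply: (mulgI (proj_PSL 1%:M)); rewrite -proj_PSLM // mulmx1 mulg1.
Qed.

Lemma proj_PSLN A : \det A = 1 -> proj_PSL (- A) = proj_PSL A.
Proof.
move=> dA; apply/eqP; rewrite proj_PSL_eq // ?eqxx ?orbT //.
by rewrite -scaleN1r detZ dA expr2 mulrNN !mulr1.
Qed.

Definition lift_PSL (x : PSL2 F) : 'M[F]_2 := s2val (cid2 (proj_PSL_surj x)).

Lemma lift_PSL_det x : \det (lift_PSL x) = 1.
Proof. by rewrite /lift_PSL; case: cid2. Qed.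

Lemma lift_PSLK x : proj_PSL (lift_PSL x) = x.
Proof. by rewrite /lift_PSL; case: cid2. Qed.

End Projection.

(** * Action of PSL2 on rays *)

Section Rays.
Variable F : finFieldType.
Variable S : {set F}.
Hypothesis S0 : 0 \notin S.
Hypothesis SN1 : -1 \in S.
Hypothesis SM : {in S &, forall a b, a * b \in S}.
Hypothesis SV : {in S, forall a, a^-1 \in S}.
Local Notation V := 'rV[F]_2.

Lemma mem_scalar1 : 1 \in S. Proof. by have := SM SN1 SN1; rewrite mulrNN mulr1. Qed.

(** For [S] the set of all nonzero scalars these are the points of the projective
   line, and for [S] the set of the two signs they are the vectors up to sign.
   As [-1] is in [S], the rays carry an action of PSL2. *)
Definition ray (v : V) : {set V} := [set c *: v | c in S].

Lemma ray_id v : v \in ray v.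
Proof. by apply/imsetP; exists 1; rewrite ?mem_scalar1 ?scale1r. Qed.

Lemma ray_eq v w : (ray v == ray w) = (w \in ray v).
Proof.
apply/eqP/idP=> [-> | /imsetP[c Sc ->]]; first exact: ray_id.
have c0 : c != 0 by apply: contraNneq S0 => <-.
apply/setP=> u; apply/imsetP/imsetP=> -[a Sa ->].
  exists (a / c); first by rewrite SM ?SV.
  by rewrite scalerA divfK.
by exists (a * c); rewrite ?SM ?scalerA.
Qed.

Definition rays : finType := {y : {set V} | [exists v, (v != 0) && (y == ray v)]}.

Fact delta0_neq0 : (delta_mx 0 0 : V) != 0.
Proof.
by apply/eqP=> /rowP/(_ 0); rewrite !mxE => /eqP; rewrite oner_eq0.
Qed.

Lemma ray_in v : v != 0 -> [exists w, (w != 0) && (ray v == ray w)].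
Proof. by move=> v0; apply/existsP; exists v; rewrite v0 eqxx. Qed.

Definition ray0 : rays := exist _ (ray (delta_mx 0 0)) (ray_in delta0_neq0).

Definition ray_of (v : V) : rays := insubd ray0 (ray v).

Lemma val_ray_of v : v != 0 -> val (ray_of v) = ray v.
Proof. by move=> v0; rewrite insubdK // -topredE /= ray_in. Qed.

Lemma ray_of_eq v w : v != 0 -> w != 0 -> reflect (exists2 c, c \in S & w = c *: v) (ray_of v == ray_of w).
Proof.
move=> v0 w0; rewrite -(inj_eq val_inj) !val_ray_of // ray_eq.
by apply: (iffP imsetP) => -[c Sc ->]; exists c.
Qed.

Lemma ray_of_surj (y : rays) : exists2 v, v != 0 & y = ray_of v.
Proof.
have /existsP[v /andP[v0 /eqP Dy]] := valP y.
by exists v => //; apply: val_inj; rewrite val_ray_of.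
Qed.

Definition ray_rep (y : rays) : V := s2val (cid2 (ray_of_surj y)).

Lemma ray_rep_neq0 y : ray_rep y != 0. Proof. by rewrite /ray_rep; case: cid2. Qed.
Lemma ray_repK y : ray_of (ray_rep y) = y. Proof. by rewrite /ray_rep; case: cid2. Qed.

Definition ray_act (y : rays) (x : PSL2 F) := ray_of (ray_rep y *m lift_PSL x).
Definition ray_scale (c : F) (y : rays) := ray_of (c *: ray_rep y).

Lemma mulmx_det1_neq0 (v : V) A : \det A = 1 -> v != 0 -> v *m A != 0.
Proof.
move=> dA; have Au : A \in unitmx by rewrite unitmxE dA unitr1.
by apply: contraNneq => vA; rewrite -(mulmxK Au v) vA mul0mx.
Qed.

Lemma ray_of_scale c v : c \in S -> v != 0 -> ray_of (c *: v) = ray_of v.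
Proof.
move=> Sc v0; have c0 : c != 0 by apply: contraNneq S0 => <-.
apply/esym/eqP/ray_of_eq => //; first by rewrite scaler_eq0 negb_or c0.
by exists c.
Qed.

Lemma ray_act_pt v A : v != 0 -> \det A = 1 -> ray_act (ray_of v) (proj_PSL A) = ray_of (v *m A).
Proof.
move=> v0 dA; rewrite /ray_act; set x := proj_PSL A.
have /eqP/(ray_of_eq v0 (ray_rep_neq0 _))[c Sc ->] := esym (ray_repK (ray_of v)).
rewrite -scalemxAl ray_of_scale ?mulmx_det1_neq0 ?lift_PSL_det //.
have := lift_PSLK x; move/eqP; rewrite proj_PSL_eq ?lift_PSL_det //.
case/orP=> /eqP-> //.
by rewrite mulmxN -scaleN1r ray_of_scale // mulmx_det1_neq0.
Qed.

Lemma ray_scale_pt c v : c != 0 -> v != 0 -> ray_scale c (ray_of v) = ray_of (c *: v).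
Proof.
move=> c0 v0; rewrite /ray_scale.
have /eqP/(ray_of_eq v0 (ray_rep_neq0 _))[d Sd ->] := esym (ray_repK (ray_of v)).
by rewrite scalerA mulrC -scalerA ray_of_scale // scaler_eq0 negb_or c0.
Qed.

Lemma ray_actM y g h : ray_act y (g * h)%g = ray_act (ray_act y g) h.
Proof.
have [v v0 ->] := ray_of_surj y; have [A dA ->] := proj_PSL_surj g.
have [B dB ->] := proj_PSL_surj h.
have dAB : \det (A *m B) = 1 by rewrite det_mulmx dA dB mulr1.
rewrite -(proj_PSLM dA dB) (ray_act_pt v0 dAB) (ray_act_pt v0 dA).
by rewrite (ray_act_pt (mulmx_det1_neq0 dA v0) dB) mulmxA.
Qed.

Lemma ray_act1 y : ray_act y 1%g = y.
Proof.
have [v v0 ->] := ray_of_surj y.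
by rewrite -proj_PSL1 ray_act_pt ?mulmx1 ?det1.
Qed.

Lemma ray_scale_act c y g : c != 0 ->
  ray_scale c (ray_act y g) = ray_act (ray_scale c y) g.
Proof.
move=> c0; have [v v0 ->] := ray_of_surj y; have [A dA ->] := proj_PSL_surj g.
have cv0 : c *: v != 0 by rewrite scaler_eq0 negb_or c0.
rewrite (ray_act_pt v0 dA) (ray_scale_pt c0 v0) (ray_act_pt cv0 dA).
by rewrite (ray_scale_pt c0 (mulmx_det1_neq0 dA v0)) scalemxAl.
Qed.

End Rays.

(** * Noncyclic abelian subgroups of PSL2 *)

Section Classification.
Variable F : finFieldType.
Implicit Types A B X : 'M[F]_2.
Local Notation proj := (@proj_PSL F).
Local Notation lift := (@lift_PSL F).
Variable N : {group PSL2 F}.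
Hypothesis abN : abelian N.

Lemma scalarN1 : (-1)%:M = - 1%:M :> 'M[F]_2.
Proof. by apply/matrixP=> i j; rewrite !mxE mulNrn. Qed.

Lemma det_linear2 (a b : F) A : \det A = 1 ->
  \det (a%:M + b *: A) = a ^+ 2 + a * b * \tr A + b ^+ 2.
Proof.
move=> dA; transitivity (a ^+ 2 + a * b * \tr A + b ^+ 2 * \det A).
  by rewrite mxtrace2 !det2 !mxE /= ?mulr1n ?mulr0n; ring.
by rewrite dA mulr1.
Qed.

Lemma anticomm_two_neq0 A B :
  A *m B = - (B *m A) -> A *m B <> B *m A -> 2%:R != 0 :> F.
Proof.
move=> anti ncomm; apply/eqP=> two0; case: ncomm; rewrite anti.
apply/matrixP=> i j; rewrite mxE; apply/eqP.
by rewrite eq_sym -addr_eq0 -mulr2n -mulr_natl two0 mul0r.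
Qed.

(** [A] is conjugate to [- A], so its trace vanishes; apply Cayley-Hamilton. *)
Lemma anticomm_sqr A B : \det A = 1 -> \det B = 1 ->
  A *m B = - (B *m A) -> A *m B <> B *m A -> A *m A = - 1%:M.
Proof.
move=> dA dB anti ncomm; have Bu : B \in unitmx by rewrite unitmxE dB unitr1.
have tA : \tr A = - \tr A.
  have DA : A = - (B *m A *m invmx B) by rewrite -mulNmx -anti mulmxK.
  by rewrite {1}DA raddfN /= mxtrace_mulC mulmxA mulVmx // mul1mx.
have /eqP : 2%:R * \tr A = 0 by rewrite mulr_natl mulr2n {1}tA addNr.
rewrite mulf_eq0 (negbTE (anticomm_two_neq0 anti ncomm)) /= => /eqP tA0.
by rewrite cayley2 // tA0 scale0r add0r.
Qed.

Lemma comm_lifts x y A B : \det A = 1 -> \det B = 1 -> x = proj A -> y = proj B ->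
  commute x y -> A *m B = B *m A \/ A *m B = - (B *m A).
Proof.
move=> dA dB -> ->; rewrite /commute -!proj_PSLM // => /eqP.
rewrite proj_PSL_eq ?det_mulmx ?dA ?dB ?mulr1 // => /orP[] /eqP; [by left | by right].
Qed.

Lemma not_scalar_neq x A : \det A = 1 -> x = proj A -> x != 1%g -> forall c, A <> c%:M.
Proof.
move=> dA -> x1 c Dc; case/negP: x1; rewrite -proj_PSL1 proj_PSL_eq ?det1 //.
have /eqP : c ^+ 2 = 1.
  by rewrite -dA Dc det2 !mxE /= ?mulr1n ?mulr0n; ring.
by rewrite sqrf_eq1 Dc => /orP[] /eqP->; rewrite ?eqxx // scalarN1 ?eqxx orbT.
Qed.

Section AnticommutingPair.
Variables A B : 'M[F]_2.
Hypotheses (dA : \det A = 1) (dB : \det B = 1).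
Hypotheses (anti : A *m B = - (B *m A)) (ncomm : A *m B <> B *m A).

Lemma quaternion_sqrs :
  [/\ A *m A = - 1%:M, B *m B = - 1%:M & (A *m B) *m (A *m B) = - 1%:M].
Proof.
have anti' : B *m A = - (A *m B) by rewrite anti opprK.
have A2 := anticomm_sqr dA dB anti ncomm.
have B2 : B *m B = - 1%:M by apply: anticomm_sqr dB dA anti' _ => /esym.
split=> //; rewrite mulmxA -[A *m B *m A]mulmxA anti' mulmxN mulmxA A2.
by rewrite !mulNmx mul1mx opprK B2.
Qed.

(** What commutes with [A] is a polynomial in [A], and a polynomial in [A] that
   commutes with [B] is a scalar. *)
Lemma quaternion_scalar X : A *m X = X *m A -> B *m X = X *m B -> exists c, X = c%:M.
Proof.
move=> AX BX.
have nA c : A <> c%:M.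
  by move=> Dc; apply: ncomm; rewrite Dc mul_scalar_mx mul_mx_scalar.
have [a [b DX]] := centralizer2 nA AX; exists a.
have [b0|b0] := eqVneq b 0; first by rewrite DX b0 scale0r addr0.
case: ncomm; move: BX; rewrite DX mulmxDl mulmxDr mul_scalar_mx mul_mx_scalar.
by move/addrI; rewrite -scalemxAl -scalemxAr => /(scalerI b0).
Qed.

(** A lift [X] of [z] commutes or anticommutes with each of [A] and [B].  According
   to the signs, one of [X], [X *m A], [X *m B] and [X *m (A *m B)] commutes with
   both, hence is a scalar. *)
Lemma quaternion_centralizer z : commute z (proj A) -> commute z (proj B) ->
  [\/ z = 1, z = proj A, z = proj B | z = proj (A *m B)]%g.
Proof.
have [X dX ->] := proj_PSL_surj z => zA zB.
have [A2 B2 AB2] := quaternion_sqrs.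
have anti' : B *m A = - (A *m B) by rewrite anti opprK.
have fin E : \det E = 1 -> E *m E = - 1%:M -> (exists c, X *m E = c%:M) -> proj X = proj E.
  move=> dE E2 [c Dc]; apply/eqP; rewrite proj_PSL_eq //.
  have DX : X = - (c *: E).
    by rewrite -mul_scalar_mx -Dc -mulmxA E2 mulmxN mulmx1 opprK.
  have /eqP : c ^+ 2 = 1.
    have : \det (X *m E) = 1 by rewrite det_mulmx dX dE mulr1.
    by rewrite Dc det2 !mxE /= ?mulr1n ?mulr0n => <-; ring.
  by rewrite sqrf_eq1 DX => /orP[] /eqP->; rewrite ?scaleN1r ?scale1r ?opprK eqxx ?orbT.
have dAB : \det (A *m B) = 1 by rewrite det_mulmx dA dB mulr1.
have [XA|XA] := comm_lifts dX dA erefl erefl zA;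
have [XB|XB] := comm_lifts dX dB erefl erefl zB.
- have [c Dc] := quaternion_scalar (esym XA) (esym XB); apply: Or41.
  apply/eqP; rewrite -proj_PSL1 proj_PSL_eq ?det1 //.
  have /eqP : c ^+ 2 = 1 by rewrite -dX Dc det2 !mxE /= ?mulr1n ?mulr0n; ring.
  by rewrite sqrf_eq1 Dc => /orP[] /eqP->; rewrite ?eqxx // scalarN1 ?eqxx orbT.
- apply: Or42; apply: fin => //; apply: quaternion_scalar.
    by rewrite mulmxA XA.
  by rewrite mulmxA -[X *m A *m B]mulmxA anti mulmxN mulmxA XB mulNmx opprK.
- apply: Or43; apply: fin => //; apply: quaternion_scalar.
    by rewrite mulmxA -[X *m B *m A]mulmxA anti' mulmxN mulmxA XA mulNmx opprK.
  by rewrite mulmxA XB.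
have AX : A *m X = - (X *m A) by rewrite XA opprK.
have BX : B *m X = - (X *m B) by rewrite XB opprK.
apply: Or44; apply: fin => //; apply: quaternion_scalar.
  rewrite !mulmxA AX -[X *m A *m B *m A]mulmxA anti' mulmxN mulmxA.
  by rewrite !mulNmx.
rewrite !mulmxA BX !mulNmx -[X *m B *m A]mulmxA anti' mulmxN mulNmx opprK.
by rewrite mulmxA.
Qed.

End AnticommutingPair.

Section CommutingLifts.
Hypothesis all_comm : {in N &, forall x y, lift x *m lift y = lift y *m lift x}.

Lemma lift_polynomial x y : x \in N -> x != 1%g -> y \in N ->
  exists a b, lift y = a%:M + b *: lift x.
Proof.
move=> Nx x1 Ny; apply: centralizer2; last exact: all_comm.
by apply: not_scalar_neq x1; rewrite ?lift_PSL_det ?lift_PSLK.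
Qed.

(** The lift of [x] has a double eigenvalue [c], equal to [1] or [-1].  The other
   lifts are polynomials in it, so they share its eigenvector, and their
   eigenvalue is also [1] or [-1] because their determinant is [1]. *)
Lemma unipotent_fixed_vector x : x \in N -> x != 1%g -> \tr (lift x) ^+ 2 = 4 ->
  exists2 v0 : 'rV[F]_2, v0 != 0 & forall y, y \in N ->
    exists A, [/\ \det A = 1, y = proj A & v0 *m A = v0].
Proof.
move=> Nx x1; set A := lift x => tA.
have dA : \det A = 1 by apply: lift_PSL_det.
have nA : forall c, A <> c%:M by apply: not_scalar_neq dA _ x1; rewrite lift_PSLK.
have [c c2 Dt] : exists2 c : F, c ^+ 2 = 1 & \tr A = c *+ 2.
  have /eqP : \tr A ^+ 2 - 2 ^+ 2 = 0 by rewrite tA; ring.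
  rewrite subr_sqr mulf_eq0 subr_eq0 addr_eq0 => /orP[] /eqP->.
    by exists 1; rewrite ?expr1n.
  by exists (-1); rewrite ?sqrrN ?expr1n // mulNrn.
have [v nz] := cyclic_vector nA.
pose v0 := v *m A - c *: v.
have v0A : v0 *m A = c *: v0.
  rewrite /v0 mulmxBl -mulmxA cayley2 // mulmxBr mulmx1 -scalemxAr -scalemxAl.
  rewrite scalerBr scalerA -expr2 c2 scale1r Dt mulr2n scalerDl.
  by rewrite addrAC addrK.
exists v0.
  apply: contraNneq nz => /eqP; rewrite subr_eq0 => /eqP->.
  by rewrite areaZr area_vv mulr0.
move=> y Ny; have [a [b Dy]] := lift_polynomial Nx x1 Ny.
have v0y : v0 *m lift y = (a + b * c) *: v0.
  by rewrite Dy mulmxDr mul_mx_scalar -scalemxAr v0A scalerA -scalerDl.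
have /eqP : (a + b * c) ^+ 2 = 1.
  rewrite -(lift_PSL_det y) Dy det_linear2 // Dt -/A.
  by rewrite -[b ^+ 2]mulr1 -c2; ring.
rewrite sqrf_eq1 => /orP[] /eqP e; rewrite e in v0y.
  by exists (lift y); rewrite lift_PSL_det lift_PSLK v0y scale1r.
exists (- lift y); rewrite proj_PSLN ?lift_PSL_det // lift_PSLK mulmxN v0y.
by rewrite scaleN1r opprK -scaleN1r detZ lift_PSL_det mulr1 sqrrN expr1n.
Qed.

(** Over an algebraic closure the lifts have a common eigenvector.  The square of
   the eigenvalue does not depend on the sign of the lift, and it embeds [N] in
   the multiplicative group of a field: an element [a%:M + b *: A] with
   eigenvalue [1] or [-1] has both its eigenvalues equal, which forces [b = 0]
   because [A] has distinct eigenvalues. *)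
Lemma semisimple_cyclic x : x \in N -> x != 1%g -> \tr (lift x) ^+ 2 <> 4 -> cyclic N.
Proof.
move=> Nx x1; set A := lift x => tA; have dA : \det A = 1 by apply: lift_PSL_det.
have [K [j _]] := countable_algebraic_closure F.
(* l is an eigenvalue of A; the other one is the trace minus l. *)
have [l Dl] : exists l : K, l ^+ 2 - j (\tr A) * l + 1 = 0.
  have [l] := @solve_monicpoly K 2 (fun i => if i == 0 then -1 else j (\tr A)) isT.
  rewrite !big_ord_recl big_ord0 /= expr0 mulr1 expr1 addr0 => Dl.
  by exists l; rewrite Dl; ring.
pose jm : 'M[F]_2 -> 'M[K]_2 := map_mx j.
have jm2 (X : 'M[F]_2) i k : jm X i k = j (X i k) by rewrite mxE.
have [v v0 vA] : exists2 v : 'rV[K]_2, v != 0 & v *m jm A = l *: v.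
  have /det0P[v v0 vA] : \det (jm A - l%:M) == 0.
    apply/eqP; rewrite det2 !mxE /= ?mulr1n ?mulr0n !subr0.
    rewrite -Dl mxtrace2 rmorphD -(rmorph1 j) -dA det2 rmorphB !rmorphM; ring.
  exists v => //; apply/eqP; rewrite -subr_eq0 -mul_mx_scalar -mulmxBr.
  exact/eqP.
have /fin_all_exists[mu Dmu] y : exists m, y \in N ->
    v *m jm (lift y) = m *: v /\
    exists a b, lift y = a%:M + b *: A /\ m = j a + j b * l.
  case: (boolP (y \in N)) => Ny; last by exists 0.
  have [a [b Dy]] := lift_polynomial Nx x1 Ny; exists (j a + j b * l) => _; split.
    rewrite Dy /jm map_mxD map_mxZ map_scalar_mx mulmxDr mul_mx_scalar.
    by rewrite -scalemxAr vA scalerA -scalerDl.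
  by exists a, b.
have muP y B : y \in N -> \det B = 1 -> y = proj B -> exists m,
    v *m jm B = m *: v /\ m ^+ 2 = mu y ^+ 2.
  move=> Ny dB Dy; have [e _] := Dmu y Ny.
  have /eqP := lift_PSLK y; rewrite [X in _ == X]Dy proj_PSL_eq ?lift_PSL_det //.
  case/orP=> /eqP DB; first by exists (mu y); rewrite -DB.
  exists (- mu y); rewrite sqrrN; split=> //.
  by rewrite -[B]opprK -DB /jm map_mxN mulmxN e scaleNr.
have vK m1 m2 : m1 *: v = m2 *: v -> m1 = m2 by apply: scale_vec_inj.
apply: (@field_mul_group_cyclic _ _ K (fun y => mu y ^+ 2)) => [y z Ny Nz|y Ny].
  have [ey _] := Dmu y Ny; have [ez _] := Dmu z Nz.
  have [||m [em <-]] := @muP (y * z)%g (lift y *m lift z) (groupM Ny Nz).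
  - by rewrite det_mulmx !lift_PSL_det mulr1.
  - by rewrite proj_PSLM ?lift_PSL_det // !lift_PSLK.
  rewrite -exprMn; congr (_ ^+ 2); apply: vK; rewrite -em /jm map_mxM mulmxA.
  by rewrite -/jm ey -scalemxAl ez scalerA mulrC.
split=> [/eqP | ->]; last first.
  have [||m [em <-]] := @muP 1%g 1%:M (group1 N); rewrite ?det1 ?proj_PSL1 //.
  rewrite (_ : m = 1) ?expr1n //; apply: vK.
  by rewrite -em /jm map_mx1 mulmx1 scale1r.
have [_ [a [b [Dy ->]]]] := Dmu y Ny.
rewrite sqrf_eq1 => De.
have {De} [e e2 De] : exists2 e : F, e ^+ 2 = 1 & j a + j b * l = j e.
  case/orP: De => /eqP->; first by exists 1; rewrite ?rmorph1 ?expr1n.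
  by exists (-1); rewrite ?rmorphN1 ?sqrrN ?expr1n.
have dy : (j a + j b * l) * (j a + j b * (j (\tr A) - l)) = 1.
  have : j (\det (lift y)) = 1 by rewrite lift_PSL_det rmorph1.
  rewrite Dy det_linear2 //; move: (\tr A) Dl => t Dl <-; rewrite !rmorphD !rmorphM.
  apply/eqP; rewrite -subr_eq0 -[X in _ == X](mulr0 (- (j b * j b))) -Dl.
  by apply/eqP; ring.
have b0 : b = 0.
  apply/eqP; apply: contraT => b0; case: tA.
  have jb0 : j b != 0 by rewrite fmorph_eq0.
  have Dl' : j a + j b * (j (\tr A) - l) = j e.
    have je2 : j e * j e = 1 by rewrite -rmorphM -expr2 e2 rmorph1.
    by rewrite -[LHS]mul1r -je2 -mulrA -{2}De dy mulr1.
  have : j b * l = j b * (j (\tr A) - l).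
    by apply: (addrI (j a)); rewrite De Dl'.
  move/(mulfI jb0) => ll.
  have Dt : j (\tr A) = l *+ 2 by rewrite mulr2n {1}ll subrK.
  apply: (fmorph_inj j); rewrite rmorphXn rmorph_nat Dt.
  have l2 : l ^+ 2 = 1.
    apply/eqP; rewrite -subr_eq0; apply/eqP.
    transitivity (- (l ^+ 2 - j (\tr A) * l + 1)); last by rewrite Dl oppr0.
    by rewrite Dt; ring.
  by rewrite -[l *+ 2]mulr_natr exprMn l2 mul1r -natrX.
have ea : a = e by apply: (fmorph_inj j); rewrite -De b0 rmorph0 mul0r addr0.
rewrite -(lift_PSLK y) Dy b0 scale0r addr0 ea; apply/eqP.
move/eqP: e2; rewrite sqrf_eq1 => /orP[] /eqP->; first by rewrite proj_PSL1.
by rewrite scalarN1 proj_PSLN ?det1 // proj_PSL1.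
Qed.

End CommutingLifts.

(** Lifts of commuting elements commute up to sign.  If all lifts commute, the
   discriminant of one of them separates the case of a fixed vector from the
   cyclic case. *)
Lemma abelian_PSL2_cases : ~~ cyclic N ->
  (exists2 v0 : 'rV[F]_2, v0 != 0 & forall y, y \in N ->
    exists A, [/\ \det A = 1, y = proj A & v0 *m A = v0]) \/
  (exists A B, [/\ \det A = 1 /\ \det B = 1, A *m B = - (B *m A),
     A *m B <> B *m A, proj A \in N & proj B \in N]).
Proof.
move=> ncyc.
case: (boolP [forall x in N, forall y in N, lift x *m lift y == lift y *m lift x]).
  move/forall_inP=> all_comm; left.
  have cN : {in N &, forall x y, lift x *m lift y = lift y *m lift x}.
    by move=> x y Nx Ny; apply/eqP; have /forall_inP := all_comm x Nx; apply.
  have /trivgPn[x Nx x1] : N :!=: 1%g by apply: contraNneq ncyc => ->; apply: cyclic1.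
  have [tx|/eqP tx] := eqVneq (\tr (lift x) ^+ 2) 4.
    exact: unipotent_fixed_vector cN x Nx x1 tx.
  by rewrite (semisimple_cyclic cN Nx x1 tx) in ncyc.
rewrite negb_forall => /existsP[x]; rewrite negb_imply => /andP[Nx].
rewrite negb_forall => /existsP[y]; rewrite negb_imply => /andP[Ny nxy].
right; exists (lift x), (lift y); rewrite !lift_PSL_det !lift_PSLK; split=> //; last exact/eqP.
have [/eqP|//] := comm_lifts (lift_PSL_det x) (lift_PSL_det y)
  (esym (lift_PSLK x)) (esym (lift_PSLK y)) (centsP abN x Nx y Ny).
by rewrite (negbTE nxy).
Qed.

End Classification.

Lemma prime_dvdn_fix_triples (gT : finGroupType) (N : {group gT}) p
    (Y : finType) (act : Y -> gT -> Y) (lam : Y -> Y) s t :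
    fix_triples_divisible N -> prime p -> (p %| #|N|)%N ->
    (forall y g h, act y (g * h)%g = act (act y g) h) ->
    (forall y, act y 1%g = y) ->
    (forall y g, lam (act y g) = act (lam y) g) ->
  (p %| fix_triples act lam N s t)%N.
Proof.
move=> good p_pr pN actM act1 lam_act.
have := dvdn_trans pN (good Y act lam actM act1 lam_act s t).
by rewrite -mulnn Euclid_dvdM // orbb.
Qed.

(** * Subgroups fixing a vector up to sign *)

Section UnipotentCase.
Variable F : finFieldType.
Implicit Types A B X : 'M[F]_2.
Local Notation proj := (@proj_PSL F).
Variable N : {group PSL2 F}.
Hypothesis good : fix_triples_divisible N.

(** The powers of a transvection, which show that it has the characteristic as
   its order. *)
Lemma transvection_expg (a b : 'rV[F]_2) A c k :
    \det A = 1 -> a *m A = a -> b *m A = b + c *: a ->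
  exists B, [/\ \det B = 1, proj B = (proj A ^+ k)%g, a *m B = a
              & b *m B = b + (c *+ k) *: a].
Proof.
move=> dA aA bA; elim: k => [|k [B [dB pB aB bB]]].
  exists 1%:M; rewrite det1 proj_PSL1 expg0 !mulmx1 mulr0n scale0r addr0.
  by [].
exists (B *m A); rewrite det_mulmx dB dA mulr1 proj_PSLM // pB expgSr !mulmxA aB.
split=> //; rewrite bB mulmxDl bA -scalemxAl aA mulrS scalerDl.
by rewrite addrA.
Qed.

Definition units : {set F} := [set c | c != 0].

Lemma units0 : 0 \notin units. Proof. by rewrite inE eqxx. Qed.
Lemma unitsN1 : -1 \in units. Proof. by rewrite inE oppr_eq0 oner_eq0. Qed.
Lemma unitsM : {in units &, forall a b, a * b \in units}.
Proof. by move=> a b; rewrite !inE => ha hb; rewrite mulf_neq0. Qed.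
Lemma unitsV : {in units, forall a, a^-1 \in units}.
Proof. by move=> a; rewrite !inE invr_eq0. Qed.

Local Notation line := (ray_of units).
Local Notation line_act := (@ray_act F units).
Local Notation lineP := (ray_of_eq units0 unitsN1 unitsM unitsV).
Local Notation line_act_pt := (ray_act_pt units0 unitsN1 unitsM unitsV).
Local Notation line_actM := (ray_actM units0 unitsN1 unitsM unitsV).
Local Notation line_act1 := (ray_act1 units0 unitsN1 unitsM unitsV).

Lemma line_eq v w : v != 0 -> w != 0 -> (line v == line w) = (area v w == 0).
Proof.
move=> v0 w0; apply/lineP/eqP=> // [[c _ ->]|/(area_eq0 v0)[c Dw]].
  by rewrite areaZr area_vv mulr0.
exists c => //; rewrite inE; apply: contraNneq w0 => c0.
by rewrite Dw c0 scale0r.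
Qed.

(** The projective line, with [U] the stabilizer of [v0] up to sign, satisfies the
   hypotheses of [unipotent_fix_triples]; [w] exchanges the lines of [v0] and
   [v1]. *)
Lemma unipotent_case p (v0 : 'rV[F]_2) :
    p \in [pchar F] -> v0 != 0 -> N :!=: 1%g ->
    (forall y, y \in N -> exists A, [/\ \det A = 1, y = proj A & v0 *m A = v0]) ->
  False.
Proof.
move=> pcharF v0nz ntN fixN; have p_pr := pcharf_prime pcharF.
have [v1 a01] := exists_area v0nz.
have nz01 : area v0 v1 != 0 by rewrite a01 oner_eq0.
have /andP[_ v1nz] := area_neq0 nz01.
pose U : {set PSL2 F} := [set x | `[< exists A, [/\ \det A = 1, x = proj A & v0 *m A = v0] >]].
have UP x : reflect (exists A, [/\ \det A = 1, x = proj A & v0 *m A = v0]) (x \in U).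
  by rewrite inE; apply: asboolP.
have gU : group_set U.
  apply/group_setP; split=> [|x y /UP[A [dA -> vA]] /UP[B [dB -> vB]]]; apply/UP.
    by exists 1%:M; rewrite det1 proj_PSL1 mulmx1.
  by exists (A *m B); rewrite det_mulmx dA dB mulr1 proj_PSLM // mulmxA vA vB.
pose UG := Group gU.
have sNU : N \subset UG by apply/subsetP=> x /fixN hx; apply/UP.
have pN : (p %| #|N|)%N.
  have [x Nx x1] := trivgPn _ ntN.
  have [A [dA Dx vA]] := fixN x Nx.
  have [c Dc] : exists c, v1 *m A = v1 + c *: v0.
    exists (area (v1 *m A) v1); rewrite {1}(area_expand (v1 *m A) nz01) a01 !divr1 addrC.
    by rewrite -{1}vA area_mul dA a01 mul1r scale1r.
  have [B [dB pB vB1 vB2]] := transvection_expg p dA vA Dc.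
  have xp1 : (x ^+ p = 1)%g.
    rewrite Dx -pB -proj_PSL1; congr (proj _).
    apply: (mx2_basis_eq nz01); rewrite mulmx1 // vB2.
    by rewrite -mulr_natr (pcharf0 pcharF) mulr0 scale0r addr0.
  have : (#[x]%g %| p)%N by rewrite order_dvdn xp1.
  have [_ prp] := elimT primeP p_pr.
  move/prp; rewrite /= order_eq1 (negbTE x1) /= => /eqP <-.
  exact: order_dvdG.
have a10 : area v1 (- v0) = area v0 v1.
  by rewrite areaC -scaleN1r areaZl mulN1r opprK.
have [w [dw vw _]] := sl2_basis nz01 a10.
have [|||s [t]] := @unipotent_fix_triples _ N _ line_act line_actM line_act1 UG (line v0) (proj w) p p_pr pN sNU.
- move=> u /UP[A [dA -> vA]]; by rewrite line_act_pt // vA.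
- move=> y y' /=; have [v vnz ->] := ray_of_surj y; have [v' v'nz ->] := ray_of_surj y'.
  rewrite ![line _ == line v0]eq_sym !line_eq // => a0v a0v'.
  (* The element of U taking the line of v to that of v' maps v to the
     multiple of v' that has the same area with v0. *)
  pose c := area v0 v / area v0 v'.
  have cnz : c != 0 by rewrite mulf_neq0 // invr_eq0.
  have acv' : area v0 (c *: v') = area v0 v by rewrite areaZr divfK.
  have [A [dA vA v'A]] := sl2_basis a0v acv'.
  exists (proj A); first by apply/UP; exists A.
  move=> u' /UP[B [dB -> vB]]; apply/eqP/eqP => [/eqP | ->].
    rewrite line_act_pt // => /lineP; case=> //; first exact: mulmx_det1_neq0.
    move=> d; rewrite inE => dnz Dv'; congr (proj _); apply: (mx2_basis_eq a0v).
      by rewrite vB vA.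
    have avB : area v0 (v *m B) = area v0 v by rewrite -{1}vB area_mul dB mul1r.
    rewrite v'A Dv' scalerA /c Dv' areaZr avB.
    have -> : area v0 v / (d * area v0 v) * d = 1 by field; rewrite a0v dnz.
    by rewrite scale1r.
  by rewrite line_act_pt // v'A (ray_of_scale units0 unitsN1 unitsM unitsV) // inE.
- by rewrite line_act_pt // vw eq_sym line_eq.
by case/negP; apply: prime_dvdn_fix_triples pN line_actM line_act1 _.
Qed.

End UnipotentCase.

(** * Klein four subgroups *)

Section KleinCases.
Variable F : finFieldType.
Local Notation proj := (@proj_PSL F).
Variable N : {group PSL2 F}.
Hypothesis good : fix_triples_divisible N.
Hypothesis abN : abelian N.
Variables A B : 'M[F]_2.
Hypotheses (dA : \det A = 1) (dB : \det B = 1).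
Hypotheses (anti : A *m B = - (B *m A)) (ncomm : A *m B <> B *m A).
Hypotheses (NA : proj A \in N) (NB : proj B \in N).

Local Notation line := (ray_of (units F)).
Local Notation line_act := (@ray_act F (units F)).
Local Notation line_act_pt := (ray_act_pt (units0 F) (unitsN1 F) (@unitsM F) (@unitsV F)).
Local Notation line_actM := (ray_actM (units0 F) (unitsN1 F) (@unitsM F) (@unitsV F)).
Local Notation line_act1 := (ray_act1 (units0 F) (unitsN1 F) (@unitsM F) (@unitsV F)).

Lemma klein_detAB : \det (A *m B) = 1. Proof. by rewrite det_mulmx dA dB mulr1. Qed.

Lemma klein_antiBA : B *m A = - (A *m B). Proof. by rewrite anti opprK. Qed.

Lemma klein_sqrA : A *m A = - 1%:M.
Proof. by case: (quaternion_sqrs dA dB anti ncomm). Qed.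

Lemma klein_sqrB : B *m B = - 1%:M.
Proof. by case: (quaternion_sqrs dA dB anti ncomm). Qed.

Lemma klein_sqrAB : (A *m B) *m (A *m B) = - 1%:M.
Proof. by case: (quaternion_sqrs dA dB anti ncomm). Qed.

Lemma two_neq0 : 2%:R != 0 :> F.
Proof. exact: anticomm_two_neq0 anti ncomm. Qed.

Lemma klein_elements x : x \in N -> [\/ x = 1, x = proj A, x = proj B | x = proj (A *m B)]%g.
Proof.
by move=> Nx; apply: quaternion_centralizer => //; apply: (centsP abN).
Qed.

Lemma sqrN1_neq1 X : \det X = 1 -> X *m X = - 1%:M -> proj X != 1%g.
Proof.
move=> dX X2; rewrite -proj_PSL1 proj_PSL_eq ?det1 //; apply/negP => DX.
have : X *m X = 1%:M.
  by case/orP: DX => /eqP->; rewrite ?mulmx1 // mulmxN mulNmx mulmx1 opprK.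
rewrite X2 => /matrixP/(_ 0 0); rewrite !mxE /= => /eqP.
by rewrite eq_sym -addr_eq0 -mulr2n (negbTE two_neq0).
Qed.

Lemma klein_lift x X : x \in N -> x != 1%g -> \det X = 1 -> x = proj X -> X *m X = - 1%:M.
Proof.
move=> Nx x1 dX Dx.
have eqX E : \det E = 1 -> E *m E = - 1%:M -> x = proj E -> X *m X = - 1%:M.
  move=> dE E2; rewrite Dx => /eqP; rewrite proj_PSL_eq // => /orP[] /eqP-> //.
  by rewrite mulmxN mulNmx opprK.
case: (klein_elements Nx) => [x1'|||]; first by rewrite x1' eqxx in x1.
- by apply: eqX klein_sqrA.
- by apply: eqX klein_sqrB.
by apply: eqX klein_sqrAB; apply: klein_detAB.
Qed.

Lemma klein_sqr : {in N, forall x, x * x = 1}%g.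
Proof.
move=> x Nx; have [->|x1] := eqVneq x 1%g; first by rewrite mulg1.
have [X dX Dx] := proj_PSL_surj x.
rewrite Dx -proj_PSLM // (klein_lift Nx x1 dX Dx) proj_PSLN ?det1 //.
exact: proj_PSL1.
Qed.

Lemma klein_even : (2 %| #|N|)%N.
Proof.
have A1 := sqrN1_neq1 dA klein_sqrA.
have : (#[proj A]%g %| 2)%N by rewrite order_dvdn expgS expg1 klein_sqr.
have [_ pr2] := elimT primeP (isT : prime 2).
move/pr2; rewrite /= order_eq1 (negbTE A1) /= => /eqP ordA.
by have := order_dvdG NA; rewrite ordA.
Qed.

Section SplitInvolutions.
Variable i : F.
Hypothesis i2 : i * i = -1.

Lemma i_neq0 : i != 0.
Proof.
by apply/eqP=> i0; move/eqP: i2; rewrite i0 mul0r eq_sym oppr_eq0 oner_eq0.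
Qed.

Lemma i_neqN : i != - i.
Proof.
rewrite -addr_eq0 -mulr2n -mulr_natl mulf_neq0 ?i_neq0 //; exact: two_neq0.
Qed.

(** [B] exchanges the two eigenlines of [A], since it anticommutes with [A]. *)
Lemma klein_eigenbasis : exists v0 w0 : 'rV[F]_2,
  [/\ area v0 w0 != 0, v0 *m A = i *: v0, w0 *m A = - i *: w0,
      v0 *m B = w0 & w0 *m B = - v0].
Proof.
have nA : forall c, A <> c%:M.
  by move=> c Dc; apply: ncomm; rewrite Dc mul_scalar_mx mul_mx_scalar.
have [v nz] := cyclic_vector nA.
pose v0 := v *m A + i *: v.
have v0A : v0 *m A = i *: v0.
  rewrite /v0 mulmxDl -mulmxA klein_sqrA mulmxN mulmx1 -scalemxAl scalerDr scalerA i2.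
  by rewrite scaleN1r addrC.
have v0nz : v0 != 0.
  apply: contraNneq nz => /eqP; rewrite addr_eq0 => /eqP->.
  by rewrite -scaleNr areaZr area_vv mulr0.
have w0A : v0 *m B *m A = - i *: (v0 *m B).
  by rewrite -mulmxA klein_antiBA mulmxN mulmxA v0A -scalemxAl scaleNr.
exists v0, (v0 *m B); split=> //; last by rewrite -mulmxA klein_sqrB mulmxN mulmx1.
apply: contraNneq i_neqN => /(area_eq0 v0nz)[c Dw]; move: w0A.
have w0nz : v0 *m B != 0 by apply: mulmx_det1_neq0.
rewrite {1}Dw -scalemxAl v0A scalerA mulrC -scalerA -Dw => /eqP.
by rewrite -subr_eq0 -scalerBl scaler_eq0 (negbTE w0nz) orbF subr_eq0.
Qed.

(** When [-1] is a square, any two distinct points of the projective line are the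
   fixed points of an involution. *)
Lemma involution_through (v1 v2 : 'rV[F]_2) : area v1 v2 != 0 ->
  exists X, [/\ \det X = 1, X *m X = - 1%:M, v1 *m X = i *: v1 & v2 *m X = - i *: v2].
Proof.
move=> nz; have e : area (i *: v1) (- i *: v2) = area v1 v2.
  by rewrite areaZr areaZl mulrA mulNr i2 opprK mul1r.
have [X [dX v1X v2X]] := sl2_basis nz e; exists X; split=> //.
apply: (mx2_basis_eq nz); rewrite mulmxA mulmxN mulmx1.
  by rewrite v1X -scalemxAl v1X scalerA i2 scaleN1r.
by rewrite v2X -scalemxAl v2X scalerA mulrNN i2 scaleN1r.
Qed.

(** Let [r] be the involution whose fixed points are the line of [v0], which [A]
   fixes, and a line fixed by no nontrivial element of [N].  Such a line is
   spanned by [v0 + z *: w0] when [z], [1 - z * z] and [z * z + 1] are nonzero, and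
   [q > 5] leaves room for such a [z]. *)
Lemma split_klein_case : (5 < #|F|)%N -> False.
Proof.
move=> F_gt5; have [v0 [w0 [nz vA wA vB wB]]] := klein_eigenbasis.
have /andP[v0nz w0nz] := area_neq0 nz.
have [z z_nroot] : exists z : F, ~~ root ('X^5 - 'X) z.
  apply/existsP; apply: contraLR F_gt5 => /existsPn allroot.
  rewrite -leqNgt cardE -ltnS.
  have szp : size ('X^5 - 'X : {poly F}) = 6.
    by rewrite size_polyDl ?size_polyXn // size_polyN size_polyX.
  suff : (size (enum F) < size ('X^5 - 'X : {poly F})%R)%N by rewrite szp.
  apply: max_poly_roots; rewrite ?enum_uniq //.
    by rewrite -size_poly_eq0 szp.
  by apply/allP=> z _; have := allroot z; rewrite negbK.
have z_eq : z ^+ 5 - z = z * (1 - z * z) * (z * z + 1) * (-1) by ring.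
rewrite /root !hornerE z_eq !mulf_eq0 !negb_or oppr_eq0 oner_eq0 andbT -!andbA in z_nroot.
case/and3P: z_nroot => z0 z2n1 z21.
pose v1 := v0 + z *: w0.
have nz01 : area v0 v1 != 0.
  by rewrite /v1 /area !mxE (_ : _ - _ = z * area v0 w0) ?mulf_neq0 // /area; ring.
have /andP[_ v1nz] := area_neq0 nz01.
have v1A : area v1 (v1 *m A) != 0.
  rewrite /v1 mulmxDl vA -scalemxAl wA.
  rewrite (_ : area _ _ = - (i * z * 2%:R) * area v0 w0).
    by rewrite !mulf_neq0 // oppr_eq0 !mulf_neq0 // ?i_neq0 //; exact: two_neq0.
  by rewrite /area !mxE; ring.
have v1B : area v1 (v1 *m B) != 0.
  rewrite /v1 mulmxDl vB -scalemxAl wB.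
  rewrite (_ : area _ _ = (z * z + 1) * area v0 w0); first by rewrite mulf_neq0.
  by rewrite /area !mxE; ring.
have v1AB : area v1 (v1 *m (A *m B)) != 0.
  rewrite mulmxA /v1 mulmxDl vA -scalemxAl wA mulmxDl -!scalemxAl vB wB.
  rewrite (_ : area _ _ = i * (1 - z * z) * area v0 w0).
    by rewrite !mulf_neq0 // i_neq0.
  by rewrite /area !mxE; ring.
have [X [dX X2 v0X v1X]] := involution_through nz01.
have r2 : (proj X * proj X = 1)%g.
  by rewrite -proj_PSLM // X2 proj_PSLN ?det1 // proj_PSL1.
have := prime_dvdn_fix_triples (lam := id) (proj X) (proj X) good (isT : prime 2) klein_even line_actM line_act1 (fun _ _ => erefl).
rewrite dvdn2 (odd_fix_triples_invol line_actM line_act1 klein_sqr r2).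
set S := [set y | _]; suff -> : S = [set line v1] by rewrite cards1.
apply/setP=> y; rewrite !inE; apply/andP/eqP => [[/eqP fy /forall_inP regy] | ->].
  have [v vnz Dy] := ray_of_surj y; rewrite Dy in fy regy *.
  move/eqP: fy; rewrite line_act_pt // line_eq ?mulmx_det1_neq0 //.
  have [a [b Dv]] : exists a b, v = a *: v0 + b *: v1.
    by do 2!eexists; apply: (area_expand v nz01).
  rewrite Dv mulmxDl -!scalemxAl v0X v1X.
  rewrite (_ : area _ _ = (a * b * i * 2%:R) * area v0 v1); last first.
    by rewrite /area !mxE; ring.
  rewrite !mulf_eq0 (negbTE nz01) (negbTE two_neq0) (negbTE i_neq0) !orbF.
  case/orP=> /eqP ab0.
    rewrite -Dv; apply/eqP; rewrite line_eq // Dv ab0 scale0r add0r areaZl area_vv mulr0.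
    by [].
  have : proj A == 1%g.
    apply: implyP (regy _ NA) _; rewrite line_act_pt // line_eq ?mulmx_det1_neq0 //.
    by rewrite Dv ab0 scale0r addr0 -scalemxAl vA !areaZl !areaZr area_vv !mulr0.
  by rewrite (negbTE (sqrN1_neq1 dA klein_sqrA)).
split.
  rewrite line_act_pt // v1X.
  by rewrite (ray_of_scale (units0 F) (unitsN1 F) (@unitsM F) (@unitsV F)) // inE oppr_eq0 i_neq0.
apply/forall_inP=> x Nx; apply/implyP.
have moved E : \det E = 1 -> area v1 (v1 *m E) != 0 -> line_act (line v1) (proj E) != line v1.
  by move=> dE v1E; rewrite (line_act_pt v1nz dE) eq_sym (line_eq v1nz (mulmx_det1_neq0 dE v1nz)).
case: (klein_elements Nx) => -> //.
- by rewrite (negbTE (moved _ dA v1A)).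
- by rewrite (negbTE (moved _ dB v1B)).
by rewrite (negbTE (moved _ klein_detAB v1AB)).
Qed.

Definition half_turn (x : PSL2 F) := exists X, [/\ \det X = 1, X *m X = - 1%:M & x = proj X].

Lemma half_turn_sqr x : half_turn x -> (x * x = 1)%g.
Proof.
by case=> X [dX X2 ->]; rewrite -proj_PSLM // X2 proj_PSLN ?det1 // proj_PSL1.
Qed.

(** Let [X] be a lift of [x].  A lift of [y] either anticommutes with [X], and then
   [y] is a half turn, or it is [a + b X] with [a ^+ 2 + b ^+ 2 = 1].  In the field
   with five elements the nonzero squares are [1] and [-1], and no two of them
   add up to [1].  So [a] or [b] vanishes; in the first case [y = x], and in the
   second [y = 1]. *)
Lemma half_turn_commute x y : #|F| = 5%N ->
  half_turn x -> commute x y -> y != 1%g -> half_turn y.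
Proof.
move=> F5 [X [dX X2 Dx]] xy y1; have [Y dY Dy] := proj_PSL_surj y.
exists Y; split=> //.
have nX : forall c, X <> c%:M.
  by apply: (not_scalar_neq dX Dx); rewrite Dx sqrN1_neq1.
have [XY|/eqP nXY] := eqVneq (X *m Y) (Y *m X); last first.
  have [//|XY] := comm_lifts dX dY Dx Dy xy.
  by apply: (anticomm_sqr dY dX); [rewrite XY opprK | move/esym].
have [a [b DY]] := centralizer2 nX XY.
have tX : \tr X = 0.
  have := cayley2 dX; rewrite X2 => /eqP.
  rewrite eq_sym subr_eq addNr scaler_eq0 => /orP[/eqP // | /eqP X0].
  by case: (nX 0); rewrite X0 raddf0.
have ab : a ^+ 2 + b ^+ 2 = 1.
  by rewrite -dY DY det_linear2 // tX mulr0 addr0.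
have fermat (c : F) : c != 0 -> c ^+ 2 = 1 \/ c ^+ 2 = -1.
  move=> c0; have : (c ^+ 2) ^+ 2 == 1.
    rewrite -exprM -(inj_eq (mulfI c0)) -exprS mulr1.
    by have := expf_card c; rewrite F5 => ->.
  by rewrite sqrf_eq1 => /orP[] /eqP; [left | right].
have char5 : 5 \in [pchar F] by apply: (@card_finPcharP F 5 1).
have [a0|a0] := eqVneq a 0.
  have b2 : b ^+ 2 = 1 by rewrite -ab a0 expr0n add0r.
  rewrite DY a0 raddf0 add0r -scalemxAl -scalemxAr scalerA X2 -expr2 b2.
  by rewrite scale1r.
have [b0|b0] := eqVneq b 0.
  case/negP: y1; rewrite Dy -proj_PSL1 proj_PSL_eq ?det1 // DY b0 scale0r addr0.
  move: ab; rewrite b0 expr0n addr0 => /eqP; rewrite sqrf_eq1.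
  by case/orP=> /eqP->; rewrite ?eqxx // scalarN1 eqxx orbT.
have five : 5%:R = 0 :> F by apply: pcharf0.
(* The sums of two nonzero squares are 2, 0, 0 and -2, none of which is 1 in
   characteristic 5. *)
have absurd : 1 = 0 :> F.
  case: (fermat a a0) => a2; case: (fermat b b0) => b2; rewrite a2 b2 in ab.
  - by apply: (addrI 1); rewrite ab addr0.
  - by rewrite -ab subrr.
  - by rewrite -ab addNr.
  have : 3%:R = 1 - (-1 + -1) :> F by ring.
  rewrite ab subrr.
  move=> three; have : 5%:R - 3%:R * 2%:R = -1 :> F by ring.
  by rewrite five three mul0r subr0 => /eqP; rewrite eq_sym oppr_eq0 => /eqP.
by move/eqP: absurd; rewrite oner_eq0.
Qed.

(** In PSL2(5) the centralizer of an involution is abelian, and each of its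
   nontrivial elements is an involution.  Let [r] be an involution outside [N]
   and [y] a nontrivial element commuting with [r].  If a nontrivial [v] in [N]
   commuted with [y], then [r] would commute with [v], hence with [N], and would
   belong to [N].  So the points counted by [odd_fix_triples_invol] are all the
   nontrivial elements of the centralizer of [r]. *)
Lemma klein_F5_case : #|F| = 5%N -> False.
Proof.
move=> F5; have [v0 [w0 [nz vA wA vB wB]]] := klein_eigenbasis.
have /andP[v0nz w0nz] := area_neq0 nz.
(* The fixed lines of this X are spanned by v0, which A fixes but B and A *m
   B move, and by v0 + w0, which A moves. *)
have nz01 : area v0 (v0 + w0) != 0.
  by rewrite (_ : area _ _ = area v0 w0) // /area !mxE; ring.
have [X [dX X2 v0X v1X]] := involution_through nz01.
pose r := proj X; have htr : half_turn r by exists X.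
have r2 := half_turn_sqr htr.
have fixed_line v E : r = proj E -> \det E = 1 -> area v (v *m X) = 0 -> area v (v *m E) = 0.
  move=> rE dE vX; move/eqP: rE; rewrite proj_PSL_eq // => /orP[] /eqP DX.
    by rewrite -DX.
  by apply/eqP; rewrite -oppr_eq0 -mulN1r -areaZr scaleN1r -mulmxN -DX vX.
have rN : r \notin N.
  apply/negP=> /klein_elements[r1|rA|rB|rAB].
  - by case/negP: (sqrN1_neq1 dX X2); apply/eqP.
  - have := fixed_line (v0 + w0) A rA dA; rewrite v1X areaZr area_vv mulr0 => /(_ erefl).
    rewrite mulmxDl vA wA => /eqP.
    rewrite (_ : area _ _ = - (i * 2%:R) * area v0 w0); last by rewrite /area !mxE; ring.
    by rewrite mulf_eq0 (negbTE nz) orbF oppr_eq0 mulf_eq0 (negbTE i_neq0) (negbTE two_neq0).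
  - have := fixed_line v0 B rB dB; rewrite v0X areaZr area_vv mulr0 vB => /(_ erefl) /eqP.
    by rewrite (negbTE nz).
  have := fixed_line v0 _ rAB klein_detAB; rewrite v0X areaZr area_vv mulr0 => /(_ erefl).
  rewrite mulmxA vA -scalemxAl vB areaZr => /eqP.
  by rewrite mulf_eq0 (negbTE nz) (negbTE i_neq0).
have cr_abelian a b c : half_turn a -> commute a b -> commute a c -> commute b c.
  move=> hta ab ac.
  have sq d : commute a d -> (d * d = 1)%g.
    move=> ad; have [->|d1] := eqVneq d 1%g; first by rewrite mulg1.
    by apply/half_turn_sqr/(half_turn_commute F5 hta ad d1).
  have inv d : commute a d -> (d^-1 = d)%g.
    by move/sq => dd; apply: (mulgI d); rewrite mulgV dd.
  by rewrite /commute -(inv _ (commuteM ab ac)) invMg !inv.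
have conjM (y g h : PSL2 F) : (y ^ (g * h) = (y ^ g) ^ h)%g by rewrite conjgM.
have conj1 (y : PSL2 F) : (y ^ 1 = y)%g by rewrite conjg1.
have := prime_dvdn_fix_triples (lam := id) r r good (isT : prime 2) klein_even conjM conj1 (fun _ _ => erefl).
rewrite dvdn2 (odd_fix_triples_invol conjM conj1 klein_sqr r2).
have r1 : r != 1%g by apply: sqrN1_neq1.
set S := [set y | _]; suff -> : S = ('C[r] :\ 1)%g.
  have : ~~ odd #|'C[r]%g|.
    rewrite -dvdn2; have : (#[r]%g %| 2)%N by rewrite order_dvdn expgS expg1 r2.
    have [_ pr2] := elimT primeP (isT : prime 2).
    move/pr2; rewrite /= order_eq1 (negbTE r1) /= => /eqP ordr.
    have Cr : r \in 'C[r]%G by apply/cent1P.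
    by have := order_dvdG Cr; rewrite ordr.
  by rewrite (cardsD1 1%g) group1 /= negbK => ->.
apply/setP=> y; rewrite in_setD1 in_set; apply/andP/andP => [[/eqP yr /forall_inP regy] | [y1 /cent1P yr]].
  split; last by apply/cent1P/commgP/conjg_fixP.
  apply: contraNneq (sqrN1_neq1 dA klein_sqrA) => y1.
  by apply: implyP (regy _ NA) _; rewrite y1 conj1g.
have ry : commute r y by apply: commute_sym.
have hty := half_turn_commute F5 htr ry y1.
split; first by apply/eqP/conjg_fixP/commgP/commute_sym.
apply/forall_inP=> v Nv; apply/implyP => /eqP/conjg_fixP/commgP yv.
apply: contraNT rN => v1.
have htv := half_turn_commute F5 hty yv v1.
have rv : commute v r.
  by apply: cr_abelian hty _ _ => //; apply: commute_sym.
have cN x : x \in N -> commute r x.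
  move=> Nx; apply: cr_abelian htv _ _ => //.
  exact: (centsP abN).
have [|||||] := @quaternion_centralizer F A B dA dB anti ncomm r; rewrite -/r.
- exact: cN.
- exact: cN.
- by move=> ->; apply: group1.
- by move=> ->.
- by move=> ->.
by move=> ->; rewrite proj_PSLM // groupM.
Qed.

End SplitInvolutions.

Section NonsplitInvolutions.
Hypothesis no_i : forall i : F, i * i != -1.

Definition nzsquares : {set F} := [set c | (c != 0) && [exists s, c == s * s]].

Lemma nzsquareP c : reflect (c != 0 /\ exists s, c = s * s) (c \in nzsquares).
Proof.
rewrite inE; apply: (iffP andP) => [[c0 /existsP[s /eqP Dc]]|[c0 [s Dc]]].
  by split=> //; exists s.
by split=> //; apply/existsP; exists s; apply/eqP.
Qed.

Lemma nzsquaresN c : c \in nzsquares -> - c \notin nzsquares.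
Proof.
case/nzsquareP=> c0 [s Dc]; apply/negP=> /nzsquareP[_ [t Dt]].
have s0 : s != 0 by apply: contraNneq c0 => s0; rewrite Dc s0 mul0r.
by case/eqP: (no_i (t / s)); rewrite mulrACA -Dt -invfM -Dc mulNr divff.
Qed.

(** [-1] is an odd power of a generator of the multiplicative group. *)
Lemma nzsquares_or c : c != 0 -> (c \in nzsquares) || (- c \in nzsquares).
Proof.
move=> c0; have /cyclicP[g Dg] := @field_unit_group_cyclic F [set: {unit F}]%G.
have gP d : d != 0 -> exists k, d = val g ^+ k.
  move=> d0; have du : d \is a GRing.unit by rewrite unitfE.
  have : FinRing.unit F du \in <[g]>%g by rewrite -Dg inE.
  case/cycleP=> k /(congr1 val) /= Dd; exists k; rewrite Dd.
  by rewrite FinRing.val_unitX.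
have g0 : val g != 0 by have := valP g; rewrite unitfE.
have [k Dc] := gP c c0.
have [|l Dl] := gP (-1); first by rewrite oppr_eq0 oner_eq0.
have even_sq m : ~~ odd m -> val g ^+ m \in nzsquares.
  move=> em; apply/nzsquareP; rewrite expf_neq0 //; split=> //.
  by exists (val g ^+ m./2); rewrite -exprD addnn even_halfK.
case: (boolP (odd k)) => ok; last by rewrite Dc even_sq.
have ol : odd l.
  apply: contraT => /even_sq; rewrite -Dl => /nzsquareP[_ [s /esym/eqP]].
  by rewrite (negbTE (no_i s)).
by rewrite orbC -mulN1r Dl Dc -exprD even_sq // oddD ok ol.
Qed.

(** Inversion pairs the nonzero squares, except [1]. *)
Lemma odd_nzsquares : odd #|nzsquares|.
Proof.
rewrite (@odd_card_invol _ _ GRing.inv) => [|c /nzsquareP[c0 [s Dc]]|c _]; last first.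
- exact: invrK.
- by apply/nzsquareP; split; [rewrite invr_eq0 | exists s^-1; rewrite Dc invfM].
rewrite (_ : [set c in _ | _] = [set 1]) ?cards1 //; apply/setP=> c; rewrite !inE.
apply/andP/eqP=> [[sc /eqP cV]|->]; last first.
  by rewrite oner_eq0 invr1 eqxx; split=> //; apply/existsP; exists 1; rewrite mulr1.
have {}sc : c \in nzsquares by rewrite inE.
have c0 : c != 0 by case/nzsquareP: sc.
have : c ^+ 2 == 1 by rewrite expr2 -{2}cV divff.
rewrite sqrf_eq1 => /orP[] /eqP // c1; have := nzsquaresN sc.
rewrite c1 opprK; case/negP; apply/nzsquareP; rewrite oner_eq0; split=> //.
by exists 1; rewrite mulr1.
Qed.

Lemma odd_F : odd #|F|.
Proof.
rewrite -cardsT (@odd_card_invol _ _ -%R) => [|//|c _]; last exact: opprK.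
rewrite (_ : [set c in _ | _] = [set 0]) ?cards1 //; apply/setP=> c; rewrite !inE /=.
by rewrite eq_sym -addr_eq0 -mulr2n -mulr_natl mulf_eq0 (negbTE two_neq0).
Qed.

Definition signs : {set F} := [set 1; -1].

Lemma signs0 : 0 \notin signs.
Proof. by rewrite !inE eq_sym oner_eq0 eq_sym oppr_eq0 oner_eq0. Qed.
Lemma signsN1 : -1 \in signs. Proof. by rewrite !inE eqxx orbT. Qed.
Lemma signsM : {in signs &, forall a b, a * b \in signs}.
Proof.
by move=> a b; rewrite !inE => /orP[]/eqP-> /orP[]/eqP->;
  rewrite ?mulr1 ?mul1r ?mulrNN ?mulr1 eqxx ?orbT.
Qed.
Lemma signsV : {in signs, forall a, a^-1 \in signs}.
Proof. by move=> a; rewrite !inE => /orP[]/eqP->; rewrite ?invrN invr1 eqxx ?orbT. Qed.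

Local Notation half := (ray_of signs).
Local Notation half_act := (@ray_act F signs).
Local Notation half_scale := (@ray_scale F signs).
Local Notation half_eq := (ray_of_eq signs0 signsN1 signsM signsV).
Local Notation half_act_pt := (ray_act_pt signs0 signsN1 signsM signsV).
Local Notation half_actM := (ray_actM signs0 signsN1 signsM signsV).
Local Notation half_act1 := (ray_act1 signs0 signsN1 signsM signsV).
Local Notation half_scale_pt := (ray_scale_pt signs0 signsN1 signsM signsV).
Local Notation half_scale_act := (ray_scale_act signs0 signsN1 signsM signsV).

Lemma halfP v w : v != 0 -> w != 0 ->
  reflect (w = v \/ w = - v) (half v == half w).
Proof.
move=> v0 w0; apply: (iffP (half_eq v0 w0)) => [[c] | [->|->]].
- by rewrite !inE => /orP[] /eqP-> ->; [left; rewrite scale1r | right; rewrite scaleN1r].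
- by exists 1; rewrite ?scale1r // !inE eqxx.
by exists (-1); rewrite ?scaleN1r // !inE eqxx orbT.
Qed.

Lemma uval_neq0 (c : {unit F}) : val c != 0.
Proof. by have := valP c; rewrite unitfE. Qed.

(** The Borel subgroup of the line of [e] is parametrized by [F * nzsquares]: up to
   sign the diagonal entry is a square, because [-1] is not one.  This makes its
   order odd.  A lift of a nontrivial element of [N] has square [-1], so it has
   no eigenvector and moves the line of [e] ([inf_free]). *)
Lemma nonsplit_klein_case : (3 < #|F|)%N -> False.
Proof.
move=> F_gt3; pose e : 'rV[F]_2 := delta_mx 0 0.
have e0 : e != 0 := delta0_neq0 F.
have [f aef] := exists_area e0.
have nz : area e f != 0 by rewrite aef oner_eq0.
have coord v : v = area v f *: e + area e v *: f.
  by rewrite {1}(area_expand v nz) aef !divr1.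
pose Y := rays signs.
have [inf infP] : exists inf : pred Y,
    forall v, v != 0 -> inf (half v) = (area e v == 0).
  exists (fun y => [exists c, (c != 0) && (y == half (c *: e))]) => v v0.
  apply/existsP/eqP => [[c /andP[c0]]|/(area_eq0 e0)[c Dv]].
    have ce0 : c *: e != 0 by rewrite scaler_eq0 negb_or c0.
    move=> /(halfP v0 ce0)[] Dce; apply: (mulfI c0); rewrite mulr0 -areaZl Dce.
      exact: area_vv.
    by rewrite -scaleN1r areaZl area_vv mulr0.
  exists c; rewrite -Dv eqxx andbT; apply: contraNneq v0 => c0.
  by rewrite Dv c0 scale0r.
pose I : finType := (F * {t : F | t \in nzsquares})%type.
have /fin_all_exists[M HM] (i : I) : exists X, [/\ \det X = 1, e *m X = val i.2 *: e
    & f *m X = (val i.2)^-1 *: f + i.1 *: e].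
  have [t0 _] := nzsquareP _ (valP i.2).
  apply: sl2_basis nz _; set t := val i.2 in t0 *.
  by rewrite /area !mxE; field.
have /fin_all_exists[mu Hmu] (i : I) : exists u : {unit F}, val u = (val i.2)^-1.
  have [t0 _] := nzsquareP _ (valP i.2).
  have tu : (val i.2)^-1 \is a GRing.unit by rewrite unitfE invr_eq0.
  by exists (FinRing.unit F tu).
have [b Db] : exists b, forall i, b i = proj (M i) by exists (fun i => proj (M i)).
have valM (c d : {unit F}) : val (c * d)%g = val c * val d by [].
have val1 : val (1%g : {unit F}) = 1 by [].
have [sc Dsc] : exists sc, forall c : {unit F}, sc c = half_scale (val c).
  by exists (fun c => half_scale (val c)).
have scale_neq0 (c : {unit F}) (v : 'rV[F]_2) : v != 0 -> val c *: v != 0.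
  by move=> v0; rewrite scaler_eq0 negb_or uval_neq0.
have sc_pt c v : v != 0 -> sc c (half v) = half (val c *: v).
  by move=> v0; rewrite Dsc half_scale_pt ?uval_neq0.
have sc_act c y g : sc c (half_act y g) = half_act (sc c y) g.
  by rewrite Dsc; apply: half_scale_act; apply: uval_neq0.
have scM c d y : sc (c * d)%g y = sc c (sc d y).
  have [v v0 ->] := ray_of_surj y; rewrite !sc_pt ?scale_neq0 // scalerA.
  by rewrite valM.
have sc1 y : sc 1%g y = y.
  by have [v v0 ->] := ray_of_surj y; rewrite (sc_pt _ _ v0) val1 scale1r.
have inf_sc c y : inf (sc c y) = inf y.
  have [v v0 ->] := ray_of_surj y; rewrite (sc_pt _ _ v0) (infP _ v0) (infP _ (scale_neq0 c v v0)) areaZr.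
  by rewrite mulf_eq0 (negbTE (uval_neq0 c)).
have twist_pt i v : v != 0 -> sc (mu i) (half_act (half v) (b i)) =
    half ((area v f + area e v * i.1 / val i.2) *: e + (area e v / (val i.2 * val i.2)) *: f).
  move=> v0; have [dM eM fM] := HM i; have [t0 _] := nzsquareP _ (valP i.2).
  rewrite Db (half_act_pt v0 dM) (sc_pt _ _ (mulmx_det1_neq0 dM v0)) Hmu; congr (half _).
  rewrite {1}(coord v) mulmxDl -!scalemxAl eM fM; set t := val i.2 in t0 *.
  by apply: rv2P; rewrite !mxE; field.
have inf_b i y : inf (half_act y (b i)) = inf y.
  have [v v0 ->] := ray_of_surj y; have [dM eM fM] := HM i.
  rewrite Db (half_act_pt v0 dM) (infP _ (mulmx_det1_neq0 dM v0)) (infP _ v0).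
  have [t0 _] := nzsquareP _ (valP i.2).
  have : area (e *m M i) (v *m M i) = area e v by rewrite area_mul dM mul1r.
  by rewrite eM areaZl => <-; rewrite mulf_eq0 (negbTE t0).
have inf_free y v : v \in N -> inf y -> inf (half_act y v) -> v = 1%g.
  have [w w0 ->] := ray_of_surj y; rewrite (infP _ w0) => Nv /eqP ew.
  have [X dX Dv] := proj_PSL_surj v; rewrite Dv (half_act_pt w0 dX).
  rewrite (infP _ (mulmx_det1_neq0 dX w0)) => /eqP ewX; apply/eqP; apply: contraT => v1.
  have X2 : X *m X = - 1%:M by apply: (klein_lift Nv _ dX Dv); rewrite Dv.
  have [c Dw] := area_eq0 e0 ew; have [d DwX] := area_eq0 e0 ewX.
  have c0 : c != 0 by apply: contraNneq w0 => c0; rewrite Dw c0 scale0r.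
  have eX : e *m X = (d / c) *: e.
    by apply: (scalerI c0); rewrite scalemxAl -Dw DwX scalerA mulrC divfK.
  have : e *m (X *m X) = - e by rewrite X2 mulmxN mulmx1.
  rewrite mulmxA eX -scalemxAl eX scalerA -scaleN1r => /eqP.
  rewrite -subr_eq0 -scalerBl scaler_eq0 (negbTE e0) orbF subr_eq0.
  by rewrite (negbTE (no_i _)).
have inf_fix i y : inf y -> sc (mu i) (half_act y (b i)) = y.
  have [v v0 ->] := ray_of_surj y; rewrite (infP _ v0) => /eqP ev.
  rewrite (twist_pt _ _ v0) ev !mul0r addr0 scale0r addr0; congr half.
  by rewrite [RHS]coord ev scale0r addr0.
(* Outside the line of e, exactly one Borel element followed by its scalar
   takes y to y'; its diagonal entry t is determined by area e v = area e v'
   * t ^+ 2, after choosing the sign of v'. *)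
have noninf_reg y y' : ~~ inf y -> ~~ inf y' ->
    odd #|[set i | sc (mu i) (half_act y (b i)) == y']|.
  have [v v0 ->] := ray_of_surj y; have [v'' v''0 ->] := ray_of_surj y'.
  rewrite (infP _ v0) (infP _ v''0) => ev ev''.
  have [v' [v'0 ->] sq] : exists2 v', v' != 0 /\ half v'' = half v' &
      area e v / area e v' \in nzsquares.
    have /nzsquares_or/orP[sq|sq] : area e v / area e v'' != 0.
    - by rewrite mulf_neq0 // invr_eq0.
    - by exists v''.
    exists (- v''); last by rewrite -scaleN1r areaZr mulN1r invrN mulrN.
    split; first by rewrite oppr_eq0.
    by apply/eqP/halfP; rewrite ?oppr_eq0 //; right.
  have ev' : area e v' != 0.
    by case/nzsquareP: sq => + _; apply: contraNneq => ->; rewrite invr0 mulr0.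
  have [t tsq t2] : exists2 t, t \in nzsquares & area e v = area e v' * (t * t).
    case/nzsquareP: sq => r0 [r Dr].
    have rnz : r != 0 by apply: contraNneq r0 => r1; rewrite Dr r1 mul0r.
    have Dev : area e v = area e v' * (r * r) by rewrite -Dr mulrC divfK.
    by case/orP: (nzsquares_or rnz) => rs; [exists r | exists (- r)]; rewrite // mulrNN.
  have [t0 _] := nzsquareP _ tsq.
  pose i0 : I := ((area v' f - area v f) * t / area e v, exist _ t tsq).
  rewrite (_ : [set i | _] = [set i0]) ?cards1 //; apply/setP=> i; rewrite !inE.
  have [s0 _] := nzsquareP _ (valP i.2).
  rewrite (twist_pt _ _ v0); set u := _ + _.
  have eu : area e u = area e v / (val i.2 * val i.2).
    by rewrite /u areaDr !areaZr area_vv mulr0 add0r aef mulr1.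
  have uf : area u f = area v f + area e v * i.1 / val i.2.
    by rewrite /u areaDl !areaZl area_vv mulr0 addr0 aef mulr1.
  have u0 : u != 0.
    apply: contraNneq ev => u0; move: eu; rewrite u0 -(scale0r e) areaZr mul0r => /esym/eqP.
    rewrite mulf_eq0 invr_eq0 mulf_eq0 (negbTE s0) !orbF.
    by [].
  apply/(halfP u0 v'0)/eqP => [Du | Di]; last first.
    left; rewrite [LHS]coord [RHS]coord eu uf Di /i0 /= t2; congr (_ *: _ + _ *: _).
      by field; rewrite t0 ev'.
    by field.
  have sgn (ep : F) : v' = ep *: u -> ep * (t * t) = val i.2 * val i.2 /\ area v' f = ep * (area v f + area e v * i.1 / val i.2).
    move=> Dv'; split; last by rewrite Dv' areaZl uf.
    apply: (mulfI ev'); rewrite mulrCA -t2 Dv' areaZr eu.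
    by field.
  have [Dt Df] : t * t = val i.2 * val i.2 /\ area v' f = area v f + area e v * i.1 / val i.2.
    case: Du => Du.
      by have := sgn 1; rewrite scale1r !mul1r => /(_ Du).
    have [|h1 _] := sgn (-1); first by rewrite scaleN1r.
    case/eqP: (no_i (val i.2 / t)); rewrite mulrACA -h1 -invfM mulN1r mulNr divff //.
    by rewrite mulf_neq0.
  have Di2 : val i.2 = t.
    move/eqP: Dt; rewrite -!expr2 eqf_sqr => /orP[] /eqP Dt //.
    by have := nzsquaresN (valP i.2); rewrite -Dt tsq.
  case: i Df Di2 {u u0 Du eu uf sgn Dt s0} => [s [t' t's]] /= Df Dt'.
  congr pair; last exact: val_inj.
  by rewrite Df Dt'; field; rewrite ev t0.
(* The order is q (q - 1) / 2, and (q - 1) / 2 is odd. *)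
have odd_I : odd #|{: I}|.
  by rewrite card_prod card_sig oddM odd_F /= odd_nzsquares.
have [l Hl] : exists l : {unit F}, (val l != 1) && (val l != -1).
  have [c c1] : exists c : F, c \notin [:: 0; 1; -1].
    apply/existsP; apply: contraLR F_gt3 => /existsPn all3; rewrite -leqNgt cardE.
    apply: (@uniq_leq_size _ (enum F) [:: 0; 1; -1]) (enum_uniq _) _ => c _.
    by have := all3 c; rewrite negbK.
  rewrite !inE !negb_or in c1; case/and3P: c1 => c0 c1 cN1.
  have cu : c \is a GRing.unit by rewrite unitfE.
  by exists (FinRing.unit F cu); rewrite /= c1 cN1.
have l_fix y : inf y -> sc l y != y.
  have [v v0 ->] := ray_of_surj y; move=> _; rewrite (sc_pt _ _ v0) eq_sym.
  apply/(halfP v0 (scale_neq0 l v v0)).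
  case/andP: Hl => l1 lN1 [] /eqP.
    rewrite -{2}[v]scale1r -subr_eq0 -scalerBl scaler_eq0 (negbTE v0) orbF subr_eq0.
    by rewrite (negbTE l1).
  rewrite -{2}[v]scale1r -scaleNr -subr_eq0 -scalerBl scaler_eq0 (negbTE v0) orbF subr_eq0.
  by rewrite (negbTE lN1).
have odd_inf : odd #|[set y | inf y]|.
  have sq0 c : c \in nzsquares -> c *: e != 0.
    by case/nzsquareP=> c0 _; rewrite scaler_eq0 negb_or c0.
  rewrite (_ : [set y | inf y] = [set half (c *: e) | c in nzsquares]).
    rewrite card_in_imset ?odd_nzsquares // => c d sqc sqd /eqP.
    move/(halfP (sq0 c sqc) (sq0 d sqd)); rewrite -scaleNr => Dd.
    have eK a1 a2 : a1 *: e = a2 *: e -> a1 = a2 by apply: scale_vec_inj.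
    case: Dd => /eK Dd; first by rewrite Dd.
    by have := nzsquaresN sqc; rewrite -Dd sqd.
  apply/setP=> y; rewrite inE; have [v v0 ->] := ray_of_surj y; rewrite (infP _ v0).
  apply/eqP/imsetP => [/(area_eq0 e0)[c Dv] | [c sqc /eqP]].
    have c0 : c != 0 by apply: contraNneq v0 => c0; rewrite Dv c0 scale0r.
    case/orP: (nzsquares_or c0) => sqc; first by exists c; rewrite // Dv.
    exists (- c) => //; apply/eqP/(halfP v0 (sq0 _ sqc)); right.
    by rewrite scaleNr Dv.
  case/(halfP v0 (sq0 c sqc)) => /(congr1 (area e)).
    by rewrite areaZr area_vv mulr0.
  rewrite areaZr area_vv mulr0 -scaleN1r areaZr mulN1r => /esym/eqP.
  by rewrite oppr_eq0 => /eqP.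
have [s [t [c odd_d]]] := twisted_fix_triples half_actM half_act1 scM sc1 sc_act
  inf_sc inf_b inf_free inf_fix noninf_reg odd_I l_fix odd_inf.
have := prime_dvdn_fix_triples s t good (isT : prime 2) klein_even half_actM half_act1 (sc_act c).
by rewrite dvdn2 odd_d.
Qed.

End NonsplitInvolutions.

End KleinCases.

Theorem corollary5p6 (R : realType) (p m : nat) (F : finFieldType)
    (p_prime : prime p) (m_ge1 : (1 <= m)%N)
    (m_gt1 : p = 2%N \/ p = 3%N -> (1 < m)%N)
    (cardF : #|F| = (p ^ m)%N)
    (M : {group PSL2 F}) (abM : abelian M)
    (omega : dual R[i] M -> dual R[i] M -> R[i])
    (omega_cocycle : normalized_2cocycle omega)
    (omega_nontrivial : ~ is_2coboundary omega)
    (L : fieldExtType rat) (iota : {rmorphism L -> R[i]}) :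
  ~ admits_hopf_order (iota \o (\val : ring_of_integers L -> L))
      (twisted_group_algebra (twist omega)).
Proof.
move=> /(hopf_order_fix_triples abM omega_cocycle omega_nontrivial).
case=> N [sNM ncyc good].
have pcharF : p \in [pchar F] := card_finPcharP cardF p_prime.
have abN : abelian N := abelianS sNM abM.
have ntN : N :!=: 1%g by apply: contraNneq ncyc => ->; apply: cyclic1.
have [[v0 v0nz fixN]|[A [B [[dA dB] anti ncomm NA NB]]]] := abelian_PSL2_cases abN ncyc.
  exact: (unipotent_case good pcharF v0nz ntN fixN).
have p_odd : p != 2%N.
  apply: contraNneq (two_neq0 anti ncomm) => p2.
  by rewrite -(pcharf0 pcharF) p2.
have odd_p : odd p.
  by case: (even_prime p_prime) => // p2; rewrite p2 in p_odd.
(* The field with three elements is excluded by hypothesis on m, and the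
   characteristic is odd. *)
have F_gt3 : (3 < #|F|)%N.
  have p_gt2 : (2 < p)%N by rewrite ltn_neqAle eq_sym p_odd prime_gt1.
  rewrite cardF; have [p3|p3] := eqVneq p 3%N.
    have m2 : (1 < m)%N by apply: m_gt1; right.
    by rewrite p3; apply: leq_trans (_ : 3 ^ 2 <= _)%N; rewrite ?leq_exp2l.
  apply: leq_trans (_ : p ^ 1 <= _)%N; last by rewrite leq_exp2l // prime_gt1.
  by rewrite expn1 ltn_neqAle eq_sym p3.
case: (pselect (exists i : F, i * i = -1)) => [[i i2]|no_i].
  have [F5|F5] := eqVneq #|F| 5%N.
    exact: (klein_F5_case good abN dA dB anti ncomm NA NB i2 F5).
  apply: (split_klein_case good abN dA dB anti ncomm NA NB i2).
  rewrite ltn_neqAle eq_sym F5 /= ltn_neqAle F_gt3 andbT eq_sym cardF.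
  apply/eqP => pm4; have : odd 4 by rewrite -pm4 oddX odd_p orbT.
  by [].
apply: (nonsplit_klein_case good abN dA dB anti ncomm NA NB _ F_gt3).
by move=> i; apply/eqP => i2; case: no_i; exists i.
Qed.
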